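(* Let $f(z)=\sum_{n=0}^{\infty}a_n e(nz)$ be a modular form of weight $r$ with respect to a congruence group $\Gamma$ for which the cusp at $i\infty$ has width $1$. Consider $f_\alpha(x)=\sum_{n=1}^\infty \frac{a_n}{n^\alpha}e(nx)$ with $\alpha>r>0$ and $1+\lfloor\alpha-r\rfloor\le\alpha$. If $f$ is not cuspidal at the irreducible fraction $p/q$, then the pointwise Hölder exponent of $f_\alpha$ at $p/q$ is $$\beta(p/q)=\alpha-r.$$
   Context: Notation: $e(x)=e^{2\pi i x}$. For $\alpha>r$ the series defining $f_\alpha$ is understood as the limit of its partial sums, which converge uniformly on $\mathbb{R}$, so $f_\alpha$ is continuous. Modular forms: $\Gamma$ is a congruence group, i.e. $\Gamma(N)<\Gamma<\mathrm{SL}_2(\mathbb{Z})$ for some principal congruence subgroup $\Gamma(N)$. A modular form of weight $r>0$ (real) with respect to $\Gamma$ is a function $f$, holomorphic on the upper half plane and at the cusps of $\Gamma$, with $f(\gamma z)=m_\gamma\,(j_\gamma(z))^r f(z)$ for all $\gamma\in\Gamma$, where $m_\gamma$ is a multiplier system with $|m_\gamma|=1$ and $j_\gamma(z)$ is the denominator of the linear fractional transformation $\gamma$ (i.e. $j_\gamma(z)=cz+d$ if $(c,d)$ is the bottom row of $\gamma$). It is assumed that the width of the cusp at $i\infty$ is $1$, so that the integral translations belong to $\Gamma$ and $f(z)=\sum_{n\ge0}a_n e(nz)$. Cuspidality: for a modular form $f$ of weight $r$ and a rational $p/q$, either $f(p/q+iy)=o(y^{-r})$ as $y\to0^+$, in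 which case $f$ is called cuspidal at $p/q$, or $y^r f(p/q+iy)\to C$ for some $C\ne0$ as $y\to0^+$, in which case $f$ is called not cuspidal at $p/q$. Pointwise Hölder exponent: for $s\ge 0$, $C^s(x_0)$ is the set of continuous functions $g:\mathbb{R}\to\mathbb{C}$ for which there is a polynomial $P$ of degree at most $s$ with $|g(x)-P(x-x_0)|=O(|x-x_0|^s)$ as $x\to x_0$; the pointwise Hölder exponent of $g$ at $x_0$ is $\beta(x_0)=\sup\{s\ge0: g\in C^s(x_0)\}$. *)

(* Defs.v *)
From Stdlib Require Import Reals ZArith.
From Coquelicot Require Import Coquelicot.

Open Scope R_scope.

(** * Complex functions *)

Definition Cexp (z : C) : C := (exp (Re z) * cos (Im z), exp (Re z) * sin (Im z)).

Definition e (z : C) : C := Cexp (RtoC (2 * PI) * Ci * z)%C.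

(* Principal argument, in (-PI, PI]; only meaningful for z <> 0. *)
Definition Carg (z : C) : R :=
  if Rle_dec 0 (Im z) then acos (Re z / Cmod z) else - acos (Re z / Cmod z).

(* z^s for a real exponent s, principal branch; only meaningful for z <> 0. *)
Definition Crpow (z : C) (s : R) : C :=
  (Rpower (Cmod z) s * cos (s * Carg z), Rpower (Cmod z) s * sin (s * Carg z)).

(* Sum of a complex series, i.e. the limit of its partial sums when they converge. *)
Definition CSeries (u : nat -> C) : C :=
  (Series (fun n => Re (u n)), Series (fun n => Im (u n))).

(** * Congruence groups *)

Record mat2 : Set := Mat2 { m11 : Z; m12 : Z; m21 : Z; m22 : Z }.

Definition mat2_id : mat2 := Mat2 1 0 0 1.

Definition mat2_mul (g h : mat2) : mat2 :=
  Mat2 (m11 g * m11 h + m12 g * m21 h) (m11 g * m12 h + m12 g * m22 h)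
       (m21 g * m11 h + m22 g * m21 h) (m21 g * m12 h + m22 g * m22 h).

(* The adjugate, which is the inverse when the determinant is 1. *)
Definition mat2_inv (g : mat2) : mat2 := Mat2 (m22 g) (- m12 g) (- m21 g) (m11 g).

Definition translation (h : Z) : mat2 := Mat2 1 h 0 1.

Definition SL2Z (g : mat2) : Prop := (m11 g * m22 g - m12 g * m21 g)%Z = 1%Z.

Definition principal_congruence (N : Z) (g : mat2) : Prop :=
  SL2Z g /\ (N | m11 g - 1)%Z /\ (N | m12 g)%Z /\ (N | m21 g)%Z /\ (N | m22 g - 1)%Z.

Definition subgroup_SL2Z (G : mat2 -> Prop) : Prop :=
  (forall g, G g -> SL2Z g) /\
  G mat2_id /\
  (forall g h, G g -> G h -> G (mat2_mul g h)) /\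
  (forall g, G g -> G (mat2_inv g)).

Definition congruence_group (G : mat2 -> Prop) : Prop :=
  subgroup_SL2Z G /\
  exists N : Z, (0 < N)%Z /\ forall g, principal_congruence N g -> G g.

(* h is the width of the cusp g(i oo) of G. The translation itself, not just
   up to sign, has to belong to the conjugate of G. *)
Definition cusp_width (G : mat2 -> Prop) (g : mat2) (h : Z) : Prop :=
  let conj k := mat2_mul (mat2_mul g (translation k)) (mat2_inv g) in
  (0 < h)%Z /\ G (conj h) /\ forall k, (0 < k < h)%Z -> ~ G (conj k).

(** * Modular forms of real weight *)

Definition upper_half_plane (z : C) : Prop := 0 < Im z.

Definition moebius (g : mat2) (z : C) : C :=
  ((RtoC (IZR (m11 g)) * z + RtoC (IZR (m12 g))) /
   (RtoC (IZR (m21 g)) * z + RtoC (IZR (m22 g))))%C.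

Definition j_factor (g : mat2) (z : C) : C :=
  (RtoC (IZR (m21 g)) * z + RtoC (IZR (m22 g)))%C.

(* The branch used in Crpow is immaterial: for a given g, another branch changes
   j_factor g z ^ r by a unimodular constant, which the multiplier absorbs. *)
Definition multiplier_system (G : mat2 -> Prop) (r : R) (m : mat2 -> C) : Prop :=
  (forall g, G g -> Cmod (m g) = 1) /\
  (forall g h z, G g -> G h -> upper_half_plane z ->
     (m (mat2_mul g h) * Crpow (j_factor (mat2_mul g h) z) r)%C =
     (m g * m h * Crpow (j_factor g (moebius h z)) r * Crpow (j_factor h z) r)%C).

Definition holomorphic_H (f : C -> C) : Prop :=
  forall z, upper_half_plane z ->
    ex_derive (K := C_AbsRing) (V := C_NormedModule) f z.

Definition slash (f : C -> C) (r : R) (g : mat2) (z : C) : C :=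
  (Crpow (j_factor g z) (- r) * f (moebius g z))%C.

(* At the cusp g(i oo) of width h, slash f r g is multiplied by a unimodular
   constant e(kappa) under z |-> z + h; holomorphy at the cusp means that
   its expansion in the powers e((n + kappa) z / h) has no negative exponent. *)
Definition holomorphic_at_cusps (G : mat2 -> Prop) (r : R) (f : C -> C) : Prop :=
  forall g, SL2Z g ->
    exists (h : Z) (kappa : R) (b : nat -> C),
      cusp_width G g h /\ 0 <= kappa < 1 /\
      forall z, upper_half_plane z ->
        is_series (K := C_AbsRing) (V := C_NormedModule)
          (fun n => (b n * e (RtoC ((INR n + kappa) / IZR h) * z))%C)
          (slash f r g z).

Definition modular_form (G : mat2 -> Prop) (r : R) (f : C -> C) : Prop :=
  holomorphic_H f /\
  holomorphic_at_cusps G r f /\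
  exists m : mat2 -> C, multiplier_system G r m /\
    forall g z, G g -> upper_half_plane z ->
      f (moebius g z) = (m g * Crpow (j_factor g z) r * f z)%C.

Definition fourier_expansion (f : C -> C) (a : nat -> C) : Prop :=
  forall z, upper_half_plane z ->
    is_series (K := C_AbsRing) (V := C_NormedModule)
      (fun n => (a n * e (RtoC (INR n) * z))%C) (f z).

Definition not_cuspidal_at (f : C -> C) (r x : R) : Prop :=
  exists c : C, c <> RtoC 0 /\
    filterlim (fun y : R => (RtoC (Rpower y r) * f (x, y))%C)
      (at_right 0) (locally c).

(* The series over n >= 1 is indexed from 0, hence the shift. *)
Definition f_alpha (a : nat -> C) (alpha x : R) : C :=
  CSeries (fun n =>
    (a (S n) / RtoC (Rpower (INR (S n)) alpha) * e (RtoC (INR (S n) * x)))%C).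

(** * Pointwise Hoelder exponent *)

Definition Cpoly_eval (d : nat) (c : nat -> C) (t : R) : C :=
  sum_n (fun k => (c k * RtoC t ^ k)%C) d.

(* The bound is asked on a punctured neighbourhood because Rpower 0 s = 1; at
   x0 itself the case s > 0 follows by continuity. *)
Definition Holder_class (s x0 : R) (g : R -> C) : Prop :=
  (forall x, continuous g x) /\
  exists (d : nat) (c : nat -> C), INR d <= s /\
  exists K : R,
    locally' x0 (fun x =>
      Cmod (g x - Cpoly_eval d c (x - x0))%C <= K * Rpower (Rabs (x - x0)) s).

Definition Holder_exponent (g : R -> C) (x0 : R) : Rbar :=
  Lub_Rbar (fun s => 0 <= s /\ Holder_class s x0 g).

(* Main.v *)
Require Import Defs.
From Stdlib Require Import Reals ZArith Lra Lia Classical.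
From Coquelicot Require Import Coquelicot.

Open Scope R_scope.

(** Write x0 = p/q and e(t) = exp(2 pi i t).  Everything rests on the growth bound
    |f(x + iy)| <= B y^(-r) for 0 < y <= 1 ([modular_form_growth]), which holds because y^(r/2) |f|
    is the height-weighted modulus of a slash of f at a point of height at least 1/2, and only
    finitely many slashes of f differ in modulus.

    That exponents below alpha - r are attained.  Integrating f(x + t + i/n) against a Dirichlet
    kernel turns the growth bound into a bound O(n^rho), for any rho > r and uniformly in x, for
    the sums of a_m e(mx) over m < n ([fourier_sum_growth]).  Summation by parts ([abel_bound])
    then controls all sums of a_m m^tau e(mx): their tails if rho + tau < 0, their initial parts
    if rho + tau > 0.  For s = alpha - rho between k and k + 1, cut the series of
    f_alpha(x0 + t) at M ~ 1/|t|: the tail is O(M^(-s)), and the initial part is a smooth function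
    whose derivative of order k + 1 is O(M^(k+1-s)), so that Taylor's formula leaves an error
    O(|t|^s) ([f_alpha_taylor]).  This works at every real point, and also gives continuity.

    That no larger exponent is attained.  The values of f above x0 are recovered from f_alpha by a
    convolution:
      f(x0 + iy) - a_0 = int_{-1/2}^{1/2} f_alpha(x0 + t) K_y(t) dt,
      K_y(t) = sum_n n^alpha exp(-2 pi n y) e(-nt).
    The kernel satisfies |K_y(t)| <= D (|t| + y)^(-alpha-1) ([abel_kernel]), because a power series
    with coefficients n^alpha is O(|1 - z|^(-alpha-1)) in the unit disc ([power_series_bound]).
    Suppose that f_alpha(x0 + t) is a polynomial in t up to O(|t|^s).  The polynomial is not
    periodic, but a trigonometric polynomial agrees with it to the order |t|^s
    ([polynomial_trig_approx]); the latter contributes a bounded amount to the convolution, whatever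
    y is, and the remainder contributes O(y^(s-alpha)) as long as s < alpha
    ([form_bound_of_Holder]).  If s > alpha - r this forces y^r f(x0 + iy) to tend to 0, against
    the hypothesis that f is not cuspidal at x0 ([not_cuspidal_lower_bound]). *)

(** * Finite sums and limits in the complex plane *)

Lemma Cmod_minus_sym (x y : C) : Cmod (x - y)%C = Cmod (y - x)%C.
Proof. rewrite <- (Cmod_opp (x - y)). f_equal. ring. Qed.

Lemma Cmod_minus_triangle (x y z : C) : Cmod (x - z)%C <= Cmod (x - y)%C + Cmod (y - z)%C.
Proof.
  replace (x - z)%C with ((x - y) + (y - z))%C by ring. apply Cmod_triangle.
Qed.

Lemma Cmod_minus_le (x y : C) : Cmod (x - y)%C <= Cmod x + Cmod y.
Proof. unfold Cminus. rewrite <- (Cmod_opp y). apply Cmod_triangle. Qed.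

Lemma im_le_Cmod (c : C) : Rabs (Im c) <= Cmod c.
Proof. eapply Rle_trans; [apply Rmax_r|apply Rmax_Cmod]. Qed.

Lemma Cmod_le_re_im (c : C) : Cmod c <= Rabs (Re c) + Rabs (Im c).
Proof.
  apply Rsqr_incr_0_var.
  - rewrite !Rsqr_pow2, Cmod2_alt.
    assert (H1 := pow2_abs (Re c)). assert (H2 := pow2_abs (Im c)).
    assert (H3 := Rabs_pos (Re c)). assert (H4 := Rabs_pos (Im c)). nra.
  - assert (H3 := Rabs_pos (Re c)). assert (H4 := Rabs_pos (Im c)). lra.
Qed.

(** The range is half open, so that the empty sum is a value of the function and differences of
    two sums are sums over blocks. *)
Fixpoint csum (u : nat -> C) (n : nat) : C :=
  match n with O => RtoC 0 | S k => (csum u k + u k)%C end.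

Lemma csum_ext (u v : nat -> C) (n : nat) :
  (forall i, (i < n)%nat -> u i = v i) -> csum u n = csum v n.
Proof.
  induction n as [|n IH]; intros H; simpl; [reflexivity|].
  rewrite IH by (intros; apply H; lia). rewrite H by lia. reflexivity.
Qed.

Lemma csum_plus (u v : nat -> C) (n : nat) :
  csum (fun i => u i + v i)%C n = (csum u n + csum v n)%C.
Proof. induction n as [|n IH]; simpl; [ring|rewrite IH; ring]. Qed.

Lemma csum_scal (c : C) (u : nat -> C) (n : nat) :
  csum (fun i => c * u i)%C n = (c * csum u n)%C.
Proof. induction n as [|n IH]; simpl; [ring|rewrite IH; ring]. Qed.

Lemma csum_zero (u : nat -> C) (n : nat) :
  (forall i, (i < n)%nat -> u i = RtoC 0) -> csum u n = RtoC 0.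
Proof.
  induction n as [|n IH]; intros H; simpl; [reflexivity|].
  rewrite IH by (intros; apply H; lia). rewrite H by lia. ring.
Qed.

Lemma csum_eventually_zero (u : nat -> C) (m n : nat) :
  (m <= n)%nat -> (forall i, (m <= i)%nat -> u i = RtoC 0) -> csum u n = csum u m.
Proof.
  intros Hmn H. induction Hmn as [|n Hmn IH]; [reflexivity|].
  simpl. rewrite IH, H by lia. ring.
Qed.

Lemma csum_first (u : nat -> C) (n : nat) :
  csum u (S n) = (u O + csum (fun i => u (S i)) n)%C.
Proof.
  induction n as [|n IH]; [simpl; ring|].
  change (csum u (S (S n))) with (csum u (S n) + u (S n))%C.
  rewrite IH. simpl. ring.
Qed.

Lemma csum_split (u : nat -> C) (m n : nat) :
  csum u (m + n) = (csum u m + csum (fun i => u (m + i)%nat) n)%C.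
Proof.
  induction n as [|n IH].
  - rewrite Nat.add_0_r. simpl. ring.
  - rewrite Nat.add_succ_r. simpl. rewrite IH. ring.
Qed.

(** The majorant enters through a primitive [B], of which the terms of the majorant are the
    increments.  Majorants such as rho^n and n^(s-1) come with primitives in closed form, so no
    real sums have to be evaluated. *)
Lemma telescope_bound (u : nat -> C) (B : nat -> R) (m n : nat) :
  (m <= n)%nat ->
  (forall i, (m <= i < n)%nat -> Cmod (u (S i) - u i)%C <= B (S i) - B i) ->
  Cmod (u n - u m)%C <= B n - B m.
Proof.
  intros Hmn. induction Hmn as [|n Hmn IH]; intros H.
  - replace (u m - u m)%C with (RtoC 0) by ring. rewrite Cmod_0. lra.
  - eapply Rle_trans; [apply (Cmod_minus_triangle _ (u n))|].
    specialize (IH ltac:(intros; apply H; lia)). specialize (H n ltac:(lia)). lra.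
Qed.

Lemma csum_telescope_bound (u : nat -> C) (B : nat -> R) (m n : nat) :
  (m <= n)%nat ->
  (forall i, (m <= i < n)%nat -> Cmod (u i) <= B (S i) - B i) ->
  Cmod (csum u n - csum u m)%C <= B n - B m.
Proof.
  intros Hmn H. apply telescope_bound; [exact Hmn|]. intros i Hi. simpl.
  replace (csum u i + u i - csum u i)%C with (u i) by ring. now apply H.
Qed.

Lemma csum_const_bound (u : nat -> C) (b : R) (n : nat) :
  (forall i, (i < n)%nat -> Cmod (u i) <= b) -> Cmod (csum u n) <= INR n * b.
Proof.
  intros H.
  replace (csum u n) with (csum u n - csum u 0)%C by (simpl; ring).
  replace (INR n * b) with (INR n * b - INR 0 * b) by (simpl; ring).
  apply (csum_telescope_bound u (fun i => INR i * b)); [lia|].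
  intros i Hi. rewrite S_INR. specialize (H i ltac:(lia)). lra.
Qed.

Definition Clim (u : nat -> C) (l : C) : Prop := is_lim_seq (fun n => Cmod (u n - l)%C) 0.

Lemma is_lim_seq_zero_squeeze (u v : nat -> R) :
  (forall n, 0 <= u n <= v n) -> is_lim_seq v 0 -> is_lim_seq u 0.
Proof.
  intros H Hv. apply is_lim_seq_le_le with (u := fun _ => 0) (w := v); auto.
  apply is_lim_seq_const.
Qed.

Lemma Clim_squeeze (u : nat -> C) (l : C) (d : nat -> R) :
  (forall n, Cmod (u n - l)%C <= d n) -> is_lim_seq d 0 -> Clim u l.
Proof.
  intros H Hd. apply is_lim_seq_zero_squeeze with d; auto.
  intros n. split; [apply Cmod_ge_0|apply H].
Qed.

Lemma Clim_ext (u v : nat -> C) (l : C) : (forall n, u n = v n) -> Clim u l -> Clim v l.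
Proof. intros H. apply is_lim_seq_ext. intros n. now rewrite H. Qed.

Lemma Clim_const (c : C) : Clim (fun _ => c) c.
Proof.
  unfold Clim. apply is_lim_seq_ext with (fun _ => 0); [|apply is_lim_seq_const].
  intros _. replace (c - c)%C with (RtoC 0) by ring. now rewrite Cmod_0.
Qed.

Lemma Clim_plus (u v : nat -> C) (l m : C) :
  Clim u l -> Clim v m -> Clim (fun n => u n + v n)%C (l + m)%C.
Proof.
  intros Hu Hv. apply Clim_squeeze with (fun n => Cmod (u n - l)%C + Cmod (v n - m)%C).
  - intros n. replace (u n + v n - (l + m))%C with ((u n - l) + (v n - m))%C by ring.
    apply Cmod_triangle.
  - replace 0 with (0 + 0) by ring. now apply is_lim_seq_plus'.
Qed.

Lemma Clim_scal (c : C) (u : nat -> C) (l : C) :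
  Clim u l -> Clim (fun n => c * u n)%C (c * l)%C.
Proof.
  intros Hu. unfold Clim.
  apply is_lim_seq_ext with (fun n => Cmod c * Cmod (u n - l)%C).
  - intros n. rewrite <- Cmod_mult. f_equal. ring.
  - replace 0 with (Cmod c * 0) by ring. now apply (is_lim_seq_scal_l _ _ 0).
Qed.

Lemma Clim_incr (u : nat -> C) (l : C) (k : nat) :
  Clim (fun n => u (n + k)%nat) l <-> Clim u l.
Proof.
  unfold Clim. symmetry. apply (is_lim_seq_incr_n (fun n => Cmod (u n - l)%C)).
Qed.

Lemma Clim_bound (u : nat -> C) (l z : C) (b : R) :
  Clim u l -> eventually (fun n => Cmod (u n - z)%C <= b) -> Cmod (l - z)%C <= b.
Proof.
  intros Hu Hb.
  assert (H : is_lim_seq (fun n => Cmod (u n - l)%C + b) (0 + b)).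
  { apply is_lim_seq_plus'; [exact Hu|apply is_lim_seq_const]. }
  rewrite Rplus_0_l in H.
  refine (is_lim_seq_le_loc (fun _ => Cmod (l - z)%C) _ _ _ _ (is_lim_seq_const _) H).
  destruct Hb as [N HN]. exists N. intros n Hn. specialize (HN n Hn).
  rewrite (Cmod_minus_sym (u n) l). assert (T := Cmod_minus_triangle l (u n) z). lra.
Qed.

Lemma Clim_bound0 (u : nat -> C) (l : C) (b : R) :
  Clim u l -> eventually (fun n => Cmod (u n) <= b) -> Cmod l <= b.
Proof.
  intros Hu [N Hb]. replace l with (l - RtoC 0)%C by ring.
  apply (Clim_bound u); auto. exists N. intros n Hn.
  replace (u n - 0)%C with (u n) by ring. auto.
Qed.

Lemma Clim_unique (u : nat -> C) (l m : C) : Clim u l -> Clim u m -> l = m.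
Proof.
  intros Hl Hm.
  assert (Clim (fun _ => RtoC 0) (l + RtoC (-1) * m)%C).
  { apply Clim_ext with (fun n => u n + RtoC (-1) * u n)%C; [intros n; ring|].
    apply Clim_plus; [auto|now apply Clim_scal]. }
  assert (Cmod (l + RtoC (-1) * m)%C <= 0).
  { apply (Clim_bound0 _ _ _ H). exists O. intros _ _. rewrite Cmod_0. lra. }
  assert (E : (l + RtoC (-1) * m)%C = RtoC 0).
  { apply Cmod_eq_0. assert (T := Cmod_ge_0 (l + RtoC (-1) * m)%C). lra. }
  replace l with ((l + RtoC (-1) * m) + m)%C by ring. rewrite E. ring.
Qed.

Lemma Clim_Re (u : nat -> C) (l : C) : Clim u l -> is_lim_seq (fun n => Re (u n)) (Re l).
Proof.
  intros H. apply is_lim_seq_spec. intros eps.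
  apply is_lim_seq_spec in H. destruct (H eps) as [N HN]. exists N. intros n Hn.
  specialize (HN n Hn). rewrite Rminus_0_r, Rabs_pos_eq in HN by apply Cmod_ge_0.
  eapply Rle_lt_trans; [|exact HN]. apply (re_le_Cmod (u n - l)%C).
Qed.

Lemma Clim_Im (u : nat -> C) (l : C) : Clim u l -> is_lim_seq (fun n => Im (u n)) (Im l).
Proof.
  intros H. apply is_lim_seq_spec. intros eps.
  apply is_lim_seq_spec in H. destruct (H eps) as [N HN]. exists N. intros n Hn.
  specialize (HN n Hn). rewrite Rminus_0_r, Rabs_pos_eq in HN by apply Cmod_ge_0.
  eapply Rle_lt_trans; [|exact HN]. apply (im_le_Cmod (u n - l)%C).
Qed.

Lemma Clim_of_Re_Im (u : nat -> C) (l : C) :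
  is_lim_seq (fun n => Re (u n)) (Re l) -> is_lim_seq (fun n => Im (u n)) (Im l) -> Clim u l.
Proof.
  intros Hr Hi.
  apply Clim_squeeze with (fun n => Rabs (Re (u n) - Re l) + Rabs (Im (u n) - Im l)).
  - intros n. apply (Cmod_le_re_im (u n - l)%C).
  - replace 0 with (Rabs (Re l - Re l) + Rabs (Im l - Im l)) by (rewrite !Rminus_diag, Rabs_R0; ring).
    apply is_lim_seq_plus'.
    + apply (is_lim_seq_abs _ (Re l - Re l)).
      apply is_lim_seq_minus'; [exact Hr|apply is_lim_seq_const].
    + apply (is_lim_seq_abs _ (Im l - Im l)).
      apply is_lim_seq_minus'; [exact Hi|apply is_lim_seq_const].
Qed.

(** The explicit modulus [d] passes to the limit; this is what makes the convergence of series
    depending on a parameter uniform. *)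
Lemma Clim_of_Cauchy (u : nat -> C) (d : nat -> R) :
  (forall m n, (m <= n)%nat -> Cmod (u n - u m)%C <= d m) -> is_lim_seq d 0 ->
  exists l, Clim u l /\ forall m, Cmod (l - u m)%C <= d m.
Proof.
  intros H Hd.
  assert (Hc : forall eps : posreal, exists N, forall m n, (N <= m)%nat -> (N <= n)%nat ->
             Cmod (u n - u m)%C < eps).
  { intros eps. apply is_lim_seq_spec in Hd. destruct (Hd eps) as [N HN].
    exists N. intros m n Hm Hn.
    assert (K : forall k, (N <= k)%nat -> d k < eps).
    { intros k Hk. specialize (HN k Hk). rewrite Rminus_0_r in HN.
      assert (T := Rle_abs (d k)). lra. }
    destruct (le_lt_dec m n) as [L|L].
    - specialize (H m n L). specialize (K m Hm). lra.
    - specialize (H n m ltac:(lia)). specialize (K n Hn). rewrite Cmod_minus_sym. lra. }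
  destruct (proj2 (ex_lim_seq_cauchy_corr (fun n => Re (u n)))) as [a Ha].
  { intros eps. destruct (Hc eps) as [N HN]. exists N. intros n m Hn Hm.
    eapply Rle_lt_trans; [|apply (HN m n Hm Hn)]. apply (re_le_Cmod (u n - u m)%C). }
  destruct (proj2 (ex_lim_seq_cauchy_corr (fun n => Im (u n)))) as [b Hb].
  { intros eps. destruct (Hc eps) as [N HN]. exists N. intros n m Hn Hm.
    eapply Rle_lt_trans; [|apply (HN m n Hm Hn)]. apply (im_le_Cmod (u n - u m)%C). }
  assert (HL : Clim u (a, b)) by now apply Clim_of_Re_Im.
  exists (a, b). split; [exact HL|].
  intros m. apply (Clim_bound u); [exact HL|]. exists m. intros n Hn. now apply H.
Qed.

Lemma csum_converges (u : nat -> C) (B : nat -> R) (b : R) :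
  (forall i, Cmod (u i) <= B (S i) - B i) -> is_lim_seq B b ->
  exists l, Clim (csum u) l /\ forall n, Cmod (l - csum u n)%C <= b - B n.
Proof.
  intros H HB.
  assert (Hinc : forall n, B n <= B (S n)).
  { intros n. specialize (H n). assert (T := Cmod_ge_0 (u n)). lra. }
  apply Clim_of_Cauchy.
  - intros m n Hmn. eapply Rle_trans; [apply csum_telescope_bound; auto|].
    assert (B n <= b); [|lra].
    apply (is_lim_seq_incr_compare B b HB Hinc).
  - replace 0 with (b - b) by ring. apply is_lim_seq_minus'; [apply is_lim_seq_const|exact HB].
Qed.

Lemma csum_geometric (u : nat -> C) (M rho : R) :
  0 <= rho < 1 -> (forall n, Cmod (u n) <= M * rho ^ n) ->
  exists l, Clim (csum u) l /\ forall n, Cmod (l - csum u n)%C <= M / (1 - rho) * rho ^ n.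
Proof.
  intros Hrho H.
  destruct (csum_converges u (fun n => - (M / (1 - rho) * rho ^ n)) 0) as [l [Hl Hb]].
  - intros n. eapply Rle_trans; [apply H|]. right. simpl. field. lra.
  - replace 0 with (- (M / (1 - rho) * 0)) by ring.
    apply (is_lim_seq_opp _ (M / (1 - rho) * 0)).
    apply (is_lim_seq_scal_l _ _ 0). apply is_lim_seq_geom. rewrite Rabs_pos_eq; lra.
  - exists l. split; [exact Hl|]. intros n. specialize (Hb n). lra.
Qed.

Lemma Clim_csum_terms_bounded (u : nat -> C) (l : C) :
  Clim (csum u) l -> exists M, 0 <= M /\ forall n, Cmod (u n) <= M.
Proof.
  intros H.
  assert (exists B, forall n, Cmod (csum u n - l)%C <= B) as [B HB].
  { assert (E : ex_lim_seq (fun n => Cmod (csum u n - l)%C)) by (exists 0; exact H).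
    destruct (filterlim_bounded (K := R_AbsRing) (V := R_NormedModule)
      (fun n => Cmod (csum u n - l)%C)) as [B HB].
    - exists 0. exact H.
    - exists B. intros n. specialize (HB n). unfold norm in HB. simpl in HB.
      unfold abs in HB. simpl in HB. rewrite Rabs_pos_eq in HB by apply Cmod_ge_0. exact HB. }
  assert (HB0 : 0 <= B) by (eapply Rle_trans; [apply Cmod_ge_0|apply (HB O)]).
  exists (2 * B). split; [lra|]. intros n.
  replace (u n) with ((csum u (S n) - l) - (csum u n - l))%C by (simpl; ring).
  eapply Rle_trans; [apply Cmod_minus_le|].
  assert (H1 := HB (S n)). assert (H2 := HB n). lra.
Qed.

(** The series of the statement are limits of sums over closed ranges, whence the shift by 1. *)
Lemma csum_sum_n (u : nat -> C) (n : nat) :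
  sum_n (u : nat -> C_NormedModule) n = csum u (S n).
Proof.
  induction n as [|n IH].
  - rewrite sum_O. simpl. ring.
  - rewrite sum_Sn, IH. reflexivity.
Qed.

Lemma is_series_Clim (u : nat -> C) (l : C) :
  is_series (K := C_AbsRing) (V := C_NormedModule) u l -> Clim (csum u) l.
Proof.
  intros H. apply (Clim_incr _ _ 1). apply is_lim_seq_spec. intros eps.
  unfold is_series in H.
  apply (proj1 (filterlim_locally_ball_norm (FF := _)
     (sum_n (u : nat -> C_NormedModule)) (l : C_NormedModule))) with (eps := eps) in H.
  destruct H as [N HN]. exists N. intros n Hn. specialize (HN n Hn).
  unfold ball_norm in HN. rewrite csum_sum_n in HN.
  rewrite Rminus_0_r, Rabs_pos_eq by apply Cmod_ge_0.
  rewrite Nat.add_1_r. exact HN.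
Qed.

Lemma csum_Re (u : nat -> C) (n : nat) : Re (csum u (S n)) = sum_n (fun k => Re (u k)) n.
Proof.
  induction n as [|n IH].
  - rewrite sum_O. simpl. apply Rplus_0_l.
  - rewrite sum_Sn, <- IH. reflexivity.
Qed.

Lemma csum_Im (u : nat -> C) (n : nat) : Im (csum u (S n)) = sum_n (fun k => Im (u k)) n.
Proof.
  induction n as [|n IH].
  - rewrite sum_O. simpl. apply Rplus_0_l.
  - rewrite sum_Sn, <- IH. reflexivity.
Qed.

Lemma CSeries_Clim (u : nat -> C) (l : C) : Clim (csum u) l -> CSeries u = l.
Proof.
  intros H. apply (Clim_incr _ _ 1) in H.
  unfold CSeries.
  rewrite (is_series_unique (fun n => Re (u n)) (Re l)).
  2:{ change (is_lim_seq (sum_n (fun n => Re (u n))) (Re l)).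
      eapply is_lim_seq_ext; [|exact (Clim_Re _ _ H)].
      intros n. cbv beta. rewrite Nat.add_1_r. apply csum_Re. }
  rewrite (is_series_unique (fun n => Im (u n)) (Im l)).
  2:{ change (is_lim_seq (sum_n (fun n => Im (u n))) (Im l)).
      eapply is_lim_seq_ext; [|exact (Clim_Im _ _ H)].
      intros n. cbv beta. rewrite Nat.add_1_r. apply csum_Im. }
  now destruct l.
Qed.

(** * Real powers *)

Lemma Rpower_pos (x a : R) : 0 < Rpower x a.
Proof. apply exp_pos. Qed.

Lemma Rpower_base_1 (a : R) : Rpower 1 a = 1.
Proof. unfold Rpower. rewrite ln_1, Rmult_0_r. apply exp_0. Qed.

Lemma Rpower_le_neg (a x y : R) : a <= 0 -> 0 < x <= y -> Rpower y a <= Rpower x a.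
Proof.
  intros Ha Hxy. replace a with (- (- a)) by ring. rewrite !(Rpower_Ropp _ (- a)).
  apply Rinv_le_contravar; [apply Rpower_pos|]. apply Rle_Rpower_l; lra.
Qed.

Lemma Rpower_exponent_le (x a b : R) : 0 < x <= 1 -> a <= b -> Rpower x b <= Rpower x a.
Proof.
  intros Hx Hab. unfold Rpower.
  assert (ln x <= 0) by (rewrite <- ln_1; apply ln_le; lra).
  assert (K : b * ln x <= a * ln x) by nra.
  destruct K as [K|K]; [left; now apply exp_increasing|right; now rewrite K].
Qed.

Lemma Rpower_Rinv (x a : R) : 0 < x -> Rpower (/ x) a = Rpower x (- a).
Proof. intros Hx. unfold Rpower. rewrite ln_Rinv by lra. f_equal. ring. Qed.

Lemma Rpower_S (x a : R) : 0 < x -> Rpower x (a + 1) = Rpower x a * x.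
Proof. intros Hx. rewrite Rpower_plus, Rpower_1 by lra. reflexivity. Qed.

Lemma Rpower_comparable (a x y : R) :
  0 < x -> x <= y <= 2 * x -> Rpower y a <= Rpower 2 (Rabs a) * Rpower x a.
Proof.
  intros Hx Hy. destruct (Rle_dec 0 a) as [Ha|Ha].
  - rewrite Rabs_pos_eq by lra. rewrite Rpower_mult_distr by lra.
    apply Rle_Rpower_l; lra.
  - apply Rle_trans with (1 * Rpower x a).
    + rewrite Rmult_1_l. apply Rpower_le_neg; lra.
    + apply Rmult_le_compat_r; [left; apply Rpower_pos|].
      rewrite <- (Rpower_O 2) by lra. apply Rle_Rpower; [lra|apply Rabs_pos].
Qed.

Lemma is_derive_Rpower (a x : R) : 0 < x ->
  is_derive (fun t => Rpower t a) x (a * Rpower x (a - 1)).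
Proof. intros Hx. apply is_derive_Reals. now apply derivable_pt_lim_power. Qed.

Lemma is_lim_seq_Rpower_neg (a : R) : a < 0 ->
  is_lim_seq (fun n => Rpower (INR (S n)) a) 0.
Proof.
  intros Ha. apply is_lim_seq_spec. intros eps.
  destruct (nfloor_ex (Rpower eps (/ a))) as [N [_ HN]]; [left; apply Rpower_pos|].
  exists (S N). intros n Hn. rewrite Rminus_0_r, Rabs_pos_eq by (left; apply Rpower_pos).
  assert (K : Rpower eps (/ a) < INR (S n)).
  { eapply Rlt_le_trans; [exact HN|]. rewrite <- S_INR. apply le_INR. lia. }
  replace (pos eps) with (Rpower (Rpower eps (/ a)) a).
  2:{ rewrite Rpower_mult, Rinv_l by lra. apply Rpower_1. apply cond_pos. }
  unfold Rpower at 1 2. apply exp_increasing.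
  assert (ln (Rpower eps (/ a)) < ln (INR (S n))) by (apply ln_increasing; [apply Rpower_pos|auto]).
  nra.
Qed.

Lemma pow_exp (x : R) (n : nat) : exp x ^ n = exp (INR n * x).
Proof.
  induction n as [|n IH].
  - simpl. now rewrite Rmult_0_l, exp_0.
  - rewrite S_INR, Rmult_plus_distr_r, Rmult_1_l, exp_plus, <- IH. simpl. ring.
Qed.

Lemma exp_le_compat (x y : R) : x <= y -> exp x <= exp y.
Proof. intros [H|H]; [left; now apply exp_increasing|right; now rewrite H]. Qed.

(** * The character e(t) and smooth curves in the plane *)

Definition cis (t : R) : C := (cos (2 * PI * t), sin (2 * PI * t)).

Lemma e_cis (z : C) : e z = (RtoC (exp (- (2 * PI * Im z))) * cis (Re z))%C.
Proof.
  unfold e, Cexp, cis. destruct z as [x y].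
  assert (H1 : Re (RtoC (2 * PI) * Ci * (x, y))%C = - (2 * PI * y)) by (simpl; ring).
  assert (H2 : Im (RtoC (2 * PI) * Ci * (x, y))%C = 2 * PI * x) by (simpl; ring).
  rewrite H1, H2. apply injective_projections; simpl; ring.
Qed.

Lemma cis_plus (s t : R) : cis (s + t) = (cis s * cis t)%C.
Proof.
  unfold cis. rewrite Rmult_plus_distr_l, cos_plus, sin_plus.
  apply injective_projections; simpl; ring.
Qed.

Lemma cis_0 : cis 0 = RtoC 1.
Proof. unfold cis. rewrite Rmult_0_r, cos_0, sin_0. reflexivity. Qed.

Lemma Cmod_cis (t : R) : Cmod (cis t) = 1.
Proof.
  unfold Cmod, cis. simpl. transitivity (sqrt 1); [f_equal|apply sqrt_1].
  assert (H := sin2_cos2 (2 * PI * t)). unfold Rsqr in H. lra.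
Qed.

Lemma cis_pow (t : R) (n : nat) : (cis t ^ n)%C = cis (INR n * t).
Proof.
  induction n as [|n IH].
  - simpl. now rewrite Rmult_0_l, cis_0.
  - rewrite S_INR, Rmult_plus_distr_r, Rmult_1_l, cis_plus, <- IH. simpl. ring.
Qed.

(** Derivatives are taken coordinate by coordinate, which gives access to the mean value
    theorem and to the fundamental theorem of calculus for real functions. *)
Definition curve_derive (F F' : R -> C) : Prop :=
  forall t, is_derive (fun x => Re (F x)) t (Re (F' t)) /\
            is_derive (fun x => Im (F x)) t (Im (F' t)).

Lemma curve_derive_ext (F F' G G' : R -> C) :
  (forall t, F t = G t) -> (forall t, F' t = G' t) -> curve_derive F F' -> curve_derive G G'.
Proof.
  intros H H' D t. destruct (D t) as [D1 D2]. rewrite <- H'. split.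
  - eapply is_derive_ext; [|exact D1]. intros x. simpl. now rewrite H.
  - eapply is_derive_ext; [|exact D2]. intros x. simpl. now rewrite H.
Qed.

Lemma curve_derive_const (c : C) : curve_derive (fun _ => c) (fun _ => RtoC 0).
Proof. intros t. split; simpl; apply @is_derive_const. Qed.

Lemma curve_derive_plus (F F' G G' : R -> C) :
  curve_derive F F' -> curve_derive G G' ->
  curve_derive (fun t => F t + G t)%C (fun t => F' t + G' t)%C.
Proof.
  intros HF HG t. destruct (HF t) as [F1 F2], (HG t) as [G1 G2].
  split; simpl; apply @is_derive_plus; assumption.
Qed.

Lemma curve_derive_mult (F F' G G' : R -> C) :
  curve_derive F F' -> curve_derive G G' ->
  curve_derive (fun t => F t * G t)%C (fun t => F' t * G t + F t * G' t)%C.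
Proof.
  intros HF HG t. destruct (HF t) as [F1 F2], (HG t) as [G1 G2].
  assert (M : forall (u v : R -> R) (du dv : R), is_derive u t du -> is_derive v t dv ->
     is_derive (fun x => u x * v x) t (du * v t + u t * dv)).
  { intros u v du dv Hu Hv. apply is_derive_Reals. apply is_derive_Reals in Hu, Hv.
    now apply derivable_pt_lim_mult. }
  split.
  - replace (Re (F' t * G t + F t * G' t)%C)
      with ((Re (F' t) * Re (G t) + Re (F t) * Re (G' t)) - (Im (F' t) * Im (G t) + Im (F t) * Im (G' t)))
      by (unfold Re, Im; simpl; ring).
    apply @is_derive_minus; now apply M.
  - replace (Im (F' t * G t + F t * G' t)%C)
      with ((Re (F' t) * Im (G t) + Re (F t) * Im (G' t)) + (Im (F' t) * Re (G t) + Im (F t) * Re (G' t)))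
      by (unfold Re, Im; simpl; ring).
    apply @is_derive_plus; now apply M.
Qed.

Lemma curve_derive_scal (c : C) (F F' : R -> C) :
  curve_derive F F' -> curve_derive (fun t => c * F t)%C (fun t => c * F' t)%C.
Proof.
  intros HF. eapply curve_derive_ext;
    [| |apply (curve_derive_mult _ _ _ _ (curve_derive_const c) HF)].
  - reflexivity.
  - intros t. cbv beta. ring.
Qed.

Lemma curve_derive_RtoC : curve_derive (fun t => RtoC t) (fun _ => RtoC 1).
Proof. intros t. split; simpl; [apply @is_derive_id|apply @is_derive_const]. Qed.

Lemma curve_derive_cis (a : R) :
  curve_derive (fun t => cis (a * t)) (fun t => RtoC (2 * PI * a) * Ci * cis (a * t))%C.
Proof.
  intros t. unfold cis. split; simpl; auto_derive; auto; ring.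
Qed.

Lemma curve_derive_csum (F F' : nat -> R -> C) (n : nat) :
  (forall i, (i < n)%nat -> curve_derive (F i) (F' i)) ->
  curve_derive (fun t => csum (fun i => F i t) n) (fun t => csum (fun i => F' i t) n).
Proof.
  induction n as [|n IH]; intros H; simpl.
  - apply curve_derive_const.
  - apply curve_derive_plus; [apply IH; intros; apply H; lia|apply H; lia].
Qed.

Lemma curve_continuous (F F' : R -> C) (t : R) : curve_derive F F' ->
  continuous (fun x => Re (F x)) t /\ continuous (fun x => Im (F x)) t.
Proof.
  intros H. destruct (H t) as [H1 H2].
  split; apply @ex_derive_continuous; eexists; eassumption.
Qed.

(** The mean value theorem is applied to the real and to the imaginary part, whence the factor 2. *)
Lemma curve_increment_bound (F F' : R -> C) (T B : R) (m : nat) (t : R) :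
  curve_derive F F' -> Rabs t <= T ->
  (forall x, Rabs x <= T -> Cmod (F' x) <= B * Rabs x ^ m) ->
  Cmod (F t - F 0)%C <= 2 * B * Rabs t ^ S m.
Proof.
  intros D Ht HB.
  assert (HB0 : forall x, Rabs x <= Rabs t -> Cmod (F' x) <= B * Rabs t ^ m).
  { intros x Hx. destruct (Req_dec t 0) as [->|Ht0].
    - rewrite Rabs_R0 in Hx. assert (x = 0).
      { destruct (Req_dec x 0) as [E|E]; [auto|]. apply Rabs_pos_lt in E. lra. }
      subst x. apply HB. rewrite Rabs_R0 in *. lra.
    - assert (0 <= B).
      { assert (0 <= B * Rabs t ^ m).
        { eapply Rle_trans; [apply Cmod_ge_0|apply HB; exact Ht]. }
        assert (0 < Rabs t ^ m) by (apply pow_lt, Rabs_pos_lt; auto). nra. }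
      eapply Rle_trans; [apply HB; lra|]. apply Rmult_le_compat_l; [lra|].
      apply pow_incr. split; [apply Rabs_pos|auto]. }
  assert (MV : forall g dg : R -> R, (forall x, is_derive g x (dg x)) ->
     (forall x, Rabs (dg x) <= Cmod (F' x)) -> Rabs (g t - g 0) <= B * Rabs t ^ S m).
  { intros g dg Dg Hg.
    destruct (MVT_gen g 0 t dg) as [c [Hc Ec]].
    - intros x _. apply Dg.
    - intros x _. apply continuity_pt_filterlim. apply (@ex_derive_continuous R_AbsRing R_NormedModule).
      eexists; apply Dg.
    - rewrite Ec, Rabs_mult, Rminus_0_r. simpl. rewrite (Rmult_comm (Rabs t)), <- Rmult_assoc.
      apply Rmult_le_compat_r; [apply Rabs_pos|].
      eapply Rle_trans; [apply Hg|]. apply HB0.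
      revert Hc. unfold Rmin, Rmax, Rabs. repeat destruct Rle_dec; repeat destruct Rcase_abs; lra. }
  eapply Rle_trans; [apply Cmod_le_re_im|].
  assert (R1 := MV (fun x => Re (F x)) (fun x => Re (F' x)) (fun x => proj1 (D x))
     (fun x => re_le_Cmod (F' x))).
  assert (R2 := MV (fun x => Im (F x)) (fun x => Im (F' x)) (fun x => proj2 (D x))
     (fun x => im_le_Cmod (F' x))).
  change (Re (F t - F 0)%C) with (Re (F t) - Re (F 0)).
  change (Im (F t - F 0)%C) with (Im (F t) - Im (F 0)). lra.
Qed.

(** * Growth of modular forms near the real line *)

Lemma Cmod_Crpow (z : C) (s : R) : Cmod (Crpow z s) = Rpower (Cmod z) s.
Proof.
  unfold Crpow. set (R0 := Rpower (Cmod z) s). set (t := s * Carg z).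
  replace (R0 * cos t, R0 * sin t) with (RtoC R0 * (cos t, sin t))%C
    by (apply injective_projections; simpl; ring).
  rewrite Cmod_mult, Cmod_R, Rabs_pos_eq by (left; apply Rpower_pos).
  replace (Cmod (cos t, sin t)) with 1; [ring|].
  unfold Cmod. simpl. symmetry. transitivity (sqrt 1); [f_equal|apply sqrt_1].
  assert (H := sin2_cos2 t). unfold Rsqr in H. lra.
Qed.

Lemma Cmod_e (z : C) : Cmod (e z) = exp (- (2 * PI * Im z)).
Proof.
  rewrite e_cis, Cmod_mult, Cmod_cis, Cmod_R, Rabs_pos_eq by (left; apply exp_pos). ring.
Qed.

Lemma SL2Z_IZR (g : mat2) : SL2Z g ->
  IZR (m11 g) * IZR (m22 g) - IZR (m12 g) * IZR (m21 g) = 1.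
Proof.
  unfold SL2Z. intros H. apply (f_equal IZR) in H. rewrite minus_IZR, !mult_IZR in H. exact H.
Qed.

Lemma j_factor_neq_0 (g : mat2) (z : C) : SL2Z g -> 0 < Im z -> j_factor g z <> RtoC 0.
Proof.
  intros Hg Hz E. apply SL2Z_IZR in Hg. destruct z as [x y]. simpl in Hz.
  unfold j_factor in E. apply (f_equal (fun w => (Re w, Im w))) in E.
  simpl in E. injection E as E1 E2.
  assert (IZR (m21 g) * y = 0) as E3 by lra.
  apply Rmult_integral in E3. destruct E3 as [E3|E3]; [|lra].
  rewrite E3 in *. assert (IZR (m22 g) = 0) as E4 by lra. rewrite E4 in Hg. lra.
Qed.

Lemma Im_moebius (g : mat2) (z : C) : SL2Z g -> 0 < Im z ->
  Im (moebius g z) * Cmod (j_factor g z) ^ 2 = Im z.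
Proof.
  intros Hg Hz.
  assert (E : (moebius g z * j_factor g z)%C = (RtoC (IZR (m11 g)) * z + RtoC (IZR (m12 g)))%C).
  { unfold moebius. fold (j_factor g z). field. now apply j_factor_neq_0. }
  apply SL2Z_IZR in Hg. rewrite Cmod2_alt. unfold j_factor in *.
  destruct (moebius g z) as [u v]. destruct z as [x y].
  apply (f_equal (fun w => (Re w, Im w))) in E. simpl in E |- *. injection E as E1 E2.
  set (a := IZR (m11 g)) in *. set (b := IZR (m12 g)) in *.
  set (c := IZR (m21 g)) in *. set (d := IZR (m22 g)) in *.
  transitivity ((a * d - b * c) * y); [|rewrite Hg; ring].
  transitivity ((u * (c * y + 0 * x + 0) + v * (c * x - 0 * y + d)) * (c * x + d)
     - (u * (c * x - 0 * y + d) - v * (c * y + 0 * x + 0)) * (c * y)); [ring|].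
  rewrite E1, E2. ring.
Qed.

Lemma Im_moebius_pos (g : mat2) (z : C) : SL2Z g -> 0 < Im z -> 0 < Im (moebius g z).
Proof.
  intros Hg Hz. assert (H := Im_moebius g z Hg Hz).
  assert (0 < Cmod (j_factor g z)) by (apply Cmod_gt_0, j_factor_neq_0; auto).
  assert (0 < Cmod (j_factor g z) ^ 2) by (apply pow_lt; auto). nra.
Qed.

Lemma j_factor_mul (g h : mat2) (z : C) : SL2Z g -> SL2Z h -> 0 < Im z ->
  j_factor (mat2_mul g h) z = (j_factor g (moebius h z) * j_factor h z)%C.
Proof.
  intros Hg Hh Hz. assert (N := j_factor_neq_0 h z Hh Hz).
  unfold j_factor, moebius, mat2_mul in *. simpl.
  rewrite !plus_IZR, !mult_IZR, !RtoC_plus, !RtoC_mult. now field.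
Qed.

Lemma moebius_mul (g h : mat2) (z : C) : SL2Z g -> SL2Z h -> 0 < Im z ->
  moebius (mat2_mul g h) z = moebius g (moebius h z).
Proof.
  intros Hg Hh Hz. assert (N := j_factor_neq_0 h z Hh Hz).
  assert (N2 := j_factor_neq_0 g _ Hg (Im_moebius_pos h z Hh Hz)).
  assert (E := j_factor_mul g h z Hg Hh Hz).
  unfold moebius at 1. fold (j_factor (mat2_mul g h) z). rewrite E.
  unfold moebius at 2. fold (j_factor g (moebius h z)).
  set (J := j_factor g (moebius h z)) in *.
  replace (RtoC (IZR (m11 (mat2_mul g h))) * z + RtoC (IZR (m12 (mat2_mul g h))))%C
    with ((RtoC (IZR (m11 g)) * moebius h z + RtoC (IZR (m12 g))) * j_factor h z)%C;
    [field; auto|].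
  unfold moebius, j_factor, mat2_mul in *. simpl.
  rewrite !plus_IZR, !mult_IZR, !RtoC_plus, !RtoC_mult. now field.
Qed.

Lemma SL2Z_mul (g h : mat2) : SL2Z g -> SL2Z h -> SL2Z (mat2_mul g h).
Proof. unfold SL2Z, mat2_mul. simpl. intros. nia. Qed.

Lemma SL2Z_inv (g : mat2) : SL2Z g -> SL2Z (mat2_inv g).
Proof. unfold SL2Z, mat2_inv. simpl. intros. lia. Qed.

Lemma moebius_id (z : C) : moebius mat2_id z = z.
Proof. unfold moebius, mat2_id. simpl. field. Qed.

Lemma j_factor_id (z : C) : j_factor mat2_id z = RtoC 1.
Proof. unfold j_factor, mat2_id. simpl. ring. Qed.

Lemma mat2_inv_mul (g : mat2) : SL2Z g -> mat2_mul (mat2_inv g) g = mat2_id.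
Proof.
  unfold SL2Z, mat2_mul, mat2_inv, mat2_id. simpl. intros H. f_equal; lia.
Qed.

(** After a translation into |Re z| <= 1/2, a point of height less than 1/2 satisfies
    |z|^2 <= 1/2, so z |-> -1/z at least doubles its height; [n] counts the doublings. *)
Lemma reduction_to_height_half (n : nat) (z : C) :
  0 < Im z -> 1 / 2 <= 2 ^ n * Im z ->
  exists g, SL2Z g /\ 1 / 2 <= Im (moebius g z).
Proof.
  revert z. induction n as [|n IH]; intros z Hz Hn.
  - exists mat2_id. split; [reflexivity|]. rewrite moebius_id. simpl in Hn. lra.
  - destruct (Rle_dec (1 / 2) (Im z)) as [Hy|Hy].
    { exists mat2_id. split; [reflexivity|]. rewrite moebius_id. exact Hy. }
    (* The nearest integer to Re z. *)
    set (k := Int_part (Re z + 1 / 2)).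
    assert (Hk : Rabs (Re z - IZR k) <= 1 / 2).
    { destruct (base_Int_part (Re z + 1 / 2)) as [K1 K2]. fold k in K1, K2.
      apply Rabs_le. lra. }
    set (g0 := Mat2 0 (-1) 1 (- k)).
    assert (Hg0 : SL2Z g0) by (unfold SL2Z, g0; simpl; lia).
    assert (HI := Im_moebius g0 z Hg0 Hz).
    assert (Hp := Im_moebius_pos g0 z Hg0 Hz).
    assert (Hj : Cmod (j_factor g0 z) ^ 2 <= 1 / 2).
    { rewrite Cmod2_alt. unfold j_factor, g0. simpl. rewrite opp_IZR.
      destruct z as [x y]. simpl in *.
      assert (HA := Rsqr_le_abs_1 (x - IZR k) (1 / 2)).
      rewrite (Rabs_pos_eq (1/2)) in HA by lra. specialize (HA Hk). unfold Rsqr in HA.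
      nra. }
    destruct (IH (moebius g0 z) Hp) as [g [Hg Hgi]].
    { simpl in Hn. assert (0 < 2 ^ n) by (apply pow_lt; lra).
      assert (2 * Im z <= Im (moebius g0 z)) by nra. nra. }
    exists (mat2_mul g g0). split; [now apply SL2Z_mul|].
    rewrite moebius_mul; auto.
Qed.

(** The exponents of the expansion at a cusp are nonnegative.  Hence, above height 1/2, the
    n-th term is at most its value at i/4 times the n-th power of a fixed ratio below 1. *)
Lemma slash_bounded (G : mat2 -> Prop) (r : R) (f : C -> C) (g : mat2) :
  holomorphic_at_cusps G r f -> SL2Z g ->
  exists B, forall z, 1 / 2 <= Im z -> Cmod (slash f r g z) <= B.
Proof.
  intros Hf Hg. destruct (Hf g Hg) as [h [kappa [b [[Hh _] [Hk Hs]]]]].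
  apply IZR_lt in Hh.
  assert (Hz0 : upper_half_plane (0, 1 / 4)) by (unfold upper_half_plane; simpl; lra).
  assert (H0 := is_series_Clim _ _ (Hs _ Hz0)).
  destruct (Clim_csum_terms_bounded _ _ H0) as [M [HM HMb]].
  set (rho := exp (- (2 * PI * (1 / 4 / IZR h)))).
  assert (HPI := PI_RGT_0).
  assert (Hi : 0 < / IZR h) by now apply Rinv_0_lt_compat.
  assert (Hrho : 0 <= rho < 1).
  { split; [left; apply exp_pos|]. unfold rho. apply Rlt_le_trans with (exp 0); [|rewrite exp_0; lra]. apply exp_increasing.
    unfold Rdiv. assert (0 < PI * / IZR h) by (apply Rmult_lt_0_compat; auto). lra. }
  exists (M / (1 - rho)). intros z Hz.
  assert (Hz' : upper_half_plane z) by (unfold upper_half_plane; lra).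
  assert (H1 := is_series_Clim _ _ (Hs _ Hz')).
  destruct (csum_geometric (fun n => (b n * e (RtoC ((INR n + kappa) / IZR h) * z))%C) M rho Hrho)
    as [l [Hl Hb]].
  - intros n. eapply Rle_trans; [|apply Rmult_le_compat_r; [apply pow_le; lra|apply (HMb n)]].
    rewrite !Cmod_mult, !Cmod_e, (Rmult_assoc (Cmod (b n))). apply Rmult_le_compat_l; [apply Cmod_ge_0|].
    unfold rho. rewrite pow_exp, <- exp_plus.
    destruct z as [x y]. simpl in Hz |- *.
    apply exp_le_compat. unfold Rdiv.
    assert (Hn := pos_INR n). set (i := / IZR h) in *. set (m := INR n) in *.
    assert (0 <= PI * i * ((m + kappa) * (y - 1 / 4) - m * (1 / 4))).
    { apply Rmult_le_pos; [apply Rmult_le_pos; lra|]. nra. }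
    nra.
  - rewrite (Clim_unique _ _ _ H1 Hl). specialize (Hb O). simpl in Hb.
    replace (l - 0)%C with l in Hb by ring. lra.
Qed.

(** Used for the four residues of a matrix in turn, to merge finitely many bounds into one. *)
Lemma bounded_choice (N : Z) (P : Z -> R -> Prop) :
  (forall i B B', B <= B' -> P i B -> P i B') -> (forall i, exists B, P i B) ->
  exists B, forall i, (0 <= i < N)%Z -> P i B.
Proof.
  intros Hmon Hex.
  assert (K : forall n : nat, exists B, forall i, (0 <= i < Z.of_nat n)%Z -> P i B).
  { induction n as [|n [B HB]].
    - exists 0. intros i Hi. lia.
    - destruct (Hex (Z.of_nat n)) as [B' HB']. exists (Rmax B B'). intros i Hi.
      destruct (Z.eq_dec i (Z.of_nat n)) as [->|Hne].
      + apply (Hmon _ B'); [apply Rmax_r|exact HB'].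
      + apply (Hmon _ B); [apply Rmax_l|apply HB; lia]. }
  destruct (K (Z.to_nat N)) as [B HB]. exists B. intros i Hi. apply HB. lia.
Qed.

(** The multiplier has modulus 1, and |j_g(h z)|^r cancels against the automorphy factor of the
    product. *)
Lemma slash_left_invariant (G : mat2 -> Prop) (r : R) (f : C -> C) (g h : mat2) (z : C) :
  subgroup_SL2Z G -> modular_form G r f -> G g -> SL2Z h -> 0 < Im z ->
  Cmod (slash f r (mat2_mul g h) z) = Cmod (slash f r h z).
Proof.
  intros [HG _] [_ [_ [m [[Hm _] Hf]]]] Hg Hh Hz.
  unfold slash. rewrite moebius_mul by auto. rewrite j_factor_mul by auto.
  assert (Hw : upper_half_plane (moebius h z)) by (apply Im_moebius_pos; auto).
  rewrite (Hf g _ Hg Hw).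
  rewrite !Cmod_mult, !Cmod_Crpow, (Hm g Hg), Cmod_mult.
  assert (P1 : 0 < Cmod (j_factor g (moebius h z))) by (apply Cmod_gt_0, j_factor_neq_0; auto).
  assert (P2 : 0 < Cmod (j_factor h z)) by (apply Cmod_gt_0, j_factor_neq_0; auto).
  rewrite <- Rpower_mult_distr by auto. rewrite (Rpower_Ropp _ r) at 1.
  field. apply Rgt_not_eq, Rpower_pos.
Qed.

Lemma mat2_mul_inv_cancel (g h : mat2) : SL2Z h ->
  mat2_mul (mat2_mul g (mat2_inv h)) h = g.
Proof.
  destruct g as [a b c d], h as [a' b' c' d']. unfold SL2Z, mat2_mul, mat2_inv. simpl.
  intros H. f_equal.
  - replace a with (a * (a' * d' - b' * c'))%Z at 3 by (rewrite H; ring). ring.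
  - replace b with (b * (a' * d' - b' * c'))%Z at 3 by (rewrite H; ring). ring.
  - replace c with (c * (a' * d' - b' * c'))%Z at 3 by (rewrite H; ring). ring.
  - replace d with (d * (a' * d' - b' * c'))%Z at 3 by (rewrite H; ring). ring.
Qed.

Lemma same_residues_principal (N : Z) (g h : mat2) : (0 < N)%Z -> SL2Z g -> SL2Z h ->
  (m11 g mod N = m11 h mod N)%Z -> (m12 g mod N = m12 h mod N)%Z ->
  (m21 g mod N = m21 h mod N)%Z -> (m22 g mod N = m22 h mod N)%Z ->
  principal_congruence N (mat2_mul g (mat2_inv h)).
Proof.
  intros HN Hg Hh H1 H2 H3 H4.
  assert (K : forall x y : Z, (x mod N = y mod N)%Z -> exists k, (x = y + k * N)%Z).
  { intros x y E. exists (x / N - y / N)%Z.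
    rewrite (Z.div_mod x N) at 1 by lia. rewrite (Z.div_mod y N) at 1 by lia. rewrite E. ring. }
  apply K in H1, H2, H3, H4.
  destruct H1 as [k1 H1], H2 as [k2 H2], H3 as [k3 H3], H4 as [k4 H4].
  split; [apply SL2Z_mul; auto using SL2Z_inv|].
  destruct g as [a b c d], h as [a' b' c' d']. unfold SL2Z in *. simpl in *. subst.
  repeat split.
  - exists (k1 * d' - k2 * c')%Z. lia.
  - exists (- k1 * b' + k2 * a')%Z. lia.
  - exists (k3 * d' - k4 * c')%Z. lia.
  - exists (- k3 * b' + k4 * a')%Z. lia.
Qed.

(** Left multiplication by [G] does not change the modulus of a slash, and matrices congruent
    mod N differ by such a multiplication; so one bound per residue class is enough. *)
Lemma slash_uniformly_bounded (G : mat2 -> Prop) (r : R) (f : C -> C) :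
  congruence_group G -> modular_form G r f ->
  exists B, forall g z, SL2Z g -> 1 / 2 <= Im z -> Cmod (slash f r g z) <= B.
Proof.
  intros [HG [N [HN HNG]]] Hf.
  assert (Hc := proj1 (proj2 Hf)).
  set (P := fun i j k l B => forall g z, SL2Z g -> (m11 g mod N = i)%Z -> (m12 g mod N = j)%Z ->
     (m21 g mod N = k)%Z -> (m22 g mod N = l)%Z -> 1 / 2 <= Im z -> Cmod (slash f r g z) <= B).
  assert (H0 : forall i j k l, exists B, P i j k l B).
  { intros i j k l.
    destruct (classic (exists h, SL2Z h /\ (m11 h mod N = i)%Z /\ (m12 h mod N = j)%Z /\
       (m21 h mod N = k)%Z /\ (m22 h mod N = l)%Z)) as [[h [Hh [E1 [E2 [E3 E4]]]]]|Hno].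
    - destruct (slash_bounded G r f h Hc Hh) as [B HB]. exists B.
      intros g z Hg F1 F2 F3 F4 Hz.
      rewrite <- (mat2_mul_inv_cancel g h Hh).
      rewrite (slash_left_invariant G); auto; [|lra].
      apply HNG, same_residues_principal; auto; congruence.
    - exists 0. intros g z Hg F1 F2 F3 F4 Hz. exfalso. apply Hno. exists g. auto. }
  assert (H1 : forall i j k, exists B, forall l, (0 <= l < N)%Z -> P i j k l B).
  { intros i j k. apply bounded_choice; [|apply H0].
    intros l B B' HB HP g z ? ? ? ? ? ?. eapply Rle_trans; [apply HP; auto|auto]. }
  assert (H2 : forall i j, exists B, forall k, (0 <= k < N)%Z -> forall l, (0 <= l < N)%Z -> P i j k l B).
  { intros i j. apply bounded_choice; [|apply H1].
    intros k B B' HB HP l Hl g z ? ? ? ? ? ?. eapply Rle_trans; [apply (HP l Hl); auto|auto]. }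
  assert (H3 : forall i, exists B, forall j, (0 <= j < N)%Z -> forall k, (0 <= k < N)%Z ->
      forall l, (0 <= l < N)%Z -> P i j k l B).
  { intros i. apply bounded_choice; [|apply H2].
    intros j B B' HB HP k Hk l Hl g z ? ? ? ? ? ?. eapply Rle_trans; [apply (HP k Hk l Hl); auto|auto]. }
  destruct (bounded_choice N (fun i B => forall j, (0 <= j < N)%Z -> forall k, (0 <= k < N)%Z ->
      forall l, (0 <= l < N)%Z -> P i j k l B)) as [B HB]; [|exact H3|].
  { intros i B B' HB HP j Hj k Hk l Hl g z ? ? ? ? ? ?.
    eapply Rle_trans; [apply (HP j Hj k Hk l Hl); auto|auto]. }
  exists B. intros g z Hg Hz.
  assert (M : forall x, (0 <= x mod N < N)%Z) by (intros; apply Z.mod_pos_bound; auto).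
  apply (HB _ (M (m11 g)) _ (M (m12 g)) _ (M (m21 g)) _ (M (m22 g))); auto.
Qed.

(** For a lower left entry c <> 0 the imaginary part of c z + d is already large enough; for
    c = 0 the modulus is 1. *)
Lemma Cmod_j_factor_ge (g : mat2) (z : C) : SL2Z g -> 0 < Im z <= 1 ->
  Im z <= Cmod (j_factor g z).
Proof.
  intros Hg Hz. destruct (Z.eq_dec (m21 g) 0) as [E|E].
  - unfold SL2Z in Hg. rewrite E in Hg.
    assert (Hd : (m22 g = 1 \/ m22 g = -1)%Z) by (apply (Z.mul_eq_1 _ (m11 g)); lia).
    unfold j_factor. rewrite E. replace (RtoC 0 * z + RtoC (IZR (m22 g)))%C with (RtoC (IZR (m22 g))) by ring.
    rewrite Cmod_R. destruct Hd as [->| ->]; unfold Rabs; destruct Rcase_abs; lra.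
  - eapply Rle_trans; [|apply im_le_Cmod].
    unfold j_factor. destruct z as [x y]. simpl in *.
    assert (H1 : 1 <= Rabs (IZR (m21 g))).
    { rewrite <- abs_IZR. apply IZR_le. lia. }
    replace (IZR (m21 g) * y + 0 * x + 0) with (IZR (m21 g) * y) by ring.
    rewrite Rabs_mult, (Rabs_pos_eq y) by lra. nra.
Qed.

(** For w = g z of height at least 1/2, f(z) is the slash of f by the inverse of g at w, up to a
    factor of modulus |j_g(z)|^(-r), and |j_g(z)| >= Im z. *)
Lemma modular_form_growth (G : mat2 -> Prop) (r : R) (f : C -> C) :
  congruence_group G -> 0 < r -> modular_form G r f ->
  exists B, 0 < B /\ forall z, 0 < Im z <= 1 -> Cmod (f z) <= B * Rpower (Im z) (- r).
Proof.
  intros HG Hr Hf. destruct (slash_uniformly_bounded G r f HG Hf) as [B HB].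
  assert (HB0 : 0 <= B).
  { eapply Rle_trans; [apply Cmod_ge_0|apply (HB mat2_id (0, 1)); [reflexivity|simpl; lra]]. }
  exists (B + 1). split; [lra|]. intros z Hz.
  assert (exists n, 1 / 2 <= 2 ^ n * Im z) as [n Hn].
  { destruct (Pow_x_infinity 2 ltac:(rewrite Rabs_pos_eq; lra) (/ Im z)) as [n Hn].
    exists n. specialize (Hn n (le_n n)). rewrite Rabs_pos_eq in Hn by (apply pow_le; lra).
    apply Rge_le in Hn. apply (Rmult_le_compat_r (Im z)) in Hn; [|lra].
    rewrite Rinv_l in Hn; lra. }
  destruct (reduction_to_height_half n z ltac:(lra) Hn) as [g [Hg Hgi]].
  assert (Hg' := SL2Z_inv g Hg).
  assert (K := HB (mat2_inv g) (moebius g z) Hg' Hgi).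
  unfold slash in K. rewrite <- moebius_mul, mat2_inv_mul, moebius_id in K by (auto; lra).
  rewrite Cmod_mult, Cmod_Crpow in K.
  assert (J := j_factor_mul (mat2_inv g) g z Hg' Hg ltac:(lra)).
  rewrite mat2_inv_mul, j_factor_id in J by auto.
  assert (Hj := Cmod_j_factor_ge g z Hg Hz).
  assert (E : Cmod (j_factor (mat2_inv g) (moebius g z)) = / Cmod (j_factor g z)).
  { apply (f_equal Cmod) in J. rewrite Cmod_1, Cmod_mult in J.
    apply Rmult_eq_reg_r with (Cmod (j_factor g z)); [|lra]. rewrite <- J. field. lra. }
  rewrite E, Rpower_Rinv, Ropp_involutive in K by lra.
  assert (P := Rpower_pos (Cmod (j_factor g z)) r).
  apply Rle_trans with (B * Rpower (Cmod (j_factor g z)) (- r)).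
  - rewrite Rpower_Ropp.
    apply Rmult_le_reg_l with (Rpower (Cmod (j_factor g z)) r); [exact P|].
    eapply Rle_trans; [exact K|]. right. field. lra.
  - apply Rmult_le_compat; [exact HB0|left; apply Rpower_pos|lra|]. apply Rpower_le_neg; lra.
Qed.

(** * Integrals over a period and Fourier coefficients *)

Definition period_integral (F : R -> C) (l : C) : Prop :=
  is_RInt (fun t => Re (F t)) (- (1 / 2)) (1 / 2) (Re l) /\
  is_RInt (fun t => Im (F t)) (- (1 / 2)) (1 / 2) (Im l).

Lemma period_integral_ext (F H : R -> C) (l : C) :
  (forall t, F t = H t) -> period_integral F l -> period_integral H l.
Proof.
  intros E [H1 H2]. split.
  - eapply is_RInt_ext; [|exact H1]. intros t _. simpl. now rewrite E.
  - eapply is_RInt_ext; [|exact H2]. intros t _. simpl. now rewrite E.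
Qed.

Lemma period_integral_zero : period_integral (fun _ => RtoC 0) (RtoC 0).
Proof.
  assert (K : is_RInt (fun _ : R => 0) (- (1 / 2)) (1 / 2) 0).
  { refine (eq_ind _ (is_RInt _ _ _) (is_RInt_const (V := R_NormedModule) _ _ 0) 0 _).
    apply Rmult_0_r. }
  split; exact K.
Qed.

Lemma period_integral_plus (F H : R -> C) (l m : C) :
  period_integral F l -> period_integral H m ->
  period_integral (fun t => F t + H t)%C (l + m)%C.
Proof. intros [F1 F2] [H1 H2]. split; simpl; apply @is_RInt_plus; assumption. Qed.

Lemma period_integral_scal (c : C) (F : R -> C) (l : C) :
  period_integral F l -> period_integral (fun t => c * F t)%C (c * l)%C.
Proof.
  intros [H1 H2]. split; simpl.
  - apply @is_RInt_minus; apply @is_RInt_scal; assumption.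
  - apply @is_RInt_plus; apply @is_RInt_scal; assumption.
Qed.

Lemma period_integral_csum (F : nat -> R -> C) (l : nat -> C) (n : nat) :
  (forall i, (i < n)%nat -> period_integral (F i) (l i)) ->
  period_integral (fun t => csum (fun i => F i t) n) (csum l n).
Proof.
  induction n as [|n IH]; intros H; simpl.
  - apply period_integral_zero.
  - apply period_integral_plus; [apply IH; intros; apply H; lia|apply H; lia].
Qed.

Lemma period_integral_derive (F F' F'' : R -> C) :
  curve_derive F F' -> curve_derive F' F'' ->
  period_integral F' (F (1 / 2)%R - F (- (1 / 2))%R)%C.
Proof.
  intros D D'. split.
  - apply (is_RInt_derive (fun t => Re (F t)) (fun t => Re (F' t))).
    + intros t _. apply D.
    + intros t _. apply (curve_continuous _ _ t D').
  - apply (is_RInt_derive (fun t => Im (F t)) (fun t => Im (F' t))).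
    + intros t _. apply D.
    + intros t _. apply (curve_continuous _ _ t D').
Qed.

Lemma period_integral_bound (F : R -> C) (l : C) (phi : R -> R) (I : R) :
  period_integral F l -> (forall t, Rabs t <= 1 / 2 -> Cmod (F t) <= phi t) ->
  is_RInt phi (- (1 / 2)) (1 / 2) I -> Cmod l <= I.
Proof.
  intros [H1 H2] Hphi HI.
  assert (N : forall z : C, norm (z : prod_NormedModule R_AbsRing R_NormedModule R_NormedModule) = Cmod z).
  { intros z. unfold norm. simpl. unfold prod_norm, Cmod. unfold norm. simpl. unfold abs. simpl.
    f_equal. rewrite !Rmult_1_r. now rewrite <- !Rabs_mult, !Rabs_pos_eq by apply Rle_0_sqr. }
  rewrite <- N.
  apply (norm_RInt_le (V := prod_NormedModule R_AbsRing R_NormedModule R_NormedModule) F phi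
     (- (1 / 2)) (1 / 2)); [lra| |destruct l; now apply is_RInt_fct_extend_pair|exact HI].
  intros t Ht. rewrite N. apply Hphi. apply Rabs_le. lra.
Qed.

Lemma is_RInt_uniform_limit (fn : nat -> R -> R) (f : R -> R) (In : nat -> R) (I a b : R)
    (d : nat -> R) :
  (forall n, is_RInt (fn n) a b (In n)) -> (forall n t, Rabs (f t - fn n t) <= d n) ->
  is_lim_seq d 0 -> is_lim_seq In I -> is_RInt f a b I.
Proof.
  intros Hn Hd Hd0 HI.
  destruct (filterlim_RInt (V := R_CompleteNormedModule) fn a b eventually eventually_filter f In Hn) as [J [HJ HfJ]].
  - apply filterlim_locally. intros eps. apply is_lim_seq_spec in Hd0.
    destruct (Hd0 eps) as [N HN]. exists N. intros n Hn'. intros t.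
    specialize (HN n Hn'). rewrite Rminus_0_r in HN.
    apply Rle_lt_trans with (Rabs (f t - fn n t)).
    + rewrite Rabs_minus_sym. apply Rle_refl.
    + eapply Rle_lt_trans; [apply Hd|]. eapply Rle_lt_trans; [apply Rle_abs|exact HN].
  - assert (E : Finite I = Finite J).
    { rewrite <- (is_lim_seq_unique _ _ HI). apply (is_lim_seq_unique In J). exact HJ. }
    injection E as ->. exact HfJ.
Qed.

Lemma period_integral_uniform_limit (Fn : nat -> R -> C) (F : R -> C) (ln : nat -> C) (l : C)
    (d : nat -> R) :
  (forall n, period_integral (Fn n) (ln n)) -> (forall n t, Cmod (F t - Fn n t)%C <= d n) ->
  is_lim_seq d 0 -> Clim ln l -> period_integral F l.
Proof.
  intros Hn Hd Hd0 Hl. split.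
  - apply is_RInt_uniform_limit with (fun n t => Re (Fn n t)) (fun n => Re (ln n)) d; auto.
    + intros n. exact (proj1 (Hn n)).
    + intros n t. eapply Rle_trans; [apply (re_le_Cmod (F t - Fn n t)%C)|apply Hd].
    + now apply Clim_Re.
  - apply is_RInt_uniform_limit with (fun n t => Im (Fn n t)) (fun n => Im (ln n)) d; auto.
    + intros n. exact (proj2 (Hn n)).
    + intros n t. eapply Rle_trans; [apply (im_le_Cmod (F t - Fn n t)%C)|apply Hd].
    + now apply Clim_Im.
Qed.

Lemma cis_IZR (k : Z) : cis (IZR k) = RtoC 1.
Proof.
  assert (P : forall n, cis (INR n) = RtoC 1).
  { induction n as [|n IH]; [apply cis_0|].
    rewrite S_INR, cis_plus, IH. unfold cis. rewrite Rmult_1_r, cos_2PI, sin_2PI.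
    apply injective_projections; simpl; ring. }
  destruct (Z_le_dec 0 k) as [Hk|Hk].
  - rewrite <- (Z2Nat.id k Hk), <- INR_IZR_INZ. apply P.
  - assert (E := P (Z.to_nat (- k))). rewrite INR_IZR_INZ, Z2Nat.id in E by lia.
    assert (E2 : (cis (IZR k) * cis (IZR (- k)))%C = RtoC 1).
    { rewrite <- cis_plus, <- plus_IZR, Z.add_opp_diag_r. apply cis_0. }
    rewrite E in E2. rewrite <- E2. ring.
Qed.

Lemma period_integral_cis (k : Z) :
  period_integral (fun t => cis (IZR k * t)) (if Z.eq_dec k 0 then RtoC 1 else RtoC 0).
Proof.
  destruct (Z.eq_dec k 0) as [->|Hk].
  - assert (K := period_integral_derive (fun t => RtoC t) (fun _ => RtoC 1) (fun _ => RtoC 0)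
      curve_derive_RtoC (curve_derive_const _)).
    cbv beta in K. replace (RtoC (1 / 2)%R - RtoC (- (1 / 2))%R)%C with (RtoC 1) in K
      by (rewrite <- RtoC_minus; f_equal; lra).
    eapply period_integral_ext; [|exact K]. intros t. simpl. now rewrite Rmult_0_l, cis_0.
  - assert (Hk' : IZR k <> 0) by now apply not_0_IZR.
    assert (HPI := PI_RGT_0).
    set (c := (RtoC (2 * PI * IZR k) * Ci)%C).
    assert (Hc : c <> RtoC 0).
    { unfold c. intros E. apply (f_equal Im) in E. simpl in E.
      assert (E' : PI * IZR k = 0) by lra. apply Rmult_integral in E'. lra. }
    assert (D := curve_derive_cis (IZR k)).
    assert (D1 : curve_derive (fun t => / c * cis (IZR k * t))%C (fun t => cis (IZR k * t))).
    { eapply curve_derive_ext; [| |exact (curve_derive_scal (/ c) _ _ D)].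
      - reflexivity.
      - intros t. cbv beta. fold c. field. exact Hc. }
    assert (K := period_integral_derive _ _ _ D1 D). simpl in K.
    replace (RtoC 0) with (/ c * cis (IZR k * (1 / 2))%R - / c * cis (IZR k * - (1 / 2))%R)%C; [exact K|].
    replace (IZR k * (1 / 2)) with (IZR k * - (1 / 2) + IZR k) by field.
    rewrite cis_plus, cis_IZR. ring.
Qed.

(** Only the partial sums are required to converge uniformly: the Fourier series of f_alpha need
    not converge absolutely. *)
Definition fourier_uniform (c : nat -> C) (g : R -> C) : Prop :=
  exists d : nat -> R, is_lim_seq d 0 /\
    forall n t, Cmod (g t - csum (fun i => c i * cis (INR i * t)) n)%C <= d n.

(** Uniform convergence allows integration term by term, and orthogonality keeps one term. *)
Lemma fourier_uniform_coefficient (c : nat -> C) (g : R -> C) (m : nat) :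
  fourier_uniform c g -> period_integral (fun t => cis (- INR m * t) * g t)%C (c m).
Proof.
  intros [d [Hd Hg]].
  set (l := fun i : nat => if Nat.eq_dec i m then c m else RtoC 0).
  apply period_integral_uniform_limit
    with (fun n t => cis (- INR m * t) * csum (fun i => c i * cis (INR i * t)) n)%C (csum l) d.
  - intros n.
    eapply period_integral_ext; [intros t; apply csum_scal|].
    apply period_integral_csum. intros i _.
    assert (K := period_integral_scal (c i) _ _ (period_integral_cis (Z.of_nat i - Z.of_nat m))).
    replace (l i) with (c i * (if Z.eq_dec (Z.of_nat i - Z.of_nat m) 0 then RtoC 1 else RtoC 0))%C.
    2:{ unfold l. destruct (Nat.eq_dec i m) as [->|Hne]; destruct Z.eq_dec; try lia; ring. }
    eapply period_integral_ext; [|exact K]. intros t. simpl.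
    rewrite minus_IZR, <- !INR_IZR_INZ.
    replace ((INR i - INR m) * t) with (- INR m * t + INR i * t) by ring.
    rewrite cis_plus. ring.
  - intros n t. replace (cis (- INR m * t) * g t - cis (- INR m * t) * csum (fun i => c i * cis (INR i * t)) n)%C
      with (cis (- INR m * t) * (g t - csum (fun i => c i * cis (INR i * t)) n))%C by ring.
    rewrite Cmod_mult, Cmod_cis, Rmult_1_l. apply Hg.
  - exact Hd.
  - apply (Clim_incr _ _ (S m)). apply Clim_ext with (fun _ => c m); [|apply Clim_const].
    intros n. rewrite Nat.add_comm. 
    rewrite (csum_eventually_zero l (S m) (S m + n)); [|lia|].
    + simpl. rewrite csum_zero.
      * unfold l. destruct Nat.eq_dec; [ring|lia].
      * intros i Hi. unfold l. destruct Nat.eq_dec; [lia|reflexivity].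
    + intros i Hi. unfold l. destruct Nat.eq_dec; [lia|reflexivity].
Qed.

Lemma fourier_pairing_finite (c k : nat -> C) (g : R -> C) (n : nat) :
  fourier_uniform c g ->
  period_integral (fun t => csum (fun m => k m * cis (- INR m * t)) n * g t)%C
    (csum (fun m => k m * c m)%C n).
Proof.
  intros Hg.
  apply period_integral_ext with (fun t => csum (fun m => k m * (cis (- INR m * t) * g t)) n)%C.
  { intros t. rewrite (Cmult_comm _ (g t)), <- csum_scal. apply csum_ext. intros; ring. }
  apply period_integral_csum. intros m _.
  apply period_integral_scal. now apply fourier_uniform_coefficient.
Qed.

(** Parseval's formula.  The kernel is truncated first, so that [g] is only ever integrated
    against trigonometric polynomials. *)
Lemma fourier_pairing (c k : nat -> C) (g K : R -> C) (B : R) (d : nat -> R) (l : C) :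
  fourier_uniform c g -> (forall t, Cmod (g t) <= B) ->
  is_lim_seq d 0 ->
  (forall n t, Cmod (K t - csum (fun m => k m * cis (- INR m * t)) n)%C <= d n) ->
  Clim (csum (fun m => k m * c m)%C) l -> period_integral (fun t => K t * g t)%C l.
Proof.
  intros Hg HB Hd HK Hl.
  apply period_integral_uniform_limit
    with (fun n t => csum (fun m => k m * cis (- INR m * t)) n * g t)%C
         (csum (fun m => k m * c m)%C) (fun n => d n * B).
  - intros n. now apply fourier_pairing_finite.
  - intros n t.
    replace (K t * g t - csum (fun m => k m * cis (- INR m * t)) n * g t)%C
      with ((K t - csum (fun m => k m * cis (- INR m * t)) n) * g t)%C by ring.
    rewrite Cmod_mult. apply Rmult_le_compat; auto using Cmod_ge_0.
  - replace 0 with (0 * B) by ring. now apply (is_lim_seq_scal_r _ B 0).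
  - exact Hl.
Qed.

(** Both kernels below are dominated by a power of |t| + y, which is comparable with the distance
    from t to iy. *)
Lemma is_RInt_peak (phi : R -> R) (y a : R) : 0 < y -> a <> 0 ->
  (forall t, t <> 0 -> phi t = Rpower (Rabs t + y) (a - 1)) ->
  is_RInt phi (- (1 / 2)) (1 / 2) (2 * ((Rpower (1 / 2 + y) a - Rpower y a) / a)).
Proof.
  intros Hy Ha Hphi.
  replace (2 * ((Rpower (1 / 2 + y) a - Rpower y a) / a)) with
    (plus ((Rpower (1 / 2 + y) a - Rpower y a) / a) ((Rpower (1 / 2 + y) a - Rpower y a) / a))
    by (unfold plus; simpl; ring).
  apply (is_RInt_Chasles (V := R_NormedModule) _ _ 0).
  - apply is_RInt_ext with (fun t => Rpower (y - t) (a - 1)).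
    { intros t. rewrite Rmin_left, Rmax_right by lra. intros Ht.
      rewrite Hphi, Rabs_left by lra. f_equal. ring. }
    replace ((Rpower (1 / 2 + y) a - Rpower y a) / a) with
      (minus (- (Rpower (y - 0) a / a)) (- (Rpower (y - - (1 / 2)) a / a))).
    2:{ unfold minus, plus, opp. simpl. replace (y - 0) with y by ring.
        replace (y - - (1 / 2)) with (1 / 2 + y) by ring. field. auto. }
    apply (is_RInt_derive (fun t => - (Rpower (y - t) a / a))).
    + intros t. rewrite Rmin_left, Rmax_right by lra. intros Ht.
      unfold Rpower. auto_derive; [lra|].
      replace ((a - 1) * ln (y - t)) with (a * ln (y - t) + - ln (y - t)) by ring.
      replace (y + - t) with (y - t) by ring.
      rewrite exp_plus, exp_Ropp, exp_ln by lra. field. lra.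
    + intros t. rewrite Rmin_left, Rmax_right by lra. intros Ht.
      apply (@ex_derive_continuous R_AbsRing R_NormedModule). unfold Rpower. auto_derive. lra.
  - apply is_RInt_ext with (fun t => Rpower (t + y) (a - 1)).
    { intros t. rewrite Rmin_left, Rmax_right by lra. intros Ht.
      rewrite Hphi, Rabs_pos_eq by lra. reflexivity. }
    replace ((Rpower (1 / 2 + y) a - Rpower y a) / a) with
      (minus (Rpower (1 / 2 + y) a / a) (Rpower (0 + y) a / a)).
    2:{ unfold minus, plus, opp. simpl. rewrite Rplus_0_l. field. auto. }
    apply (is_RInt_derive (fun t => Rpower (t + y) a / a)).
    + intros t. rewrite Rmin_left, Rmax_right by lra. intros Ht.
      unfold Rpower. auto_derive; [lra|].
      replace ((a - 1) * ln (t + y)) with (a * ln (t + y) + - ln (t + y)) by ring.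
      rewrite exp_plus, exp_Ropp, exp_ln by lra. field. lra.
    + intros t. rewrite Rmin_left, Rmax_right by lra. intros Ht.
      apply (@ex_derive_continuous R_AbsRing R_NormedModule). unfold Rpower. auto_derive. lra.
Qed.

(** The point t = 0 is left out, since a punctured neighbourhood is all that a pointwise Hoelder
    condition speaks about. *)
Lemma period_integral_peak_bound (F : R -> C) (l : C) (A y a : R) : 0 < A -> 0 < y -> a <> 0 ->
  period_integral F l ->
  (forall t, 0 < Rabs t <= 1 / 2 -> Cmod (F t) <= A * Rpower (Rabs t + y) (a - 1)) ->
  Cmod l <= A * (2 * ((Rpower (1 / 2 + y) a - Rpower y a) / a)).
Proof.
  intros HA Hy Ha HF Hb.
  set (phi := fun t => if Req_EM_T t 0 then Cmod (F 0) / A else Rpower (Rabs t + y) (a - 1)).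
  apply (period_integral_bound F l (fun t => A * phi t)); [exact HF| |].
  - intros t Ht. unfold phi. destruct (Req_EM_T t 0) as [->|Hne].
    + right. field. lra.
    + apply Hb. split; [now apply Rabs_pos_lt|exact Ht].
  - apply (is_RInt_scal (V := R_NormedModule)). apply is_RInt_peak; auto.
    intros t Ht. unfold phi. destruct (Req_EM_T t 0); [contradiction|reflexivity].
Qed.

(** * Growth of the sums of a_m e(mx) *)

Lemma sin_lower_bound (t : R) : Rabs t <= 1 / 2 -> Rabs t <= Rabs (sin (PI * t)).
Proof.
  assert (HP : forall s, 0 <= s <= 1 / 2 -> s <= sin (PI * s)).
  { intros s Hs. assert (P1 := PI2_3_2). assert (P2 := PI_4).
    assert (0 <= PI * s) by nra. assert (PI * s <= 2) by nra.
    (* sin x >= x - x^3/6 >= x/3 for 0 <= x <= 2, and PI >= 3. *)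
    assert (B := proj1 (pre_sin_bound (PI * s) 0 ltac:(lra) ltac:(lra))).
    unfold sin_approx, sin_term in B. simpl in B.
    set (x := PI * s) in *. assert (3 * s <= x) by (unfold x; nra).
    assert (x * (1 / 3) <= x * (1 - x * x / 6)); [|lra].
    apply Rmult_le_compat_l; nra. }
  intros Ht. destruct (Rle_dec 0 t) as [H|H].
  - rewrite (Rabs_pos_eq t) in * by lra.
    eapply Rle_trans; [apply HP; lra|apply Rle_abs].
  - rewrite (Rabs_left t) in * by lra.
    replace (PI * t) with (- (PI * - t)) by ring. rewrite sin_neg, Rabs_Ropp.
    eapply Rle_trans; [apply HP; lra|apply Rle_abs].
Qed.

Lemma Cmod_1_minus_polar (rho t : R) :
  Cmod (1 - RtoC rho * cis t)%C ^ 2 = (1 - rho) ^ 2 + 4 * rho * sin (PI * t) ^ 2.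
Proof.
  rewrite Cmod2_alt. unfold cis. simpl.
  replace (2 * PI * t) with (2 * (PI * t)) by ring.
  assert (H := sin2_cos2 (2 * (PI * t))). unfold Rsqr in H.
  assert (H2 := cos_2a_sin (PI * t)).
  set (c := cos (2 * (PI * t))) in *. set (s := sin (2 * (PI * t))) in *.
  set (u := sin (PI * t)) in *.
  transitivity (1 - 2 * rho * c + rho * rho * (s * s + c * c)); [ring|].
  rewrite H, H2. ring.
Qed.

Lemma Cmod_1_minus_polar_ge (rho t : R) : 0 <= rho -> Rabs t <= 1 / 2 ->
  4 * rho * t ^ 2 <= Cmod (1 - RtoC rho * cis t)%C ^ 2.
Proof.
  intros Hr Ht. rewrite Cmod_1_minus_polar.
  assert (H := sin_lower_bound t Ht).
  assert (t ^ 2 <= sin (PI * t) ^ 2).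
  { rewrite <- (pow2_abs t), <- (pow2_abs (sin _)). apply pow_incr. split; [apply Rabs_pos|exact H]. }
  assert (0 <= (1 - rho) ^ 2) by apply pow2_ge_0. nra.
Qed.

Lemma csum_geometric_identity (u : C) (n : nat) :
  ((1 - u) * csum (fun m => u ^ m) n = 1 - u ^ n)%C.
Proof. induction n as [|n IH]; simpl; [ring|]. rewrite Cmult_plus_distr_l, IH. ring. Qed.

(** The n terms have modulus at most exp(2 pi), which controls the kernel times 1/n; being
    geometric with a ratio u outside the open unit disc, the sum times 1 - u is also bounded, which
    controls the kernel times |t|, as 2 |t| <= |1 - u|. *)
Lemma dirichlet_kernel_bound (n : nat) (t : R) : (1 <= n)%nat -> Rabs t <= 1 / 2 ->
  Cmod (csum (fun m => RtoC (exp (2 * PI * INR m / INR n)) * cis (- INR m * t))%C n)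
    * (Rabs t + / INR n) <= 1 + 2 * exp (2 * PI).
Proof.
  intros Hn Ht. assert (HPI := PI_RGT_0).
  assert (Hn1 : 1 <= INR n) by (apply (le_INR 1); exact Hn).
  set (rho := exp (2 * PI / INR n)).
  assert (Hrho : 1 <= rho).
  { unfold rho. apply Rle_trans with (exp 0); [rewrite exp_0; lra|]. apply exp_le_compat.
    apply Rmult_le_pos; [lra|left; apply Rinv_0_lt_compat; lra]. }
  set (u := (RtoC rho * cis (- t))%C).
  assert (Hu : forall m, (u ^ m = RtoC (exp (2 * PI * INR m / INR n)) * cis (- INR m * t))%C).
  { intros m. unfold u. rewrite Cpow_mult_l, <- RtoC_pow, cis_pow. unfold rho. rewrite pow_exp.
    f_equal; [f_equal; f_equal; field; lra|f_equal; ring]. }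
  rewrite (csum_ext _ (fun m => u ^ m)%C) by (intros; now rewrite Hu).
  assert (Hum : forall m, (m <= n)%nat -> Cmod (u ^ m)%C <= exp (2 * PI)).
  { intros m Hm. rewrite Hu, Cmod_mult, Cmod_cis, Cmod_R, Rabs_pos_eq by (left; apply exp_pos).
    rewrite Rmult_1_r. apply exp_le_compat. apply le_INR in Hm.
    apply Rmult_le_reg_r with (INR n); [lra|]. unfold Rdiv. rewrite Rmult_assoc, Rinv_l by lra. nra. }
  set (D := csum (fun m => u ^ m)%C n).
  assert (HD1 : Cmod D <= INR n * exp (2 * PI)).
  { apply csum_const_bound. intros i Hi. apply Hum. lia. }
  assert (HD2 : Cmod D * (2 * Rabs t) <= 1 + exp (2 * PI)).
  { apply Rle_trans with (Cmod D * Cmod (1 - u)%C).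
    - apply Rmult_le_compat_l; [apply Cmod_ge_0|].
      apply Rsqr_incr_0_var; [|apply Cmod_ge_0]. rewrite !Rsqr_pow2.
      eapply Rle_trans; [|apply Cmod_1_minus_polar_ge; [lra|now rewrite Rabs_Ropp]].
      rewrite Rpow_mult_distr, pow2_abs. replace ((- t) ^ 2) with (t ^ 2) by ring.
      assert (0 <= t ^ 2) by apply pow2_ge_0. nra.
    - rewrite <- Cmod_mult, Cmult_comm. unfold D. rewrite csum_geometric_identity.
      eapply Rle_trans; [apply Cmod_minus_le|]. rewrite Cmod_1. apply Rplus_le_compat_l. apply Hum. lia. }
  assert (HD0 := Cmod_ge_0 D). assert (He := exp_pos (2 * PI)).
  assert (HD3 : Cmod D * / INR n <= exp (2 * PI)).
  { apply Rmult_le_reg_r with (INR n); [lra|]. rewrite Rmult_assoc, Rinv_l by lra. lra. }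
  lra.
Qed.

Lemma fourier_expansion_Clim (f : C -> C) (a : nat -> C) (x y : R) :
  fourier_expansion f a -> 0 < y ->
  Clim (csum (fun n => a n * (RtoC (exp (- (2 * PI * (INR n * y)))) * cis (INR n * x)))%C) (f (x, y)).
Proof.
  intros Ha Hy. assert (H := is_series_Clim _ _ (Ha (x, y) Hy)).
  eapply Clim_ext; [|exact H]. intros n. apply csum_ext. intros i _. cbv beta.
  rewrite e_cis. f_equal. f_equal; [f_equal; f_equal; simpl; ring|f_equal; simpl; ring].
Qed.

(** Convergence at height y/2 leaves a geometric factor at height y. *)
Lemma fourier_expansion_geometric (f : C -> C) (a : nat -> C) (y : R) :
  fourier_expansion f a -> 0 < y ->
  exists M rho, 0 <= rho < 1 /\ forall n, Cmod (a n) * exp (- (2 * PI * (INR n * y))) <= M * rho ^ n.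
Proof.
  intros Ha Hy. assert (HPI := PI_RGT_0).
  assert (H := fourier_expansion_Clim f a 0 (y / 2) Ha ltac:(lra)).
  destruct (Clim_csum_terms_bounded _ _ H) as [M [HM HMb]].
  exists M, (exp (- (PI * y))). split.
  - split; [left; apply exp_pos|]. apply Rlt_le_trans with (exp 0); [|rewrite exp_0; lra].
    apply exp_increasing. nra.
  - intros n. specialize (HMb n).
    rewrite !Cmod_mult, Cmod_cis, Cmod_R, Rabs_pos_eq in HMb by (left; apply exp_pos).
    rewrite pow_exp.
    replace (exp (- (2 * PI * (INR n * y)))) with
      (exp (- (2 * PI * (INR n * (y / 2)))) * exp (INR n * - (PI * y))).
    2:{ rewrite <- exp_plus. f_equal. field. }
    rewrite <- Rmult_assoc. apply Rmult_le_compat_r; [left; apply exp_pos|]. lra.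
Qed.

Lemma fourier_uniform_height (f : C -> C) (a : nat -> C) (x y : R) :
  fourier_expansion f a -> 0 < y ->
  fourier_uniform (fun n => a n * (RtoC (exp (- (2 * PI * (INR n * y)))) * cis (INR n * x)))%C
    (fun t => f (x + t, y)).
Proof.
  intros Ha Hy. destruct (fourier_expansion_geometric f a y Ha Hy) as [M [rho [Hrho HM]]].
  exists (fun n => M / (1 - rho) * rho ^ n). split.
  - replace 0 with (M / (1 - rho) * 0) by ring.
    apply (is_lim_seq_scal_l _ _ 0). apply is_lim_seq_geom. rewrite Rabs_pos_eq; lra.
  - intros n t. assert (H := fourier_expansion_Clim f a (x + t) y Ha Hy).
    set (u := fun i => (a i * (RtoC (exp (- (2 * PI * (INR i * y)))) * cis (INR i * (x + t))))%C) in H.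
    destruct (csum_geometric u M rho Hrho) as [l [Hl Hb]].
    + intros i. unfold u. rewrite !Cmod_mult, Cmod_cis, Cmod_R, Rabs_pos_eq by (left; apply exp_pos).
      rewrite Rmult_1_r. apply HM.
    + rewrite (Clim_unique _ _ _ H Hl).
      rewrite (csum_ext _ u); [apply Hb|].
      intros i _. unfold u. rewrite Rmult_plus_distr_l, cis_plus. ring.
Qed.

(** The sum is recovered from f at height y = 1/n, where |f| <= B n^r, by integration against the
    kernel above.  The kernel has L^1 norm of order log n; bounding 1/(|t| + y) by
    y^(-eps) (|t| + y)^(eps-1) replaces the logarithm by n^eps and keeps the integrals powers. *)
Lemma fourier_sum_growth (f : C -> C) (a : nat -> C) (r eps B : R) :
  fourier_expansion f a -> 0 < eps -> 0 < B ->
  (forall z, 0 < Im z <= 1 -> Cmod (f z) <= B * Rpower (Im z) (- r)) ->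
  exists A, 0 <= A /\ forall x n, (1 <= n)%nat ->
    Cmod (csum (fun m => a m * cis (INR m * x))%C n) <= A * Rpower (INR n) (r + eps).
Proof.
  intros Ha Heps HB0 HB.
  set (C1 := 1 + 2 * exp (2 * PI)).
  assert (HC1 : 0 < C1) by (unfold C1; assert (T := exp_pos (2 * PI)); lra).
  set (I0 := 2 * (Rpower 2 eps / eps)).
  assert (HI0 : 0 <= I0).
  { unfold I0. assert (T := Rpower_pos 2 eps). assert (0 < Rpower 2 eps / eps) by (apply Rdiv_lt_0_compat; lra). lra. }
  exists (B * C1 * I0). split; [apply Rmult_le_pos; [apply Rmult_le_pos|]; lra|].
  intros x n Hn. assert (Hn1 : 1 <= INR n) by (apply (le_INR 1); exact Hn).
  (* The height at which the exponential weights of the kernel are bounded for all m < n. *)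
  set (y := / INR n).
  assert (Hy : 0 < y <= 1).
  { split; [apply Rinv_0_lt_compat; lra|]. rewrite <- Rinv_1. apply Rinv_le_contravar; lra. }
  assert (K := fourier_pairing_finite _ (fun m => RtoC (exp (2 * PI * INR m / INR n))) _ n
     (fourier_uniform_height f a x y Ha (proj1 Hy))).
  rewrite (csum_ext _ (fun m => a m * cis (INR m * x))%C) in K.
  2:{ intros i _. rewrite (Cmult_comm (a i)). rewrite !Cmult_assoc, <- RtoC_mult, <- exp_plus.
      replace (2 * PI * INR i / INR n + - (2 * PI * (INR i * y))) with 0 by (unfold y; field; lra).
      rewrite exp_0. ring. }
  assert (HBp : 0 < B * Rpower (INR n) (r + eps) * C1).
  { assert (T := Rpower_pos (INR n) (r + eps)). apply Rmult_lt_0_compat; [apply Rmult_lt_0_compat|]; lra. }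
  apply (period_integral_peak_bound _ _ _ y eps HBp) in K; [| lra | lra |].
  - eapply Rle_trans; [exact K|].
    replace (B * C1 * I0 * Rpower (INR n) (r + eps)) with (B * Rpower (INR n) (r + eps) * C1 * I0) by ring.
    apply Rmult_le_compat_l.
    { lra. }
    unfold I0. apply Rmult_le_compat_l; [lra|]. unfold Rdiv.
    apply Rmult_le_compat_r; [left; now apply Rinv_0_lt_compat|].
    assert (T := Rpower_pos y eps).
    assert (Rpower (1 / 2 + y) eps <= Rpower 2 eps) by (apply Rle_Rpower_l; lra). lra.
  - intros t [_ Ht]. rewrite Cmod_mult.
    assert (HD := dirichlet_kernel_bound n t Hn Ht). fold C1 y in HD.
    set (D := Cmod (csum _ n)) in *.
    assert (Hpos : 0 < Rabs t + y) by (assert (T := Rabs_pos t); lra).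
    assert (HD' : D <= C1 * (Rpower y (- eps) * Rpower (Rabs t + y) (eps - 1))).
    { apply Rle_trans with (C1 * / (Rabs t + y)).
      - apply Rmult_le_reg_r with (Rabs t + y); [exact Hpos|]. rewrite Rmult_assoc, Rinv_l by lra. lra.
      - apply Rmult_le_compat_l; [lra|].
        replace (/ (Rabs t + y)) with (Rpower (Rabs t + y) (- eps) * Rpower (Rabs t + y) (eps - 1)).
        2:{ rewrite <- Rpower_plus. replace (- eps + (eps - 1)) with (- (1)) by ring.
            rewrite Rpower_Ropp, Rpower_1 by lra. reflexivity. }
        apply Rmult_le_compat_r; [left; apply Rpower_pos|]. apply Rpower_le_neg; [lra|].
        assert (T := Rabs_pos t). lra. }
    assert (Hf := HB (x + t, y) Hy). simpl in Hf.
    assert (E : Rpower (INR n) (r + eps) = Rpower y (- r) * Rpower y (- eps)).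
    { unfold y. rewrite !Rpower_Rinv, !Ropp_involutive by lra. apply Rpower_plus. }
    rewrite E.
    replace (B * (Rpower y (- r) * Rpower y (- eps)) * C1 * Rpower (Rabs t + y) (eps - 1)) with
      ((C1 * (Rpower y (- eps) * Rpower (Rabs t + y) (eps - 1))) * (B * Rpower y (- r))) by ring.
    apply Rmult_le_compat; auto; unfold D; apply Cmod_ge_0.
Qed.

(** * Summation by parts *)

Lemma Rpower_comparable_inv (a x y : R) :
  0 < x -> x <= y <= 2 * x -> Rpower x a <= Rpower 2 (Rabs a) * Rpower y a.
Proof.
  intros Hx Hy. assert (H := Rpower_comparable (- a) x y Hx Hy).
  rewrite Rabs_Ropp, !(Rpower_Ropp _ a) in H.
  assert (Px := Rpower_pos x a). assert (Py := Rpower_pos y a).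
  apply Rmult_le_reg_r with (/ Rpower y a * / Rpower x a).
  { apply Rmult_lt_0_compat; now apply Rinv_0_lt_compat. }
  field_simplify; [|lra|lra]. unfold Rdiv. rewrite Rmult_1_l. exact H.
Qed.

Lemma Rpower_increment (a x : R) : 0 < x ->
  exists xi, x <= xi <= x + 1 /\ Rpower (x + 1) a - Rpower x a = a * Rpower xi (a - 1).
Proof.
  intros Hx. destruct (MVT_gen (fun t => Rpower t a) x (x + 1) (fun t => a * Rpower t (a - 1))) as [xi [Hxi E]].
  - intros t. rewrite Rmin_left by lra. intros Ht. apply is_derive_Rpower. lra.
  - intros t. rewrite Rmin_left by lra. intros Ht. apply continuity_pt_filterlim.
    apply (@ex_derive_continuous R_AbsRing R_NormedModule (fun t => Rpower t a)).
    eexists. apply is_derive_Rpower. lra.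
  - rewrite Rmin_left, Rmax_right in Hxi by lra. exists xi. split; [exact Hxi|].
    rewrite E. ring.
Qed.

Lemma Rpower_increment_le (a x : R) : 1 <= x ->
  Rabs (Rpower (x + 1) a - Rpower x a) <= Rabs a * Rpower 2 (Rabs (a - 1)) * Rpower x (a - 1).
Proof.
  intros Hx. destruct (Rpower_increment a x ltac:(lra)) as [xi [Hxi E]].
  rewrite E, Rabs_mult, (Rabs_pos_eq (Rpower xi _)) by (left; apply Rpower_pos).
  rewrite Rmult_assoc. apply Rmult_le_compat_l; [apply Rabs_pos|].
  apply Rpower_comparable; lra.
Qed.

Lemma Rpower_increment_ge (a x : R) : 1 <= x -> a <> 0 ->
  Rpower x (a - 1) <= Rpower 2 (Rabs (a - 1)) / a * Rpower (x + 1) a - Rpower 2 (Rabs (a - 1)) / a * Rpower x a.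
Proof.
  intros Hx Ha. destruct (Rpower_increment a x ltac:(lra)) as [xi [Hxi E]].
  rewrite <- Rmult_minus_distr_l, E.
  replace (Rpower 2 (Rabs (a - 1)) / a * (a * Rpower xi (a - 1)))
    with (Rpower 2 (Rabs (a - 1)) * Rpower xi (a - 1)) by (field; auto).
  apply Rpower_comparable_inv; lra.
Qed.

(** The value 0 at n = 0 reflects that f_alpha has no constant term, and it makes
    n^(tau+1) = n^tau * n true for every n. *)
Definition npow (tau : R) (n : nat) : R :=
  match n with O => 0 | S _ => Rpower (INR n) tau end.

Lemma npow_pos_index (tau : R) (n : nat) : (1 <= n)%nat -> npow tau n = Rpower (INR n) tau.
Proof. destruct n; [lia|reflexivity]. Qed.

Lemma npow_plus_1 (tau : R) (n : nat) : npow (tau + 1) n = npow tau n * INR n.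
Proof.
  destruct n as [|n]; [simpl; ring|].
  unfold npow. apply Rpower_S. apply lt_0_INR. lia.
Qed.

(** Subtracting the boundary term n^tau * csum A n leaves a sequence whose increments are
    ((n+1)^tau - n^tau) * csum A (n+1) = O(n^(s-1)) with s = rho + tau; these are dominated by the
    increments of a multiple of n^s / s.  The bound is of the size of the larger of the two powers:
    it estimates tails for s < 0 and initial parts for s > 0. *)
Lemma abel_bound (rho tau B : R) : rho + tau <> 0 -> 0 <= B ->
  exists D, 0 <= D /\ forall A : nat -> C,
    (forall n, (1 <= n)%nat -> Cmod (csum A n) <= B * Rpower (INR n) rho) ->
    forall m n, (1 <= m <= n)%nat ->
    Cmod (csum (fun i => RtoC (npow tau i) * A i) n - csum (fun i => RtoC (npow tau i) * A i) m)%C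
      <= D * (Rpower (INR n) (rho + tau) + Rpower (INR m) (rho + tau)).
Proof.
  intros Hs HB. set (s := rho + tau) in *.
  set (D1 := B * (Rabs tau * Rpower 2 (Rabs (tau - 1)) * Rpower 2 (Rabs rho))).
  assert (HD1 : 0 <= D1).
  { unfold D1. assert (T1 := Rpower_pos 2 (Rabs (tau - 1))). assert (T2 := Rpower_pos 2 (Rabs rho)).
    assert (T3 := Rabs_pos tau). apply Rmult_le_pos; [auto|]. apply Rmult_le_pos; [|lra]. apply Rmult_le_pos; lra. }
  set (D2 := D1 * (Rpower 2 (Rabs (s - 1)) / s)).
  exists (B + Rabs D2). split; [assert (T := Rabs_pos D2); lra|].
  intros A HA m n Hmn.
  set (W := fun i => RtoC (npow tau i)).
  set (rem := fun k => (csum (fun i => W i * A i) k - W k * csum A k)%C).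
  assert (Hrem : Cmod (rem n - rem m)%C <= D2 * Rpower (INR n) s - D2 * Rpower (INR m) s).
  { apply (telescope_bound rem (fun i => D2 * Rpower (INR i) s)); [lia|].
    intros i Hi. assert (Hi1 : 1 <= INR i) by (apply (le_INR 1); lia).
    replace (rem (S i) - rem i)%C with (- (W (S i) - W i) * csum A (S i))%C
      by (unfold rem; simpl; ring).
    rewrite Cmod_mult, Cmod_opp. unfold W. rewrite <- RtoC_minus, Cmod_R.
    rewrite !npow_pos_index by lia.
    apply Rle_trans with ((Rabs tau * Rpower 2 (Rabs (tau - 1)) * Rpower (INR i) (tau - 1)) *
       (B * (Rpower 2 (Rabs rho) * Rpower (INR i) rho))).
    - apply Rmult_le_compat; [apply Rabs_pos|apply Cmod_ge_0| |].
      + rewrite S_INR. now apply Rpower_increment_le.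
      + eapply Rle_trans; [apply HA; lia|]. apply Rmult_le_compat_l; [exact HB|].
        rewrite S_INR. apply Rpower_comparable; lra.
    - replace ((Rabs tau * Rpower 2 (Rabs (tau - 1)) * Rpower (INR i) (tau - 1)) *
       (B * (Rpower 2 (Rabs rho) * Rpower (INR i) rho))) with (D1 * (Rpower (INR i) (tau - 1) * Rpower (INR i) rho))
        by (unfold D1; ring).
      rewrite <- Rpower_plus. replace (tau - 1 + rho) with (s - 1) by (unfold s; ring).
      unfold D2. rewrite !Rmult_assoc, <- Rmult_minus_distr_l. apply Rmult_le_compat_l; [exact HD1|].
      rewrite S_INR. now apply Rpower_increment_ge. }
  assert (HW : forall k, (1 <= k)%nat -> Cmod (W k * csum A k)%C <= B * Rpower (INR k) s).
  { intros k Hk. rewrite Cmod_mult. unfold W. rewrite Cmod_R, npow_pos_index, Rabs_pos_eq by (auto; left; apply Rpower_pos).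
    unfold s. rewrite Rpower_plus.
    replace (B * (Rpower (INR k) rho * Rpower (INR k) tau)) with (Rpower (INR k) tau * (B * Rpower (INR k) rho)) by ring.
    apply Rmult_le_compat_l; [left; apply Rpower_pos|auto]. }
  apply Rle_trans with (Cmod ((rem n - rem m) + (W n * csum A n - W m * csum A m))%C).
  { right. f_equal. unfold rem, W. ring. }
  eapply Rle_trans; [apply Cmod_triangle|].
  assert (K := Cmod_minus_le (W n * csum A n) (W m * csum A m)).
  assert (K1 := HW n ltac:(lia)). assert (K2 := HW m ltac:(lia)).
  assert (Pn := Rpower_pos (INR n) s). assert (Pm := Rpower_pos (INR m) s).
  assert (T1 := Rle_abs D2). assert (T2 := Rle_abs (- D2)). rewrite Rabs_Ropp in T2.
  assert (Q1 : D2 * Rpower (INR n) s <= Rabs D2 * Rpower (INR n) s) by (apply Rmult_le_compat_r; lra).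
  assert (Q2 : - D2 * Rpower (INR m) s <= Rabs D2 * Rpower (INR m) s) by (apply Rmult_le_compat_r; lra).
  lra.
Qed.

(** * Taylor expansion of f_alpha at a real point *)

Definition fourier_sums_bounded (a : nat -> C) (rho : R) : Prop :=
  exists A, 0 <= A /\ forall x n, (1 <= n)%nat ->
    Cmod (csum (fun m => a m * cis (INR m * x))%C n) <= A * Rpower (INR n) rho.

Definition dirichlet_term (a : nat -> C) (tau x : R) (i : nat) : C :=
  (RtoC (npow tau i) * (a i * cis (INR i * x)))%C.

(** These are f_alpha and, for tau = j - alpha, its formal derivatives up to powers of 2 pi i; as
    [CSeries] is total, the coefficients of a Taylor polynomial can be written down before their
    convergence is known. *)
Definition dirichlet_series (a : nat -> C) (tau x : R) : C := CSeries (dirichlet_term a tau x).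

Lemma dirichlet_series_tail (a : nat -> C) (rho tau : R) :
  fourier_sums_bounded a rho -> rho + tau < 0 ->
  exists D, 0 <= D /\ forall x,
    Clim (csum (dirichlet_term a tau x)) (dirichlet_series a tau x) /\
    forall n, (1 <= n)%nat ->
      Cmod (dirichlet_series a tau x - csum (dirichlet_term a tau x) n)%C
        <= D * Rpower (INR n) (rho + tau).
Proof.
  intros [A [HA Ha]] Hs.
  destruct (abel_bound rho tau A ltac:(lra) HA) as [D [HD Hb]].
  exists (2 * D). split; [lra|]. intros x.
  assert (HC : forall m n, (1 <= m <= n)%nat ->
    Cmod (csum (dirichlet_term a tau x) n - csum (dirichlet_term a tau x) m)%C <= 2 * D * Rpower (INR m) (rho + tau)).
  { intros m n Hmn. eapply Rle_trans; [apply (Hb (fun i => a i * cis (INR i * x))%C (Ha x) m n Hmn)|].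
    assert (Rpower (INR n) (rho + tau) <= Rpower (INR m) (rho + tau)).
    { apply Rpower_le_neg; [lra|]. split; [apply lt_0_INR; lia|apply le_INR; lia]. }
    nra. }
  destruct (Clim_of_Cauchy (fun n => csum (dirichlet_term a tau x) (S n))
     (fun m => 2 * D * Rpower (INR (S m)) (rho + tau))) as [l [Hl Hlb]].
  - intros m n Hmn. apply HC. lia.
  - replace 0 with (2 * D * 0) by ring. apply (is_lim_seq_scal_l _ _ 0).
    now apply is_lim_seq_Rpower_neg.
  - assert (Hl' : Clim (csum (dirichlet_term a tau x)) l).
    { apply (Clim_incr _ _ 1). eapply Clim_ext; [|exact Hl]. intros n. cbv beta. now rewrite Nat.add_1_r. }
    unfold dirichlet_series. rewrite (CSeries_Clim _ _ Hl'). split; [exact Hl'|].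
    intros [|n] Hn; [lia|]. apply Hlb.
Qed.

Lemma dirichlet_sum_head (a : nat -> C) (rho tau : R) :
  fourier_sums_bounded a rho -> 0 < rho + tau ->
  exists D, 0 <= D /\ forall x n, (1 <= n)%nat ->
    Cmod (csum (dirichlet_term a tau x) n) <= D * Rpower (INR n) (rho + tau).
Proof.
  intros [A [HA Ha]] Hs.
  destruct (abel_bound rho tau A ltac:(lra) HA) as [D [HD Hb]].
  exists (2 * D). split; [lra|]. intros x n Hn.
  assert (K : Cmod (csum (dirichlet_term a tau x) n - csum (dirichlet_term a tau x) 1)%C
      <= D * (Rpower (INR n) (rho + tau) + Rpower (INR 1) (rho + tau)))
    by exact (Hb (fun i => a i * cis (INR i * x))%C (Ha x) 1%nat n ltac:(lia)).
  replace (csum (dirichlet_term a tau x) 1) with (RtoC 0) in K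
    by (simpl; unfold dirichlet_term; simpl; ring).
  replace (csum (dirichlet_term a tau x) n - 0)%C with (csum (dirichlet_term a tau x) n) in K by ring.
  eapply Rle_trans; [exact K|]. simpl. rewrite Rpower_base_1.
  assert (1 <= Rpower (INR n) (rho + tau)).
  { rewrite <- (Rpower_base_1 (rho + tau)). apply Rle_Rpower_l; [lra|]. split; [lra|].
    apply (le_INR 1). exact Hn. }
  nra.
Qed.

Lemma e_RtoC (x : R) : e (RtoC x) = cis x.
Proof. rewrite e_cis. simpl. rewrite Rmult_0_r, Ropp_0, exp_0. ring. Qed.

Lemma f_alpha_dirichlet_series (a : nat -> C) (rho alpha x : R) :
  fourier_sums_bounded a rho -> rho < alpha ->
  f_alpha a alpha x = dirichlet_series a (- alpha) x.
Proof.
  intros Ha Hrho. destruct (dirichlet_series_tail a rho (- alpha) Ha ltac:(lra)) as [D [_ HD]].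
  destruct (HD x) as [Hl _]. unfold f_alpha. apply CSeries_Clim.
  apply (Clim_incr _ _ 1) in Hl. eapply Clim_ext; [|exact Hl].
  intros n. cbv beta. rewrite Nat.add_1_r, csum_first.
  replace (dirichlet_term a (- alpha) x 0) with (RtoC 0) by (unfold dirichlet_term; simpl; ring).
  rewrite Cplus_0_l. apply csum_ext. intros i _.
  unfold dirichlet_term. rewrite e_RtoC, npow_pos_index by lia.
  rewrite Rpower_Ropp, RtoC_inv by (apply Rgt_not_eq, Rpower_pos).
  unfold Cdiv. ring.
Qed.

Lemma curve_derive_pow (n : nat) :
  curve_derive (fun t => RtoC (t ^ S n / INR (fact (S n)))) (fun t => RtoC (t ^ n / INR (fact n))).
Proof.
  intros t. split; simpl Re; simpl Im.
  - apply is_derive_ext with (fun x => / INR (fact (S n)) * x ^ S n).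
    { intros x. apply Rmult_comm. }
    replace (t ^ n / INR (fact n)) with (/ INR (fact (S n)) * (INR (S n) * t ^ n)).
    2:{ rewrite fact_simpl, mult_INR. field.
        split; [apply INR_fact_neq_0|apply not_0_INR; lia]. }
    apply is_derive_Reals, derivable_pt_lim_scal, derivable_pt_lim_pow.
  - apply @is_derive_const.
Qed.

(** Induction on the order: the derivative of the remainder is the remainder of g 1, one order
    lower.  Each integration costs the factor 2 of [curve_increment_bound]. *)
Lemma taylor_bound (g : nat -> R -> C) (m : nat) (B t : R) :
  (forall j, curve_derive (g j) (g (S j))) ->
  (forall x, Cmod (g m x) <= B) ->
  Cmod (g O t - csum (fun j => g j 0 * RtoC (t ^ j / INR (fact j))) m)%C <= 2 ^ m * B * Rabs t ^ m.
Proof.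
  revert g t. induction m as [|m IH]; intros g t Hd HB.
  - simpl. replace (g O t - 0)%C with (g O t) by ring. specialize (HB t). lra.
  - set (F := fun x => (g O x - csum (fun j => g j 0 * RtoC (x ^ j / INR (fact j))) (S m))%C).
    set (F' := fun x => (g 1%nat x - csum (fun j => g (S j) 0 * RtoC (x ^ j / INR (fact j))) m)%C).
    assert (DF : curve_derive F F').
    { apply curve_derive_ext with
        (fun x => g O x + (RtoC (-1) * csum (fun j => g (S j) 0 * RtoC (x ^ S j / INR (fact (S j)))) m + - g O 0))%C
        (fun x => g 1%nat x + (RtoC (-1) * csum (fun j => g (S j) 0 * RtoC (x ^ j / INR (fact j))) m + RtoC 0))%C.
      - intros x. unfold F. rewrite csum_first. simpl pow at 2. simpl fact at 2. simpl INR at 2.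
        replace (1 / 1) with 1 by field. ring.
      - intros x. unfold F'. ring.
      - apply curve_derive_plus; [apply Hd|]. apply curve_derive_plus; [|apply curve_derive_const].
        apply curve_derive_scal. apply (curve_derive_csum (fun j x => g (S j) 0 * RtoC (x ^ S j / INR (fact (S j))))%C
           (fun j x => g (S j) 0 * RtoC (x ^ j / INR (fact j)))%C).
        intros j _. apply curve_derive_scal, curve_derive_pow. }
    assert (F0 : F 0 = RtoC 0).
    { unfold F. rewrite csum_first, csum_zero.
      - simpl. replace (1 / 1) with 1 by field. ring.
      - intros i _. simpl pow. rewrite Rmult_0_l. unfold Rdiv. rewrite Rmult_0_l. ring. }
    assert (K := curve_increment_bound F F' (Rabs t) (2 ^ m * B) m t DF (Rle_refl _)).
    rewrite F0 in K. replace (F t - 0)%C with (F t) in K by ring.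
    change (Cmod (F t) <= 2 ^ S m * B * Rabs t ^ S m).
    replace (2 ^ S m * B) with (2 * (2 ^ m * B)) by (simpl; ring). apply K.
    intros x _. apply (IH (fun j => g (S j))); auto.
Qed.

Lemma dirichlet_sum_derive (a : nat -> C) (tau x0 : R) (n : nat) :
  curve_derive (fun t => csum (dirichlet_term a tau (x0 + t)) n)
    (fun t => RtoC (2 * PI) * Ci * csum (dirichlet_term a (tau + 1) (x0 + t)) n)%C.
Proof.
  eapply curve_derive_ext; [| |apply (curve_derive_csum
    (fun i t => RtoC (npow tau i) * (a i * cis (INR i * x0)) * cis (INR i * t))%C
    (fun i t => RtoC (npow tau i) * (a i * cis (INR i * x0)) *
        (RtoC (2 * PI * INR i) * Ci * cis (INR i * t)))%C n)].
  - intros t. apply csum_ext. intros i _. unfold dirichlet_term.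
    rewrite Rmult_plus_distr_l, cis_plus. ring.
  - intros t. cbv beta. rewrite <- csum_scal. apply csum_ext. intros i _. unfold dirichlet_term.
    rewrite Rmult_plus_distr_l, cis_plus, npow_plus_1, !RtoC_mult. ring.
  - intros i _. apply curve_derive_scal, curve_derive_cis.
Qed.

Lemma csum_bound_family {P : Type} (Q : P -> Prop) (u : nat -> P -> C) (phi : P -> R) (m : nat) :
  (forall j, (j < m)%nat -> exists D, 0 <= D /\ forall p, Q p -> Cmod (u j p) <= D * phi p) ->
  exists D, 0 <= D /\ forall p, Q p -> Cmod (csum (fun j => u j p) m) <= D * phi p.
Proof.
  induction m as [|m IH]; intros H.
  - exists 0. split; [lra|]. intros p _. simpl. rewrite Cmod_0. lra.
  - destruct IH as [D [HD Hb]]; [intros; apply H; lia|].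
    destruct (H m ltac:(lia)) as [D' [HD' Hb']].
    exists (D + D'). split; [lra|]. intros p Hp. simpl.
    eapply Rle_trans; [apply Cmod_triangle|]. specialize (Hb p Hp). specialize (Hb' p Hp). lra.
Qed.

(** The remainder has three parts: the tail of the series at x0 + t beyond M ~ 1/|t|, the Taylor
    remainder of the partial sum up to M, and the tails of the Taylor coefficients at x0.  Each is
    O(|t|^s) for s = alpha - rho; the strict inequalities k < s < k + 1 make the first k + 1
    coefficients converge and the derivative of order k + 1 diverge like a power of M. *)
Lemma f_alpha_taylor (a : nat -> C) (rho alpha x0 : R) (k : nat) :
  fourier_sums_bounded a rho -> INR k < alpha - rho < INR k + 1 ->
  exists (c : nat -> C) (K : R), 0 <= K /\ c O = f_alpha a alpha x0 /\
    forall t, 0 < Rabs t <= 1 ->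
      Cmod (f_alpha a alpha (x0 + t) - csum (fun j => c j * RtoC t ^ j) (S k))%C
        <= K * Rpower (Rabs t) (alpha - rho).
Proof.
  intros Ha Hk. set (s := alpha - rho) in *.
  assert (Hk0 := pos_INR k).
  assert (Hra : rho < alpha) by (unfold s in Hk; lra).
  set (w := (RtoC (2 * PI) * Ci)%C).
  assert (Hw : Cmod w = 2 * PI).
  { unfold w. rewrite Cmod_mult, Cmod_Ci, Cmod_R, Rabs_pos_eq by (assert (T := PI_RGT_0); lra). ring. }
  set (L := fun j => dirichlet_series a (INR j - alpha) x0).
  set (c := fun j => (w ^ j * RtoC (/ INR (fact j)) * L j)%C).
  (* The cut: M is the integer part of 1/|t|. *)
  assert (HM : forall t, 0 < Rabs t <= 1 -> exists M, (1 <= M)%nat /\ INR M * Rabs t <= 1 /\ 1 <= 2 * INR M * Rabs t).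
  { intros t Ht. assert (1 <= / Rabs t) by (rewrite <- Rinv_1; apply Rinv_le_contravar; lra).
    destruct (nfloor_ex (/ Rabs t)) as [M [M1 M2]]; [lra|].
    assert (1 <= M)%nat by (apply INR_lt; simpl; destruct M; [simpl in M2; lra|]; rewrite S_INR in *; assert (T := pos_INR M); lra).
    exists M. split; [auto|]. assert (1 <= INR M) by (apply (le_INR 1); auto).
    split.
    - apply Rmult_le_reg_r with (/ Rabs t); [lra|]. rewrite Rmult_assoc, Rinv_r by lra. lra.
    - apply Rmult_le_reg_r with (/ Rabs t); [lra|]. rewrite Rmult_assoc, Rinv_r by lra. lra. }
  assert (HMneg : forall t M b, b <= 0 -> 0 < Rabs t <= 1 -> (1 <= M)%nat -> 1 <= 2 * INR M * Rabs t ->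
    Rpower (INR M) b <= Rpower 2 (- b) * Rpower (Rabs t) (- b)).
  { intros t M b Hb Ht HM1 HM2. assert (1 <= INR M) by (apply (le_INR 1); auto).
    rewrite Rpower_mult_distr by lra.
    rewrite <- Rpower_Rinv by lra.
    apply Rpower_le_neg; [exact Hb|]. split; [apply Rinv_0_lt_compat; lra|].
    apply Rmult_le_reg_l with (2 * Rabs t); [lra|]. rewrite Rinv_r by lra. lra. }
  assert (Hsplit : forall t j, 0 < Rabs t -> Rabs t ^ j * Rpower (Rabs t) (s - INR j) = Rpower (Rabs t) s).
  { intros t j Ht. rewrite <- Rpower_pow, <- Rpower_plus by auto. f_equal. ring. }
  (* The pairs (t, M) in which the coefficient tails are estimated. *)
  set (Q := fun p : R * nat => 0 < Rabs (fst p) <= 1 /\ (1 <= snd p)%nat /\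
      1 <= 2 * INR (snd p) * Rabs (fst p)).
  destruct (dirichlet_series_tail a rho (- alpha) Ha ltac:(lra)) as [D1 [HD1 Hb1]].
  assert (HA : exists D, 0 <= D /\ forall p : R * nat, Q p ->
     Cmod (csum (fun j => w ^ j * RtoC (fst p ^ j / INR (fact j)) *
        (csum (dirichlet_term a (INR j - alpha) x0) (snd p) - L j))%C (S k)) <= D * Rpower (Rabs (fst p)) s).
  { apply (csum_bound_family Q (fun j p => w ^ j * RtoC (fst p ^ j / INR (fact j)) *
        (csum (dirichlet_term a (INR j - alpha) x0) (snd p) - L j))%C
      (fun p => Rpower (Rabs (fst p)) s)).
    intros j Hj. assert (Hjk : INR j <= INR k) by (apply le_INR; lia).
    destruct (dirichlet_series_tail a rho (INR j - alpha) Ha) as [D [HD Hb]]; [unfold s in Hk; lra|].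
    assert (Hf := INR_fact_lt_0 j).
    assert (Hi : 0 < / INR (fact j)) by now apply Rinv_0_lt_compat.
    assert (Hwj : 0 <= (2 * PI) ^ j) by (apply pow_le; assert (T := PI_RGT_0); lra).
    assert (HP2 := Rpower_pos 2 (s - INR j)).
    exists ((2 * PI) ^ j * / INR (fact j) * (D * Rpower 2 (s - INR j))). split.
    { apply Rmult_le_pos; apply Rmult_le_pos; lra. }
    intros [t M] [Ht [HM1 HM3]]. simpl in Ht, HM1, HM3 |- *.
    rewrite !Cmod_mult, Cmod_pow, Hw, Cmod_R, Cmod_minus_sym. unfold Rdiv.
    rewrite Rabs_mult, (Rabs_pos_eq (/ _)) by lra. rewrite <- RPow_abs.
    apply Rle_trans with ((2 * PI) ^ j * (Rabs t ^ j * / INR (fact j)) *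
       (D * (Rpower 2 (s - INR j) * Rpower (Rabs t) (s - INR j)))).
    - apply Rmult_le_compat_l.
      + apply Rmult_le_pos; [lra|]. apply Rmult_le_pos; [apply pow_le, Rabs_pos|lra].
      + eapply Rle_trans; [apply Hb; exact HM1|]. apply Rmult_le_compat_l; [exact HD|].
        replace (s - INR j) with (- (rho + (INR j - alpha))) by (unfold s; ring).
        apply HMneg; auto. unfold s in Hk. lra.
    - rewrite <- (Hsplit t j) by lra. right. ring. }
  destruct HA as [D2 [HD2 Hb2]].
  destruct (dirichlet_sum_head a rho (INR (S k) - alpha) Ha) as [D3 [HD3 Hb3]].
  { rewrite S_INR. unfold s in Hk. lra. }
  set (K := D1 * Rpower 2 s + D2 + 2 ^ S k * ((2 * PI) ^ S k * D3)).
  assert (HPI := PI_RGT_0).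
  exists c, K. split; [|split].
  - unfold K. assert (T := Rpower_pos 2 s).
    assert (0 <= D1 * Rpower 2 s) by (apply Rmult_le_pos; lra).
    assert (0 <= 2 ^ S k * ((2 * PI) ^ S k * D3)).
    { apply Rmult_le_pos; [apply pow_le; lra|]. apply Rmult_le_pos; [apply pow_le; lra|auto]. }
    lra.
  - unfold c, L. rewrite (f_alpha_dirichlet_series a rho) by auto. simpl. rewrite Rinv_1, Rminus_0_l. ring.
  - intros t Ht. destruct (HM t Ht) as [M [HM1 [HM2 HM3]]].
    set (T := fun j x => csum (dirichlet_term a (INR j - alpha) x) M).
    set (g := fun j x => (w ^ j * T j (x0 + x)%R)%C).
    assert (Hg : forall j, curve_derive (g j) (g (S j))).
    { intros j. assert (D := curve_derive_scal (w ^ j)%C _ _ (dirichlet_sum_derive a (INR j - alpha) x0 M)).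
      eapply curve_derive_ext; [| |exact D].
      - intros x. reflexivity.
      - intros x. unfold g, T. cbv beta. fold w.
        replace (INR (S j) - alpha) with (INR j - alpha + 1) by (rewrite S_INR; ring).
        simpl. ring. }
    assert (HgB : forall x, Cmod (g (S k) x) <= (2 * PI) ^ S k * (D3 * Rpower (INR M) (INR (S k) - s))).
    { intros x. unfold g. rewrite Cmod_mult, Cmod_pow, Hw. apply Rmult_le_compat_l; [apply pow_le; lra|].
      replace (INR (S k) - s) with (rho + (INR (S k) - alpha)) by (unfold s; ring). now apply Hb3. }
    assert (HT := taylor_bound g (S k) _ t Hg HgB).
    assert (Hp := Hb2 (t, M) (conj Ht (conj HM1 HM3))). simpl fst in Hp. simpl snd in Hp.
    rewrite (f_alpha_dirichlet_series a rho) by auto.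
    destruct (Hb1 (x0 + t)) as [_ Hb1t]. specialize (Hb1t M HM1).
    assert (E : (dirichlet_series a (- alpha) (x0 + t) - csum (fun j => c j * RtoC t ^ j) (S k))%C =
      ((dirichlet_series a (- alpha) (x0 + t) - csum (dirichlet_term a (- alpha) (x0 + t)) M) +
       (g O t - csum (fun j => g j 0 * RtoC (t ^ j / INR (fact j))) (S k)) +
       csum (fun j => w ^ j * RtoC (t ^ j / INR (fact j)) * (csum (dirichlet_term a (INR j - alpha) x0) M - L j)) (S k))%C).
    { assert (E1 : (csum (fun j => w ^ j * RtoC (t ^ j / INR (fact j)) * (csum (dirichlet_term a (INR j - alpha) x0) M - L j)) (S k) =
        csum (fun j => g j 0 * RtoC (t ^ j / INR (fact j))) (S k) + RtoC (-1) * csum (fun j => c j * RtoC t ^ j) (S k))%C).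
      { rewrite <- csum_scal, <- csum_plus. apply csum_ext. intros j _. unfold g, c, T.
        rewrite Rplus_0_r. unfold Rdiv. rewrite RtoC_mult, RtoC_pow. ring. }
      rewrite E1. unfold g, T. simpl INR. rewrite Rminus_0_l. simpl Cpow. ring. }
    rewrite E. eapply Rle_trans; [apply Cmod_triangle|].
    eapply Rle_trans; [apply Rplus_le_compat_r, Cmod_triangle|].
    unfold K. rewrite !Rmult_plus_distr_r.
    assert (B1 : D1 * Rpower (INR M) (rho + - alpha) <= D1 * Rpower 2 s * Rpower (Rabs t) s).
    { rewrite Rmult_assoc. apply Rmult_le_compat_l; [auto|].
      replace s with (- (rho + - alpha)) by (unfold s; ring). apply HMneg; auto. lra. }
    assert (B3 : 2 ^ S k * ((2 * PI) ^ S k * (D3 * Rpower (INR M) (INR (S k) - s))) * Rabs t ^ S k <=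
       2 ^ S k * ((2 * PI) ^ S k * D3) * Rpower (Rabs t) s).
    { replace (2 ^ S k * ((2 * PI) ^ S k * (D3 * Rpower (INR M) (INR (S k) - s))) * Rabs t ^ S k) with
        (2 ^ S k * ((2 * PI) ^ S k * D3) * (Rabs t ^ S k * Rpower (INR M) (INR (S k) - s))) by ring.
      apply Rmult_le_compat_l.
      { apply Rmult_le_pos; [apply pow_le; lra|]. apply Rmult_le_pos; [apply pow_le; lra|auto]. }
      rewrite <- (Hsplit t (S k)) by lra. apply Rmult_le_compat_l; [apply pow_le, Rabs_pos|].
      replace (s - INR (S k)) with (- (INR (S k) - s)) by ring. rewrite <- Rpower_Rinv by lra.
      assert (1 <= INR M) by (apply (le_INR 1); auto).
      apply Rle_Rpower_l; [rewrite S_INR; lra|]. split; [lra|].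
      apply Rmult_le_reg_r with (Rabs t); [lra|]. rewrite Rinv_l by lra. lra. }
    lra.
Qed.

Lemma Cpoly_eval_csum (d : nat) (c : nat -> C) (t : R) :
  Cpoly_eval d c t = csum (fun j => c j * RtoC t ^ j)%C (S d).
Proof.
  unfold Cpoly_eval. induction d as [|d IH].
  - rewrite sum_O. simpl. ring.
  - rewrite sum_Sn, IH. reflexivity.
Qed.

(** The Taylor polynomial of degree 0 is the value at the point, and its error is a positive power
    of the distance. *)
Lemma f_alpha_continuous (a : nat -> C) (r alpha x : R) :
  (forall rho, r < rho -> fourier_sums_bounded a rho) -> r < alpha ->
  continuous (f_alpha a alpha) x.
Proof.
  (* An exponent below 1, for which the Taylor polynomial has degree 0. *)
  intros Ha Hra. set (s := Rmin (alpha - r) 1 / 2).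
  assert (Hs : 0 < s < 1 /\ s < alpha - r).
  { unfold s. assert (T1 := Rmin_l (alpha - r) 1). assert (T2 := Rmin_r (alpha - r) 1).
    assert (0 < Rmin (alpha - r) 1) by (apply Rmin_glb_lt; lra). lra. }
  destruct (f_alpha_taylor a (alpha - s) alpha x 0) as [c [K [HK [Hc Hb]]]].
  { apply Ha. lra. } { simpl. lra. }
  replace (alpha - (alpha - s)) with s in Hb by ring.
  apply filterlim_locally. intros eps.
  set (d := Rmin 1 (Rpower (eps / (K + 1)) (/ s))).
  assert (He : 0 < eps / (K + 1)) by (apply Rdiv_lt_0_compat; [apply cond_pos|lra]).
  assert (Hd : 0 < d) by (apply Rmin_glb_lt; [lra|apply Rpower_pos]).
  exists (mkposreal d Hd). intros y Hy. unfold ball in Hy; simpl in Hy.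
  unfold AbsRing_ball, abs, minus, plus, opp in Hy; simpl in Hy.
  assert (Hlt : Cmod (f_alpha a alpha y - f_alpha a alpha x)%C < eps).
  { destruct (Req_dec y x) as [->|Hne].
    - replace (f_alpha a alpha x - f_alpha a alpha x)%C with (RtoC 0) by ring. rewrite Cmod_0. apply cond_pos.
    - set (t := y - x).
      assert (Ht : 0 < Rabs t) by (apply Rabs_pos_lt; unfold t; lra).
      assert (Htd : Rabs t < d) by exact Hy.
      assert (T1 := Rmin_l 1 (Rpower (eps / (K + 1)) (/ s))).
      assert (T2 := Rmin_r 1 (Rpower (eps / (K + 1)) (/ s))). fold d in T1, T2.
      assert (Hbt := Hb t ltac:(lra)).
      replace (x + t) with (y : R) in Hbt by (symmetry; apply Rplus_minus).
      replace (csum (fun j => c j * RtoC t ^ j)%C 1) with (f_alpha a alpha x) in Hbt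
        by (simpl; rewrite Hc; ring).
      eapply Rle_lt_trans; [exact Hbt|].
      assert (Rpower (Rabs t) s <= eps / (K + 1)).
      { replace (eps / (K + 1)) with (Rpower (Rpower (eps / (K + 1)) (/ s)) s).
        - apply Rle_Rpower_l; lra.
        - rewrite Rpower_mult, Rinv_l by lra. now apply Rpower_1. }
      apply Rle_lt_trans with (K * (eps / (K + 1))); [now apply Rmult_le_compat_l|].
      replace (K * (eps / (K + 1))) with (eps - eps / (K + 1)) by (field; lra). lra. }
  split.
  - eapply Rle_lt_trans; [apply (re_le_Cmod (f_alpha a alpha y - f_alpha a alpha x)%C)|exact Hlt].
  - eapply Rle_lt_trans; [apply (im_le_Cmod (f_alpha a alpha y - f_alpha a alpha x)%C)|exact Hlt].
Qed.

(** A slightly larger exponent s' with the same integer part and s < s' < alpha - r is not an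
    integer, so that [f_alpha_taylor] applies to it; a bound of order s' implies one of order s. *)
Lemma f_alpha_Holder_class (a : nat -> C) (r alpha x0 s : R) :
  (forall rho, r < rho -> fourier_sums_bounded a rho) -> 0 <= s < alpha - r ->
  Holder_class s x0 (f_alpha a alpha).
Proof.
  intros Ha Hs. split.
  { intros x. apply (f_alpha_continuous a r); [exact Ha|lra]. }
  destruct (nfloor_ex s (proj1 Hs)) as [k Hk].
  set (s' := (s + Rmin (INR k + 1) (alpha - r)) / 2).
  assert (Hs' : s < s' < INR k + 1 /\ s' < alpha - r).
  { unfold s'. assert (T1 := Rmin_l (INR k + 1) (alpha - r)). assert (T2 := Rmin_r (INR k + 1) (alpha - r)).
    assert (s < Rmin (INR k + 1) (alpha - r)) by (apply Rmin_glb_lt; lra). lra. }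
  destruct (f_alpha_taylor a (alpha - s') alpha x0 k) as [c [K [HK [_ Hb]]]].
  { apply Ha. lra. } { lra. }
  replace (alpha - (alpha - s')) with s' in Hb by ring.
  exists k, c. split; [lra|]. exists K. exists (mkposreal 1 Rlt_0_1). intros x Hx Hne.
  unfold ball in Hx; simpl in Hx. unfold AbsRing_ball, abs, minus, plus, opp in Hx; simpl in Hx.
  assert (Ht : 0 < Rabs (x - x0)) by (apply Rabs_pos_lt; lra).
  assert (Ht1 : Rabs (x - x0) < 1) by exact Hx.
  rewrite Cpoly_eval_csum.
  assert (Hbt := Hb (x - x0) ltac:(lra)). replace (x0 + (x - x0)) with (x : R) in Hbt by (symmetry; apply Rplus_minus).
  eapply Rle_trans; [exact Hbt|]. apply Rmult_le_compat_l; [exact HK|].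
  apply Rpower_exponent_le; lra.
Qed.

(** * Power series with coefficients n^alpha *)

Fixpoint power_diff (j : nat) (tau x : R) : R :=
  match j with
  | O => Rpower x tau
  | S i => power_diff i tau (x + 1) - power_diff i tau x
  end.

Lemma is_derive_power_diff (j : nat) (tau x : R) : 0 < x ->
  is_derive (power_diff j tau) x (tau * power_diff j (tau - 1) x).
Proof.
  revert x. induction j as [|j IH]; intros x Hx.
  - now apply is_derive_Rpower.
  - simpl. rewrite Rmult_minus_distr_l. apply @is_derive_minus; [|now apply IH].
    replace (tau * power_diff j (tau - 1) (x + 1)) with (scal 1 (tau * power_diff j (tau - 1) (x + 1)))
      by (unfold scal; simpl; apply Rmult_1_l).
    apply (is_derive_comp (power_diff j tau) (fun t => t + 1)).
    + apply IH. lra.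
    + auto_derive; auto.
Qed.

(** By the mean value theorem, one more difference amounts to one more derivative, which lowers
    the exponent by 1. *)
Lemma power_diff_bound (j : nat) (tau : R) :
  exists D, 0 <= D /\ forall x, 1 <= x -> Rabs (power_diff j tau x) <= D * Rpower x (tau - INR j).
Proof.
  revert tau. induction j as [|j IH]; intros tau.
  - exists 1. split; [lra|]. intros x Hx. simpl. rewrite Rminus_0_r, Rmult_1_l, Rabs_pos_eq; [lra|].
    left; apply Rpower_pos.
  - destruct (IH (tau - 1)) as [D [HD Hb]].
    set (b := tau - 1 - INR j).
    exists (Rabs tau * (D * Rpower 2 (Rabs b))). split.
    { assert (T := Rpower_pos 2 (Rabs b)). apply Rmult_le_pos; [apply Rabs_pos|]. apply Rmult_le_pos; lra. }
    intros x Hx.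
    destruct (MVT_gen (power_diff j tau) x (x + 1) (fun t => tau * power_diff j (tau - 1) t)) as [xi [Hxi E]].
    + intros t. rewrite Rmin_left by lra. intros Ht. apply is_derive_power_diff. lra.
    + intros t. rewrite Rmin_left by lra. intros Ht. apply continuity_pt_filterlim.
      apply (@ex_derive_continuous R_AbsRing R_NormedModule (power_diff j tau)).
      eexists. apply is_derive_power_diff. lra.
    + rewrite Rmin_left, Rmax_right in Hxi by lra. simpl power_diff. rewrite E, !Rabs_mult.
      replace (x + 1 - x) with 1 by ring. rewrite Rabs_R1, Rmult_1_r.
      rewrite Rmult_assoc. apply Rmult_le_compat_l; [apply Rabs_pos|].
      eapply Rle_trans; [apply Hb; lra|]. rewrite Rmult_assoc. apply Rmult_le_compat_l; [exact HD|].
      replace (tau - INR (S j)) with b by (unfold b; rewrite S_INR; ring).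
      apply Rpower_comparable; lra.
Qed.

Lemma ln_le_linear (x eps : R) : 0 < x -> 0 < eps -> ln x <= eps * x - 1 - ln eps.
Proof.
  intros Hx He. assert (H := exp_ineq1_le (ln (eps * x))).
  rewrite exp_ln, ln_mult in H by (auto; apply Rmult_lt_0_compat; auto). lra.
Qed.

(** [ln_le_linear] with a small slope bounds the power by a constant times an exponential of
    arbitrarily small rate, which costs a part of the geometric decay. *)
Lemma power_times_geometric (tau w : R) (M : nat) : 0 <= w < 1 -> (1 <= M)%nat ->
  exists K rho, 0 <= rho < 1 /\ 0 <= K /\ forall n, Rpower (INR (M + n)) tau * w ^ n <= K * rho ^ n.
Proof.
  intros Hw HM.
  (* w may be 0, so its powers are compared with those of a positive v < 1 before taking logarithms. *)
  set (v := (1 + w) / 2). set (b := - ln v / 2).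
  assert (Hv : 0 < v < 1) by (unfold v; lra).
  assert (Hb : 0 < b).
  { unfold b. assert (ln v < 0) by (rewrite <- ln_1; apply ln_increasing; lra). lra. }
  set (t := Rabs tau + 1). assert (Ht : 0 < t) by (unfold t; assert (T := Rabs_pos tau); lra).
  set (eps := b / t). assert (Heps : 0 < eps) by (apply Rdiv_lt_0_compat; auto).
  exists (exp (t * (- 1 - ln eps) + b * INR M)), (exp (- b)).
  split; [|split].
  - split; [left; apply exp_pos|]. apply Rlt_le_trans with (exp 0); [apply exp_increasing; lra|rewrite exp_0; lra].
  - left; apply exp_pos.
  - intros n. assert (H1 : 1 <= INR (M + n)) by (apply (le_INR 1); lia).
    apply Rle_trans with (Rpower (INR (M + n)) t * v ^ n).
    + apply Rmult_le_compat; [left; apply Rpower_pos|apply pow_le; lra| |].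
      * apply Rle_Rpower; [exact H1|]. unfold t. assert (T := Rle_abs tau). lra.
      * apply pow_incr. unfold v. lra.
    + assert (Ev : v ^ n = exp (INR n * (- (2 * b)))).
      { rewrite <- pow_exp. f_equal. unfold b. replace (- (2 * (- ln v / 2))) with (ln v) by field.
        now rewrite exp_ln. }
      rewrite Ev, pow_exp. unfold Rpower. rewrite <- !exp_plus. apply exp_le_compat.
      assert (L := ln_le_linear (INR (M + n)) eps ltac:(lra) Heps).
      apply (Rmult_le_compat_l t) in L; [|lra].
      replace (t * (eps * INR (M + n) - 1 - ln eps)) with (b * INR (M + n) + t * (- 1 - ln eps)) in L
        by (unfold eps; field; lra).
      rewrite plus_INR in *. lra.
Qed.

Definition shifted_diff_term (j : nat) (alpha : R) (M : nat) (z : C) (n : nat) : C :=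
  (RtoC (power_diff j alpha (INR (M + n))) * z ^ n)%C.

Lemma shifted_diff_series_converges (j : nat) (alpha : R) (M : nat) (z : C) : Cmod z < 1 -> (1 <= M)%nat ->
  exists l, Clim (csum (shifted_diff_term j alpha M z)) l.
Proof.
  intros Hz HM. destruct (power_diff_bound j alpha) as [D [HD Hb]].
  destruct (power_times_geometric (alpha - INR j) (Cmod z) M (conj (Cmod_ge_0 z) Hz) HM) as [K [rho [Hrho [HK Hg]]]].
  destruct (csum_geometric (shifted_diff_term j alpha M z) (D * K) rho Hrho) as [l [Hl _]].
  - intros n. unfold shifted_diff_term. rewrite Cmod_mult, Cmod_R, Cmod_pow.
    apply Rle_trans with (D * (Rpower (INR (M + n)) (alpha - INR j) * Cmod z ^ n)).
    + rewrite <- Rmult_assoc. apply Rmult_le_compat_r; [apply pow_le, Cmod_ge_0|].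
      apply Hb. apply (le_INR 1). lia.
    + rewrite Rmult_assoc. apply Rmult_le_compat_l; auto.
  - now exists l.
Qed.

(** Multiplying a power series by 1 - z replaces its coefficients by their differences. *)
Lemma shifted_diff_series_recursion (j : nat) (alpha : R) (M : nat) (z l l' : C) :
  Clim (csum (shifted_diff_term j alpha M z)) l -> Clim (csum (shifted_diff_term (S j) alpha M z)) l' ->
  ((1 - z) * l = RtoC (power_diff j alpha (INR M)) + z * l')%C.
Proof.
  intros Hl Hl'.
  assert (E : l = (RtoC (power_diff j alpha (INR M)) + z * (l + l'))%C).
  { apply (Clim_unique (fun n => csum (shifted_diff_term j alpha M z) (S n))).
    - apply (Clim_incr _ _ 1) in Hl. eapply Clim_ext; [|exact Hl]. intros n. cbv beta. now rewrite Nat.add_1_r.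
    - apply Clim_ext with (fun n => RtoC (power_diff j alpha (INR M)) +
          z * (csum (shifted_diff_term j alpha M z) n + csum (shifted_diff_term (S j) alpha M z) n))%C.
      + intros n. rewrite csum_first, <- csum_plus, <- csum_scal. f_equal.
        * unfold shifted_diff_term. rewrite Nat.add_0_r. simpl. ring.
        * apply csum_ext. intros i _. unfold shifted_diff_term. rewrite Nat.add_succ_r, S_INR.
          simpl power_diff. rewrite RtoC_minus. simpl Cpow. ring.
      + apply Clim_plus; [apply Clim_const|]. apply Clim_scal. now apply Clim_plus. }
  transitivity (l - z * l)%C; [ring|]. rewrite E at 1. ring.
Qed.

(** After enough differences (the number [i] counts those still to be taken) the coefficients are
    summable and |z| < 1 suffices.  Going back, each division by 1 - z costs a factor M, because
    1 <= M |1 - z|, which is what the exponent alpha - j + 1 of M allows. *)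
Lemma shifted_diff_series_bound (alpha : R) (i : nat) : forall j, alpha - INR j - INR i + 1 < 0 ->
  exists D, 0 <= D /\ forall z M l, Cmod z < 1 -> (1 <= M)%nat -> 1 <= INR M * Cmod (1 - z)%C ->
    Clim (csum (shifted_diff_term j alpha M z)) l -> Cmod l <= D * Rpower (INR M) (alpha - INR j + 1).
Proof.
  induction i as [|i IH]; intros j Hj.
  - simpl in Hj. destruct (power_diff_bound j alpha) as [D [HD Hb]].
    set (a := alpha - INR j + 1) in *.
    assert (Ha : a < 0) by (unfold a; lra).
    set (c := Rpower 2 (Rabs (a - 1)) / a).
    assert (Hc : c < 0).
    { unfold c, Rdiv. assert (T := Rpower_pos 2 (Rabs (a - 1))). assert (/ a < 0) by now apply Rinv_lt_0_compat. nra. }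
    exists (D * - c). split; [apply Rmult_le_pos; lra|].
    intros z M l Hz HM _ Hl.
    destruct (csum_converges (shifted_diff_term j alpha M z) (fun n => D * c * Rpower (INR (M + n)) a) 0) as [l' [Hl' Hb']].
    + intros n. unfold shifted_diff_term. rewrite Cmod_mult, Cmod_R, Cmod_pow.
      assert (H1 : 1 <= INR (M + n)) by (apply (le_INR 1); lia).
      apply Rle_trans with (D * Rpower (INR (M + n)) (a - 1) * 1).
      * apply Rmult_le_compat; [apply Rabs_pos|apply pow_le, Cmod_ge_0| |].
        -- replace (a - 1) with (alpha - INR j) by (unfold a; ring). now apply Hb.
        -- rewrite <- (pow1 n). apply pow_incr. split; [apply Cmod_ge_0|lra].
      * rewrite Rmult_1_r, !(Rmult_assoc D), <- Rmult_minus_distr_l. apply Rmult_le_compat_l; [exact HD|].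
        rewrite Nat.add_succ_r, S_INR. apply Rpower_increment_ge; lra.
    + replace 0 with (D * c * 0) by ring. apply (is_lim_seq_scal_l _ _ 0).
      apply is_lim_seq_ext with (fun n => Rpower (INR (S (n + (M - 1)))) a).
      { intros n. f_equal. f_equal. lia. }
      apply (is_lim_seq_incr_n (fun n => Rpower (INR (S n)) a)). now apply is_lim_seq_Rpower_neg.
    + rewrite (Clim_unique _ _ _ Hl Hl'). specialize (Hb' O). rewrite Nat.add_0_r in Hb'. simpl csum in Hb'.
      replace (l' - 0)%C with l' in Hb' by ring. lra.
  - destruct (power_diff_bound j alpha) as [D [HD Hb]].
    destruct (IH (S j)) as [D' [HD' Hb']].
    { rewrite !S_INR in *. lra. }
    exists (D + D'). split; [lra|]. intros z M l Hz HM Hzm Hl.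
    destruct (shifted_diff_series_converges (S j) alpha M z Hz HM) as [l' Hl'].
    assert (Hrec := shifted_diff_series_recursion j alpha M z l l' Hl Hl').
    apply (f_equal Cmod) in Hrec. rewrite Cmod_mult in Hrec.
    specialize (Hb' z M l' Hz HM Hzm Hl').
    replace (alpha - INR (S j) + 1) with (alpha - INR j) in Hb' by (rewrite S_INR; ring).
    assert (H1 : 1 <= INR M) by (apply (le_INR 1); exact HM).
    specialize (Hb (INR M) H1).
    assert (T : Cmod (1 - z)%C * Cmod l <= (D + D') * Rpower (INR M) (alpha - INR j)).
    { rewrite Hrec. eapply Rle_trans; [apply Cmod_triangle|]. rewrite Cmod_R, Cmod_mult.
      assert (Cmod z * Cmod l' <= Cmod l') by (assert (T := Cmod_ge_0 l'); nra). lra. }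
    assert (Hl0 := Cmod_ge_0 l).
    apply Rle_trans with (INR M * Cmod (1 - z)%C * Cmod l).
    { rewrite <- (Rmult_1_l (Cmod l)) at 1. now apply Rmult_le_compat_r. }
    rewrite Rpower_S, Rmult_assoc by lra.
    apply (Rmult_le_compat_l (INR M)) in T; lra.
Qed.

(** Cut the series at M ~ 1/|1 - z|.  The M terms of the initial part are at most M^alpha each, and
    the tail is z^M times the series of [shifted_diff_series_bound] without differences; both are
    O(M^(alpha+1)). *)
Lemma power_series_bound (alpha : R) : 0 <= alpha ->
  exists D, 0 <= D /\ forall z l, Cmod z < 1 ->
    Clim (csum (fun n => RtoC (npow alpha n) * z ^ n)%C) l ->
    Cmod l <= D * Rpower (Cmod (1 - z)%C) (- (alpha + 1)).
Proof.
  intros Halpha.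
  destruct (nfloor_ex (alpha + 1) ltac:(lra)) as [i Hi].
  destruct (shifted_diff_series_bound alpha (S i) 0) as [D [HD Hb]].
  { rewrite S_INR. simpl. lra. }
  exists ((1 + D) * Rpower 3 (alpha + 1)). split.
  { apply Rmult_le_pos; [lra|left; apply Rpower_pos]. }
  intros z l Hz Hl. set (d := Cmod (1 - z)%C).
  assert (Hd : 0 < d <= 2).
  { split.
    - apply Cmod_gt_0. intros E. replace z with (1 - (1 - z))%C in Hz by ring. rewrite E in Hz.
      replace (1 - 0)%C with (RtoC 1) in Hz by ring. rewrite Cmod_1 in Hz. lra.
    - eapply Rle_trans; [apply Cmod_minus_le|]. rewrite Cmod_1. lra. }
  assert (Hdi : 0 < / d) by (apply Rinv_0_lt_compat; lra).
  (* the cut M is comparable with 1/|1-z| *)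
  destruct (nfloor_ex (/ d) ltac:(lra)) as [M0 HM0]. set (M := S M0).
  assert (HM : / d <= INR M <= 3 * / d).
  { unfold M. rewrite S_INR. assert (1 <= 2 * / d); [|lra].
    apply Rmult_le_reg_r with d; [lra|]. rewrite Rmult_assoc, Rinv_l; lra. }
  assert (HM1 : 1 <= INR M) by (apply (le_INR 1); unfold M; lia).
  assert (HMz : 1 <= INR M * d).
  { apply Rmult_le_reg_r with (/ d); [lra|]. rewrite Rmult_assoc, Rinv_r; lra. }
  destruct (shifted_diff_series_converges 0 alpha M z Hz ltac:(unfold M; lia)) as [T HT].
  assert (HTb := Hb z M T Hz ltac:(unfold M; lia) HMz HT). change (INR 0) with 0 in HTb. rewrite Rminus_0_r in HTb.
  set (h := csum (fun n => RtoC (npow alpha n) * z ^ n)%C M).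
  assert (E : l = (h + z ^ M * T)%C).
  { apply (Clim_incr _ _ M) in Hl.
    apply (Clim_unique _ _ _ Hl).
    apply Clim_ext with (fun n => h + z ^ M * csum (shifted_diff_term 0 alpha M z) n)%C.
    - intros n. rewrite (Nat.add_comm n M), csum_split. fold h. f_equal. rewrite <- csum_scal.
      apply csum_ext. intros k _. unfold shifted_diff_term. rewrite npow_pos_index by (unfold M; lia).
      rewrite Cpow_add_r. cbn [power_diff].
      generalize (z ^ M)%C (z ^ k)%C. intros u v. ring.
    - apply Clim_plus; [apply Clim_const|now apply Clim_scal]. }
  assert (Hh : Cmod h <= INR M * Rpower (INR M) alpha).
  { apply csum_const_bound. intros k Hk. rewrite Cmod_mult, Cmod_R, Cmod_pow.
    rewrite <- (Rmult_1_r (Rpower (INR M) alpha)).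
    apply Rmult_le_compat; [apply Rabs_pos|apply pow_le, Cmod_ge_0| |].
    - destruct k as [|k].
      + simpl npow. rewrite Rabs_R0. left; apply Rpower_pos.
      + rewrite npow_pos_index, Rabs_pos_eq by (try lia; left; apply Rpower_pos).
        apply Rle_Rpower_l; [exact Halpha|]. split; [apply lt_0_INR; lia|apply le_INR; lia].
    - rewrite <- (pow1 k). apply pow_incr. split; [apply Cmod_ge_0|lra]. }
  assert (Hzm : Cmod (z ^ M * T)%C <= Cmod T).
  { rewrite Cmod_mult, Cmod_pow. assert (Cmod z ^ M <= 1).
    { rewrite <- (pow1 M). apply pow_incr. split; [apply Cmod_ge_0|lra]. }
    assert (Q := Cmod_ge_0 T). nra. }
  assert (Hl1 : Cmod l <= (1 + D) * Rpower (INR M) (alpha + 1)).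
  { rewrite E. eapply Rle_trans; [apply Cmod_triangle|].
    rewrite (Rpower_S _ alpha) in HTb |- * by lra. lra. }
  eapply Rle_trans; [exact Hl1|]. rewrite Rmult_assoc. apply Rmult_le_compat_l; [lra|].
  rewrite <- (Rpower_Rinv d) by lra. rewrite Rpower_mult_distr by lra.
  apply Rle_Rpower_l; lra.
Qed.

(** * Trigonometric approximation of polynomials *)

Definition trig_poly (Q : R -> C) : Prop :=
  exists (N : nat) (q : nat -> C), (forall n, (N <= n)%nat -> q n = RtoC 0) /\
    forall t, Q t = csum (fun n => q n * cis (INR n * t))%C N.

Lemma trig_poly_ext (P Q : R -> C) : (forall t, P t = Q t) -> trig_poly P -> trig_poly Q.
Proof. intros H [N [q [Hq HP]]]. exists N, q. split; [exact Hq|]. intros t. now rewrite <- H. Qed.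

Lemma trig_poly_const (c : C) : trig_poly (fun _ => c).
Proof.
  exists 1%nat, (fun n => match n with O => c | S _ => RtoC 0 end). split.
  - intros [|n] Hn; [lia|reflexivity].
  - intros t. simpl. rewrite Rmult_0_l, cis_0. ring.
Qed.

Lemma trig_poly_plus (P Q : R -> C) : trig_poly P -> trig_poly Q -> trig_poly (fun t => P t + Q t)%C.
Proof.
  intros [M [p [Hp HP]]] [N [q [Hq HQ]]]. exists (Nat.max M N), (fun n => p n + q n)%C. split.
  - intros n Hn. rewrite Hp, Hq by lia. ring.
  - intros t. rewrite HP, HQ.
    rewrite <- (csum_eventually_zero _ M (Nat.max M N)); [|lia|intros i Hi; rewrite Hp by lia; ring].
    rewrite <- (csum_eventually_zero _ N (Nat.max M N)); [|lia|intros i Hi; rewrite Hq by lia; ring].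
    rewrite <- csum_plus. apply csum_ext. intros; ring.
Qed.

Lemma trig_poly_scal (c : C) (P : R -> C) : trig_poly P -> trig_poly (fun t => c * P t)%C.
Proof.
  intros [M [p [Hp HP]]]. exists M, (fun n => c * p n)%C. split.
  - intros n Hn. rewrite Hp by lia. ring.
  - intros t. rewrite HP, <- csum_scal. apply csum_ext. intros; ring.
Qed.

Lemma trig_poly_mul_cis (P : R -> C) : trig_poly P -> trig_poly (fun t => cis t * P t)%C.
Proof.
  intros [M [p [Hp HP]]]. exists (S M), (fun n => match n with O => RtoC 0 | S i => p i end). split.
  - intros [|n] Hn; [lia|]. apply Hp. lia.
  - intros t. rewrite HP, csum_first, <- csum_scal, Cmult_0_l, Cplus_0_l.
    apply csum_ext. intros i _. rewrite S_INR, Rmult_plus_distr_r, Rmult_1_l, cis_plus. ring.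
Qed.

Lemma trig_poly_mul_cis_INR (n : nat) (P : R -> C) : trig_poly P -> trig_poly (fun t => cis (INR n * t) * P t)%C.
Proof.
  intros HP. induction n as [|n IH].
  - eapply trig_poly_ext; [|exact HP]. intros t. simpl. rewrite Rmult_0_l, cis_0. ring.
  - eapply trig_poly_ext; [|exact (trig_poly_mul_cis _ IH)]. intros t. cbv beta.
    rewrite S_INR, Rmult_plus_distr_r, Rmult_1_l, cis_plus. ring.
Qed.

Lemma trig_poly_csum (F : nat -> R -> C) (n : nat) :
  (forall i, trig_poly (F i)) -> trig_poly (fun t => csum (fun i => F i t) n).
Proof.
  intros H. induction n as [|n IH]; simpl.
  - apply trig_poly_const.
  - apply trig_poly_plus; auto.
Qed.

Lemma trig_poly_mult (P Q : R -> C) : trig_poly P -> trig_poly Q -> trig_poly (fun t => P t * Q t)%C.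
Proof.
  intros [M [p [_ HP]]] HQ.
  apply trig_poly_ext with (fun t => csum (fun i => p i * (cis (INR i * t) * Q t))%C M).
  - intros t. rewrite HP, (Cmult_comm _ (Q t)), <- csum_scal. apply csum_ext. intros; ring.
  - apply trig_poly_csum. intros i. apply trig_poly_scal. now apply trig_poly_mul_cis_INR.
Qed.

Lemma trig_poly_pow (P : R -> C) (n : nat) : trig_poly P -> trig_poly (fun t => P t ^ n)%C.
Proof.
  intros HP. induction n as [|n IH]; simpl; [apply trig_poly_const|now apply trig_poly_mult].
Qed.

(** The sum of |q_i|, taken as the real part of a [csum] to have the lemmas on [csum] at hand. *)
Definition coefficient_mass (q : nat -> C) (n : nat) : R := Re (csum (fun i => RtoC (Cmod (q i))) n).

Lemma coefficient_mass_bound (q u : nat -> C) (m n : nat) : (m <= n)%nat ->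
  (forall i, Cmod (u i) <= Cmod (q i)) ->
  Cmod (csum u n - csum u m)%C <= coefficient_mass q n - coefficient_mass q m.
Proof.
  intros Hmn H. apply csum_telescope_bound; [exact Hmn|]. intros i _.
  eapply Rle_trans; [apply H|]. right. unfold coefficient_mass.
  change (Re (csum (fun i => RtoC (Cmod (q i))) (S i)))
    with (Re (csum (fun i => RtoC (Cmod (q i))) i) + Cmod (q i)). ring.
Qed.

Lemma trig_poly_fourier (N : nat) (q : nat -> C) : (forall n, (N <= n)%nat -> q n = RtoC 0) ->
  fourier_uniform q (fun t => csum (fun n => q n * cis (INR n * t))%C N).
Proof.
  intros Hq. exists (fun n => coefficient_mass q N - coefficient_mass q n).
  assert (HE : forall n, (N <= n)%nat -> coefficient_mass q n = coefficient_mass q N).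
  { intros n Hn. unfold coefficient_mass. f_equal. apply csum_eventually_zero; [exact Hn|].
    intros i Hi. rewrite Hq, Cmod_0 by exact Hi. reflexivity. }
  split.
  - apply (is_lim_seq_incr_n _ N). apply is_lim_seq_ext with (fun _ => 0); [|apply is_lim_seq_const].
    intros n. rewrite (HE (n + N)%nat) by lia. ring.
  - intros n t. destruct (le_lt_dec n N) as [L|L].
    + apply coefficient_mass_bound; [exact L|]. intros i. rewrite Cmod_mult, Cmod_cis. lra.
    + rewrite (HE n) by lia. rewrite (csum_eventually_zero _ N n); [|lia|intros i Hi; rewrite Hq by exact Hi; ring].
      rewrite Rminus_diag. replace (_ - _)%C with (RtoC 0) by ring. rewrite Cmod_0. lra.
Qed.

Lemma curve_derive_power (F F' : R -> C) (n : nat) : curve_derive F F' ->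
  curve_derive (fun t => F t ^ S n)%C (fun t => RtoC (INR (S n)) * F t ^ n * F' t)%C.
Proof.
  intros D. induction n as [|n IH].
  - eapply curve_derive_ext; [| |exact D]; intros t; simpl; ring.
  - eapply curve_derive_ext; [| |exact (curve_derive_mult _ _ _ _ D IH)].
    + intros t. reflexivity.
    + intros t. cbv beta. rewrite (S_INR (S n)), RtoC_plus. simpl Cpow. ring.
Qed.

(** A partial sum of the Taylor series of log(1 + v) / (2 pi i) at v = e(t) - 1, a periodic
    substitute for t. *)
Definition log_sum (n : nat) (t : R) : C :=
  (- / (RtoC (2 * PI) * Ci) * csum (fun i => RtoC (/ INR (S i)) * (1 - cis t) ^ S i) n)%C.

Lemma two_pi_i_neq_0 : (RtoC (2 * PI) * Ci)%C <> RtoC 0.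
Proof.
  intros E. apply (f_equal Im) in E. simpl in E. assert (T := PI_RGT_0). lra.
Qed.

Lemma log_sum_trig_poly (n : nat) : trig_poly (log_sum n).
Proof.
  unfold log_sum. apply trig_poly_scal. apply (trig_poly_csum (fun i t => RtoC (/ INR (S i)) * (1 - cis t) ^ S i)%C).
  intros i. apply trig_poly_scal. apply (trig_poly_pow (fun t => 1 - cis t)%C).
  apply trig_poly_ext with (fun t => RtoC 1 + RtoC (-1) * (cis t * RtoC 1))%C; [intros t; ring|].
  apply trig_poly_plus; [apply trig_poly_const|]. apply trig_poly_scal.
  apply trig_poly_mul_cis, trig_poly_const.
Qed.

Lemma curve_derive_1_minus_cis :
  curve_derive (fun t => 1 - cis t)%C (fun t => - (RtoC (2 * PI) * Ci) * cis t)%C.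
Proof.
  eapply curve_derive_ext; [| |exact (curve_derive_plus _ _ _ _ (curve_derive_const (RtoC 1))
     (curve_derive_scal (RtoC (-1)) _ _ (curve_derive_cis 1)))].
  - intros t. cbv beta. rewrite Rmult_1_l. ring.
  - intros t. cbv beta. rewrite Rmult_1_l, Rmult_1_r. ring.
Qed.

Lemma Cmod_1_minus_cis_le (t : R) : Cmod (1 - cis t)%C <= 4 * PI * Rabs t.
Proof.
  assert (HPI := PI_RGT_0).
  assert (K := curve_increment_bound _ _ (Rabs t) (2 * PI) 0 t curve_derive_1_minus_cis (Rle_refl _)).
  cbv beta in K. rewrite cis_0 in K.
  replace (1 - cis t - (1 - 1))%C with (1 - cis t)%C in K by ring.
  replace (4 * PI * Rabs t) with (2 * (2 * PI) * Rabs t ^ 1) by ring. apply K.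
  intros x _. rewrite Cmod_mult, Cmod_cis, Cmod_opp, Cmod_mult, Cmod_Ci, Cmod_R, Rabs_pos_eq by lra.
  simpl. lra.
Qed.

(** The derivative of the logarithmic sum is e(t) times a geometric sum with ratio 1 - e(t), that
    is 1 - (1 - e(t))^n; so the derivative of the difference to t is O(|t|^n). *)
Lemma log_sum_approx (n : nat) (t : R) :
  Cmod (log_sum n t - RtoC t)%C <= 2 * (4 * PI) ^ n * Rabs t ^ S n.
Proof.
  assert (HPI := PI_RGT_0). assert (H2 := two_pi_i_neq_0).
  set (F := fun t => (log_sum n t - RtoC t)%C).
  assert (D : curve_derive F (fun t => - (1 - cis t) ^ n)%C).
  { eapply curve_derive_ext; [| |exact (curve_derive_plus _ _ _ _
      (curve_derive_scal (- / (RtoC (2 * PI) * Ci))%C _ _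
        (curve_derive_csum (fun i t => RtoC (/ INR (S i)) * (1 - cis t) ^ S i)%C _ n
          (fun i _ => curve_derive_scal (RtoC (/ INR (S i))) _ _
             (curve_derive_power _ _ i curve_derive_1_minus_cis))))
      (curve_derive_scal (RtoC (-1)) _ _ curve_derive_RtoC))].
    - intros x. unfold F, log_sum. ring.
    - intros x. cbv beta.
      rewrite (csum_ext _ (fun i => (- (RtoC (2 * PI) * Ci)) * (cis x * (1 - cis x) ^ i))%C).
      + assert (E : (cis x * csum (Cpow (1 - cis x)) n = 1 - (1 - cis x) ^ n)%C).
        { change (cis x * csum (fun m => (1 - cis x) ^ m) n = 1 - (1 - cis x) ^ n)%C.
          rewrite <- csum_geometric_identity. ring. }
        rewrite csum_scal, csum_scal, E. revert H2.
        generalize (RtoC (2 * PI) * Ci)%C. intros v Hv. field. exact Hv.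
      + intros i _. rewrite RtoC_inv by (apply not_0_INR; lia). field.
        intros E. apply (f_equal Re) in E. apply (not_0_INR (S i)); [lia|exact E]. }
  assert (K := curve_increment_bound F _ (Rabs t) ((4 * PI) ^ n) n t D (Rle_refl _)).
  assert (F0 : F 0 = RtoC 0).
  { unfold F, log_sum. rewrite csum_zero; [ring|]. intros i _. rewrite cis_0. simpl. ring. }
  rewrite F0 in K. replace (F t - 0)%C with (F t) in K by ring. apply K.
  intros x _. rewrite Cmod_opp, Cmod_pow, <- Rpow_mult_distr. apply pow_incr.
  split; [apply Cmod_ge_0|apply Cmod_1_minus_cis_le].
Qed.

Lemma Cmod_pow_minus_le (b : R) (x y : C) (j : nat) : 1 <= b -> Cmod x <= b -> Cmod y <= b ->
  Cmod (x ^ j - y ^ j)%C <= INR j * b ^ j * Cmod (x - y)%C.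
Proof.
  intros HR Hx Hy. assert (Hd := Cmod_ge_0 (x - y)%C).
  induction j as [|j IH].
  - simpl. replace (1 - 1)%C with (RtoC 0) by ring. rewrite Cmod_0. lra.
  - replace (x ^ S j - y ^ S j)%C with (x * (x ^ j - y ^ j) + (x - y) * y ^ j)%C by (simpl; ring).
    eapply Rle_trans; [apply Cmod_triangle|]. rewrite !Cmod_mult, Cmod_pow, S_INR. simpl pow.
    assert (Hj := pos_INR j). assert (HRj : 1 <= b ^ j) by now apply pow_R1_Rle.
    apply Rle_trans with (b * (INR j * b ^ j * Cmod (x - y)%C) + Cmod (x - y)%C * b ^ j).
    + apply Rplus_le_compat.
      * apply Rmult_le_compat; auto using Cmod_ge_0.
      * apply Rmult_le_compat_l; [auto|]. apply pow_incr. split; [apply Cmod_ge_0|auto].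
    + assert (0 <= (b - 1) * (Cmod (x - y)%C * b ^ j)).
      { apply Rmult_le_pos; [lra|]. apply Rmult_le_pos; lra. }
      lra.
Qed.

(** Substitute [log_sum] for t in the polynomial. *)
Lemma polynomial_trig_approx (d n : nat) (c : nat -> C) :
  exists (Q : R -> C) (D : R), trig_poly Q /\ 0 <= D /\
    forall t, Rabs t <= 1 -> Cmod (csum (fun j => c j * RtoC t ^ j) d - Q t)%C <= D * Rabs t ^ S n.
Proof.
  set (Q := fun t => csum (fun j => c j * log_sum n t ^ j)%C d).
  assert (HPI := PI_RGT_0).
  set (B := 2 * (4 * PI) ^ n). assert (HB : 0 <= B).
  { unfold B. assert (0 <= (4 * PI) ^ n) by (apply pow_le; lra). lra. }
  set (b := 1 + B).
  destruct (csum_bound_family (fun t => Rabs t <= 1)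
    (fun j t => c j * (RtoC t ^ j - log_sum n t ^ j))%C (fun t => Rabs t ^ S n) d) as [D [HD Hb]].
  - intros j _. assert (Hb : 0 <= b ^ j) by (apply pow_le; unfold b; lra).
    exists (Cmod (c j) * (INR j * b ^ j * B)). split.
    { apply Rmult_le_pos; [apply Cmod_ge_0|]. apply Rmult_le_pos; [|auto]. apply Rmult_le_pos; [apply pos_INR|auto]. }
    intros t Ht. assert (HL := log_sum_approx n t). fold B in HL.
    assert (Ht1 : Rabs t ^ S n <= 1).
    { rewrite <- (pow1 (S n)). apply pow_incr. split; [apply Rabs_pos|auto]. }
    rewrite Cmod_mult, Rmult_assoc. apply Rmult_le_compat_l; [apply Cmod_ge_0|].
    eapply Rle_trans; [apply (Cmod_pow_minus_le b)|].
    + unfold b; lra.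
    + rewrite Cmod_R. unfold b. lra.
    + replace (log_sum n t) with ((log_sum n t - RtoC t) + RtoC t)%C by ring.
      eapply Rle_trans; [apply Cmod_triangle|]. rewrite Cmod_R. unfold b. nra.
    + rewrite (Rmult_assoc _ B). apply Rmult_le_compat_l.
      * apply Rmult_le_pos; [apply pos_INR|auto].
      * rewrite Cmod_minus_sym. exact HL.
  - exists Q, D. split; [|split; [exact HD|]].
    + apply (trig_poly_csum (fun j t => c j * log_sum n t ^ j)%C). intros j. apply trig_poly_scal.
      apply trig_poly_pow, log_sum_trig_poly.
    + intros t Ht. eapply Rle_trans; [|apply (Hb t Ht)]. right. f_equal. unfold Q.
      replace (csum (fun j => c j * RtoC t ^ j) d - csum (fun j => c j * log_sum n t ^ j) d)%C
        with (csum (fun j => c j * RtoC t ^ j) d + RtoC (-1) * csum (fun j => c j * log_sum n t ^ j) d)%C by ring.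
      rewrite <- csum_scal, <- csum_plus. apply csum_ext. intros; ring.
Qed.

(** * No exponent exceeds alpha - r *)

Lemma peak_le_circle_distance (y t : R) : 0 < y <= 1 -> Rabs t <= 1 / 2 ->
  Rabs t + y <= (exp 4 / 2 + 2) * Cmod (1 - RtoC (exp (- (2 * PI * y))) * cis t)%C.
Proof.
  intros Hy Ht. assert (P3 : 3 < PI) by (assert (T := PI2_3_2); lra). assert (P4 := PI_4).
  set (w := exp (- (2 * PI * y))). set (d := Cmod (1 - RtoC w * cis t)%C).
  assert (Hd : 0 <= d) by apply Cmod_ge_0.
  assert (He : 0 < exp 4) by apply exp_pos.
  assert (Hw0 : 0 < w) by apply exp_pos.
  assert (E1 : y <= 2 * d).
  { assert (Hd1 : 1 - w <= d).
    { unfold d. assert (T := Cmod_minus_triangle 1 (RtoC w * cis t) 0).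
      replace (1 - 0)%C with (RtoC 1) in T by ring. rewrite Cmod_1 in T.
      replace (RtoC w * cis t - 0)%C with (RtoC w * cis t)%C in T by ring.
      rewrite Cmod_mult, Cmod_cis, Cmod_R, Rabs_pos_eq in T by lra. lra. }
    assert (Hw : w * (1 + 2 * PI * y) <= 1).
    { unfold w. rewrite exp_Ropp. apply Rmult_le_reg_l with (exp (2 * PI * y)); [apply exp_pos|].
      rewrite <- Rmult_assoc, Rinv_r, Rmult_1_l, Rmult_1_r by (apply Rgt_not_eq, exp_pos).
      apply exp_ineq1_le. }
    destruct (Rle_dec y (2 * (1 - w))) as [Hyw|Hyw]; [lra|exfalso].
    assert (Hpy : 0 < PI * y) by (apply Rmult_lt_0_compat; lra).
    assert (X1 : (1 - y / 2) * (1 + 2 * PI * y) <= w * (1 + 2 * PI * y)) by (apply Rmult_le_compat_r; lra).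
    assert (X2 : PI * y * y <= PI * y * 1) by (apply Rmult_le_compat_l; lra).
    assert (X3 : 3 * y < PI * y) by (apply Rmult_lt_compat_r; lra).
    lra. }
  assert (E2 : Rabs t <= exp 4 / 2 * d).
  { apply Rsqr_incr_0_var; [|apply Rmult_le_pos; lra].
    rewrite !Rsqr_pow2, pow2_abs.
    assert (T := Cmod_1_minus_polar_ge w t ltac:(lra) Ht). fold d in T.
    assert (Hw8 : 1 <= w * exp 4 ^ 2).
    { unfold w. rewrite pow_exp, <- exp_plus. apply Rle_trans with (exp 0); [rewrite exp_0; lra|].
      apply exp_le_compat. simpl. nra. }
    assert (T2 := pow2_ge_0 t).
    replace ((exp 4 / 2 * d) ^ 2) with (exp 4 ^ 2 / 4 * d ^ 2) by field.
    apply Rle_trans with (exp 4 ^ 2 / 4 * (4 * w * t ^ 2)).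
    - replace (exp 4 ^ 2 / 4 * (4 * w * t ^ 2)) with (w * exp 4 ^ 2 * t ^ 2) by field.
      rewrite <- (Rmult_1_l (t ^ 2)) at 1. now apply Rmult_le_compat_r.
    - apply Rmult_le_compat_l; [|exact T]. assert (0 < exp 4 ^ 2) by (apply pow_lt; auto). lra. }
  lra.
Qed.

Lemma exp_height_bounds (y : R) : 0 < y -> 0 <= exp (- (2 * PI * y)) < 1.
Proof.
  intros Hy. assert (HPI := PI_RGT_0). split; [left; apply exp_pos|].
  apply Rlt_le_trans with (exp 0); [|rewrite exp_0; lra]. apply exp_increasing. nra.
Qed.

(** The multiplier n^alpha exp(-2 pi n y) turns the coefficients a_n n^(-alpha) of f_alpha into those
    of f at height y; the kernel is the power series of [power_series_bound] at a point of the
    circle of radius exp(-2 pi y). *)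
Lemma abel_kernel (alpha : R) : 0 <= alpha ->
  exists D, 0 < D /\ forall y, 0 < y <= 1 ->
  exists (K : R -> C) (d : nat -> R), is_lim_seq d 0 /\
    (forall n t, Cmod (K t - csum (fun m => RtoC (npow alpha m * exp (- (2 * PI * (INR m * y)))) *
         cis (- INR m * t)) n)%C <= d n) /\
    forall t, Rabs t <= 1 / 2 -> Cmod (K t) <= D * Rpower (Rabs t + y) (- (alpha + 1)).
Proof.
  intros Halpha. destruct (power_series_bound alpha Halpha) as [D0 [HD0 Hb]].
  set (H := exp 4 / 2 + 2). assert (HH : 0 < H) by (unfold H; assert (T := exp_pos 4); lra).
  exists ((D0 + 1) * Rpower H (alpha + 1)). split.
  { apply Rmult_lt_0_compat; [lra|apply Rpower_pos]. }
  intros y Hy. set (w := exp (- (2 * PI * y))).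
  assert (Hw := exp_height_bounds y (proj1 Hy)). fold w in Hw.
  destruct (power_times_geometric alpha w 1 Hw (le_n 1)) as [M [rho [Hrho [HM Hg]]]].
  set (u := fun t m => (RtoC (npow alpha m) * (RtoC w * cis (- t)) ^ m)%C).
  assert (Hu : forall t m, Cmod (u t m) <= M * rho ^ m).
  { intros t m. unfold u. rewrite Cmod_mult, Cmod_pow, Cmod_mult, Cmod_cis, !Cmod_R, Rmult_1_r, (Rabs_pos_eq w) by lra.
    eapply Rle_trans; [|apply Hg]. apply Rmult_le_compat_r; [apply pow_le; lra|].
    destruct m as [|m].
    - simpl npow. rewrite Rabs_R0. left; apply Rpower_pos.
    - rewrite npow_pos_index, Rabs_pos_eq by (try lia; left; apply Rpower_pos).
      apply Rle_Rpower_l; [exact Halpha|]. split; [apply lt_0_INR; lia|apply le_INR; lia]. }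
  assert (HK : forall t, Clim (csum (u t)) (CSeries (u t)) /\
     forall n, Cmod (CSeries (u t) - csum (u t) n)%C <= M / (1 - rho) * rho ^ n).
  { intros t. destruct (csum_geometric (u t) M rho Hrho (Hu t)) as [l [Hl Hlb]].
    rewrite (CSeries_Clim _ _ Hl). auto. }
  exists (fun t => CSeries (u t)), (fun n => M / (1 - rho) * rho ^ n). split; [|split].
  - replace 0 with (M / (1 - rho) * 0) by ring.
    apply (is_lim_seq_scal_l _ _ 0). apply is_lim_seq_geom. rewrite Rabs_pos_eq; lra.
  - intros n t. rewrite (csum_ext _ (u t)); [apply HK|].
    intros m _. unfold u. rewrite Cpow_mult_l, <- RtoC_pow, cis_pow. unfold w. rewrite pow_exp.
    rewrite RtoC_mult, <- Cmult_assoc. f_equal. f_equal; [f_equal; f_equal; ring|f_equal; ring].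
  - intros t Ht.
    assert (Hz : Cmod (RtoC w * cis (- t))%C < 1).
    { rewrite Cmod_mult, Cmod_cis, Cmod_R, Rabs_pos_eq; lra. }
    eapply Rle_trans; [apply (Hb _ _ Hz (proj1 (HK t)))|].
    assert (HC := peak_le_circle_distance y (- t) Hy ltac:(now rewrite Rabs_Ropp)).
    rewrite Rabs_Ropp in HC. fold w H in HC. set (d := Cmod (1 - RtoC w * cis (- t))%C) in *.
    assert (Hty : 0 < Rabs t + y) by (assert (T := Rabs_pos t); lra).
    assert (Hd : 0 < d) by nra.
    assert (Hle : Rpower d (- (alpha + 1)) <= Rpower H (alpha + 1) * Rpower (Rabs t + y) (- (alpha + 1))).
    { rewrite <- (Rpower_Rinv (Rabs t + y)) by lra. rewrite <- (Rpower_Rinv d) by lra.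
      rewrite Rpower_mult_distr by (try lra; apply Rinv_0_lt_compat; lra).
      apply Rle_Rpower_l; [lra|]. split; [now apply Rinv_0_lt_compat|].
      apply Rmult_le_reg_r with d; [exact Hd|]. rewrite Rinv_l by lra.
      apply Rmult_le_reg_r with (Rabs t + y); [exact Hty|].
      replace (H * / (Rabs t + y) * d * (Rabs t + y)) with (H * d) by (field; lra). lra. }
    rewrite Rmult_assoc. apply Rmult_le_compat; [lra|left; apply Rpower_pos|lra|exact Hle].
Qed.

Lemma fourier_uniform_minus (b q : nat -> C) (g h : R -> C) :
  fourier_uniform b g -> fourier_uniform q h ->
  fourier_uniform (fun n => b n - q n)%C (fun t => g t - h t)%C.
Proof.
  intros [d [Hd Hg]] [d' [Hd' Hh]]. exists (fun n => d n + d' n). split.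
  - replace 0 with (0 + 0) by ring. now apply is_lim_seq_plus'.
  - intros n t.
    rewrite (csum_ext _ (fun i => b i * cis (INR i * t) + RtoC (-1) * (q i * cis (INR i * t)))%C) by (intros; ring).
    rewrite csum_plus, csum_scal.
    replace (g t - h t - (csum (fun i => b i * cis (INR i * t)) n + RtoC (-1) * csum (fun i => q i * cis (INR i * t)) n))%C
      with ((g t - csum (fun i => b i * cis (INR i * t)) n) - (h t - csum (fun i => q i * cis (INR i * t)) n))%C by ring.
    eapply Rle_trans; [apply Cmod_minus_le|]. apply Rplus_le_compat; auto.
Qed.

Lemma fourier_uniform_bounded (c : nat -> C) (g : R -> C) : fourier_uniform c g ->
  exists B, 0 <= B /\ forall t, Cmod (g t) <= B.
Proof.
  intros [d [_ Hg]]. exists (d O). split.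
  - eapply Rle_trans; [apply Cmod_ge_0|apply (Hg O 0)].
  - intros t. specialize (Hg O t). simpl in Hg. replace (g t - 0)%C with (g t) in Hg by ring. exact Hg.
Qed.

Lemma f_alpha_fourier_uniform (a : nat -> C) (rho alpha x0 : R) :
  fourier_sums_bounded a rho -> rho < alpha ->
  fourier_uniform (fun n => RtoC (npow (- alpha) n) * (a n * cis (INR n * x0)))%C
    (fun t => f_alpha a alpha (x0 + t)).
Proof.
  intros Ha Hra. destruct (dirichlet_series_tail a rho (- alpha) Ha ltac:(lra)) as [D [HD Hb]].
  set (s := rho + - alpha) in *.
  exists (fun n => D * Rpower (INR (S (n - 1))) s). split.
  - replace 0 with (D * 0) by ring. apply (is_lim_seq_scal_l _ _ 0).
    apply (is_lim_seq_incr_n _ 1). apply is_lim_seq_ext with (fun n => Rpower (INR (S n)) s).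
    + intros n. now replace (n + 1 - 1)%nat with n by lia.
    + apply is_lim_seq_Rpower_neg. unfold s. lra.
  - intros n t. destruct (Hb (x0 + t)) as [_ Hbt].
    rewrite (f_alpha_dirichlet_series a rho) by auto.
    rewrite (csum_ext _ (dirichlet_term a (- alpha) (x0 + t))).
    2:{ intros i _. unfold dirichlet_term. rewrite Rmult_plus_distr_l, cis_plus. ring. }
    destruct n as [|n].
    + specialize (Hbt 1%nat (le_n 1)). change (S (0 - 1)) with 1%nat.
      replace (csum (dirichlet_term a (- alpha) (x0 + t)) 0) with (csum (dirichlet_term a (- alpha) (x0 + t)) 1);
        [exact Hbt|]. simpl. unfold dirichlet_term. simpl. ring.
    + replace (S (S n - 1)) with (S n) by lia. apply Hbt. lia.
Qed.

Lemma pow_Rabs_le_Rpower (t e : R) (n : nat) : 0 < Rabs t <= 1 -> e <= INR n ->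
  Rabs t ^ n <= Rpower (Rabs t) e.
Proof.
  intros Ht He. rewrite <- Rpower_pow by lra. apply Rpower_exponent_le; lra.
Qed.

(** Near x0 the polynomial of the Hoelder condition may be replaced by a trigonometric one; away from
    x0 the bound is that of bounded functions, as |t|^s' is bounded below there. *)
Lemma Holder_class_trig_poly (g : R -> C) (x0 s s' : R) (B : R) :
  (forall x, Cmod (g x) <= B) -> 0 < s' <= s -> Holder_class s x0 g ->
  exists (N : nat) (q : nat -> C) (A : R), (forall n, (N <= n)%nat -> q n = RtoC 0) /\ 0 < A /\
    forall t, 0 < Rabs t <= 1 / 2 ->
      Cmod (g (x0 + t)%R - csum (fun n => q n * cis (INR n * t)) N)%C <= A * Rpower (Rabs t) s'.
Proof.
  intros HB Hs [_ [d [c [_ [K [delta HK]]]]]].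
  destruct (nfloor_ex s' ltac:(lra)) as [n Hn].
  destruct (polynomial_trig_approx (S d) n c) as [Q [D [HQ [HD HQb]]]].
  destruct HQ as [N [q [Hq HQ]]].
  destruct (fourier_uniform_bounded _ _ (trig_poly_fourier N q Hq)) as [B' [HB' HQB]].
  assert (HB0 : 0 <= B) by (eapply Rle_trans; [apply Cmod_ge_0|apply (HB 0)]).
  (* Inside radius de the Hoelder condition is used, outside it the boundedness of g. *)
  set (de := Rmin delta 1). assert (Hde : 0 < de <= 1).
  { split; [apply Rmin_glb_lt; [apply cond_pos|lra]|apply Rmin_r]. }
  set (A1 := Rabs K + D). set (A2 := (B + B') * Rpower de (- s')).
  assert (HA1 : 0 <= A1) by (unfold A1; assert (T := Rabs_pos K); lra).
  assert (HA2 : 0 <= A2) by (apply Rmult_le_pos; [lra|left; apply Rpower_pos]).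
  exists N, q, (A1 + A2 + 1). split; [exact Hq|]. split; [lra|].
  intros t Ht. rewrite <- HQ.
  assert (Hp := Rpower_pos (Rabs t) s').
  destruct (Rlt_dec (Rabs t) de) as [Hlt|Hge].
  - assert (Hx : Cmod (g (x0 + t)%R - Cpoly_eval d c (x0 + t - x0)%R)%C <= K * Rpower (Rabs (x0 + t - x0)) s).
    { apply HK.
      - unfold ball; simpl. unfold AbsRing_ball, abs, minus, plus, opp; simpl.
        replace (x0 + t + - x0) with t by ring. eapply Rlt_le_trans; [exact Hlt|apply Rmin_l].
      - intros E. assert (E0 : t = 0) by lra. rewrite E0, Rabs_R0 in Ht. lra. }
    replace (x0 + t - x0) with t in Hx by ring. rewrite Cpoly_eval_csum in Hx.
    specialize (HQb t ltac:(lra)).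
    eapply Rle_trans; [apply (Cmod_minus_triangle _ (csum (fun j => c j * RtoC t ^ j)%C (S d)))|].
    assert (X1 : K * Rpower (Rabs t) s <= Rabs K * Rpower (Rabs t) s').
    { apply Rle_trans with (Rabs K * Rpower (Rabs t) s).
      - apply Rmult_le_compat_r; [left; apply Rpower_pos|apply Rle_abs].
      - apply Rmult_le_compat_l; [apply Rabs_pos|]. apply Rpower_exponent_le; lra. }
    assert (X2 : D * Rabs t ^ S n <= D * Rpower (Rabs t) s').
    { apply Rmult_le_compat_l; [exact HD|]. apply pow_Rabs_le_Rpower; [lra|]. rewrite S_INR. lra. }
    unfold A1. assert (0 <= A2 * Rpower (Rabs t) s') by (apply Rmult_le_pos; lra). lra.
  - assert (X : 1 <= Rpower de (- s') * Rpower (Rabs t) s').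
    { rewrite <- Rpower_Rinv by lra. rewrite Rpower_mult_distr by (try lra; apply Rinv_0_lt_compat; lra).
      rewrite <- (Rpower_base_1 s'). apply Rle_Rpower_l; [lra|]. split; [lra|].
      apply Rmult_le_reg_l with de; [lra|]. rewrite <- Rmult_assoc, Rinv_r by lra. lra. }
    eapply Rle_trans; [apply Cmod_minus_le|].
    assert (T1 := HB (x0 + t)). assert (T2 := HQB t). rewrite <- HQ in T2.
    assert (0 <= A1 * Rpower (Rabs t) s') by (apply Rmult_le_pos; lra).
    assert ((B + B') * 1 <= A2 * Rpower (Rabs t) s').
    { unfold A2. rewrite Rmult_assoc. apply Rmult_le_compat_l; lra. }
    lra.
Qed.

(** Pair f_alpha minus the trigonometric polynomial with the kernel of [abel_kernel].  On the Fourier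
    side this is f(x0 + iy) - a_0 up to a finite sum that stays bounded as y tends to 0.  The
    integrand is at most a multiple of (|t| + y)^(s'-alpha-1), and s' < alpha makes its integral
    O(y^(s'-alpha)). *)
Lemma form_bound_of_Holder (f : C -> C) (a : nat -> C) (rho alpha x0 s s' : R) :
  fourier_expansion f a -> fourier_sums_bounded a rho -> rho < alpha -> 0 <= alpha ->
  Holder_class s x0 (f_alpha a alpha) -> 0 < s' <= s -> s' < alpha ->
  exists A, 0 <= A /\ forall y, 0 < y <= 1 -> Cmod (f (x0, y)) <= A * Rpower y (s' - alpha).
Proof.
  intros Hf Ha Hra Halpha Hh Hs Hs'.
  destruct (fourier_uniform_bounded _ _ (f_alpha_fourier_uniform a rho alpha 0 Ha Hra)) as [B [HB HBb]].
  destruct (Holder_class_trig_poly (f_alpha a alpha) x0 s s' B) as [N [q [A [Hq [HA Hb]]]]]; auto.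
  { intros x. specialize (HBb x). now rewrite Rplus_0_l in HBb. }
  assert (HF := fourier_uniform_minus _ _ _ _ (f_alpha_fourier_uniform a rho alpha x0 Ha Hra) (trig_poly_fourier N q Hq)).
  destruct (fourier_uniform_bounded _ _ HF) as [B2 [_ HB2]].
  destruct (abel_kernel alpha Halpha) as [D [HD HK]].
  set (m := coefficient_mass (fun n => RtoC (npow alpha n) * q n)%C N).
  set (e1 := s' - alpha). assert (He1 : e1 < 0) by (unfold e1; lra).
  set (A1 := D * A * (2 * / - e1)).
  assert (Hie : 0 < / - e1) by (apply Rinv_0_lt_compat; lra).
  assert (HA1 : 0 <= A1) by (unfold A1; apply Rmult_le_pos; [apply Rmult_le_pos|]; lra).
  assert (Hm : 0 <= m).
  { assert (T := coefficient_mass_bound (fun n => RtoC (npow alpha n) * q n)%C (fun _ => RtoC 0) 0 N ltac:(lia)).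
    eapply Rle_trans; [apply Cmod_ge_0|]. eapply Rle_trans; [apply T|].
    - intros i. rewrite Cmod_0. apply Cmod_ge_0.
    - unfold m, coefficient_mass at 2. simpl. lra. }
  exists (A1 + Cmod (a O) + m). split; [assert (T := Cmod_ge_0 (a O)); lra|].
  intros y Hy. destruct (HK y Hy) as [K [d [Hd [HKd HKb]]]].
  set (w := fun n => exp (- (2 * PI * (INR n * y)))).
  assert (Hw : forall n, 0 < w n <= 1).
  { intros n. split; [apply exp_pos|]. rewrite <- exp_0. apply exp_le_compat.
    assert (T := PI_RGT_0). assert (0 <= PI * (INR n * y)); [|lra].
    apply Rmult_le_pos; [lra|]. apply Rmult_le_pos; [apply pos_INR|lra]. }
  set (Rq := csum (fun n => RtoC (npow alpha n * w n) * q n)%C N).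
  assert (HRq : Cmod Rq <= m).
  { assert (T := coefficient_mass_bound (fun n => RtoC (npow alpha n) * q n)%C
      (fun n => RtoC (npow alpha n * w n) * q n)%C 0 N ltac:(lia)).
    simpl csum in T at 2. replace (csum (fun n => RtoC (npow alpha n * w n) * q n) N - 0)%C with Rq in T by (unfold Rq; ring).
    eapply Rle_trans; [apply T|].
    - intros i. rewrite RtoC_mult, !Cmod_mult. apply Rmult_le_compat_r; [apply Cmod_ge_0|].
      rewrite <- (Rmult_1_r (Cmod (RtoC (npow alpha i)))) at 2. apply Rmult_le_compat_l; [apply Cmod_ge_0|].
      destruct (Hw i). rewrite Cmod_R, Rabs_pos_eq; lra.
    - unfold m, coefficient_mass at 2. simpl. lra. }
  set (l := (f (x0, y) - a O - Rq)%C).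
  assert (Hl : Clim (csum (fun n => RtoC (npow alpha n * w n) *
      (RtoC (npow (- alpha) n) * (a n * cis (INR n * x0)) - q n))%C) l).
  { assert (HC := fourier_expansion_Clim f a x0 y Hf (proj1 Hy)).
    apply (Clim_incr _ _ (S N)).
    apply Clim_ext with (fun n => csum (fun n => a n * (RtoC (exp (- (2 * PI * (INR n * y)))) * cis (INR n * x0)))%C (n + S N)
       + (- a O - Rq))%C.
    (* The term n = 0 is split off: there npow vanishes and the coefficient is a_0. *)
    - intros n. rewrite Nat.add_succ_r.
      replace Rq with (csum (fun n => RtoC (npow alpha n * w n) * q n)%C (S (n + N))).
      2:{ apply csum_eventually_zero; [lia|]. intros i Hi. rewrite Hq by exact Hi. ring. }
      rewrite !(csum_first _ (n + N)).
      rewrite (csum_ext (fun i => RtoC (npow alpha (S i) * w (S i)) *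
            (RtoC (npow (- alpha) (S i)) * (a (S i) * cis (INR (S i) * x0)) - q (S i)))%C
        (fun i => a (S i) * (RtoC (exp (- (2 * PI * (INR (S i) * y)))) * cis (INR (S i) * x0)) +
           RtoC (-1) * (RtoC (npow alpha (S i) * w (S i)) * q (S i)))%C).
      + rewrite csum_plus, csum_scal. simpl npow. simpl INR.
        rewrite !Rmult_0_l, Rmult_0_r, Ropp_0, exp_0, cis_0. ring.
      + intros i _. fold (w (S i)).
        assert (E : (RtoC (npow alpha (S i) * w (S i)) * RtoC (npow (- alpha) (S i)) = RtoC (w (S i)))%C).
        { rewrite <- RtoC_mult. f_equal. unfold npow. rewrite Rpower_Ropp. field. apply Rgt_not_eq, Rpower_pos. }
        transitivity ((RtoC (npow alpha (S i) * w (S i)) * RtoC (npow (- alpha) (S i))) * (a (S i) * cis (INR (S i) * x0))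
          - RtoC (npow alpha (S i) * w (S i)) * q (S i))%C; [ring|]. rewrite E. ring.
    - unfold l. replace (f (x0, y) - a O - Rq)%C with (f (x0, y) + (- a O - Rq))%C by ring.
      apply Clim_plus; [|apply Clim_const]. now apply Clim_incr. }
  assert (HI := fourier_pairing _ _ _ K B2 d l HF HB2 Hd HKd Hl).
  assert (HDA : 0 < D * A) by now apply Rmult_lt_0_compat.
  apply (period_integral_peak_bound _ _ (D * A) y e1 HDA (proj1 Hy) ltac:(lra)) in HI.
  2:{ intros t Ht. rewrite Cmod_mult.
      replace (D * A * Rpower (Rabs t + y) (e1 - 1)) with
        ((D * Rpower (Rabs t + y) (- (alpha + 1))) * (A * Rpower (Rabs t + y) s')).
      2:{ replace (e1 - 1) with (- (alpha + 1) + s') by (unfold e1; ring). rewrite Rpower_plus. ring. }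
      apply Rmult_le_compat; try apply Cmod_ge_0.
      - apply HKb. lra.
      - eapply Rle_trans; [apply Hb; exact Ht|]. apply Rmult_le_compat_l; [lra|].
        apply Rle_Rpower_l; lra. }
  assert (Hl1 : Cmod l <= A1 * Rpower y e1).
  { eapply Rle_trans; [exact HI|]. unfold A1. rewrite (Rmult_assoc (D * A)). apply Rmult_le_compat_l; [lra|].
    rewrite Rmult_assoc. apply Rmult_le_compat_l; [lra|].
    replace ((Rpower (1 / 2 + y) e1 - Rpower y e1) / e1) with (/ - e1 * (Rpower y e1 - Rpower (1 / 2 + y) e1))
      by (field; lra).
    apply Rmult_le_compat_l; [lra|]. assert (T := Rpower_pos (1 / 2 + y) e1). lra. }
  assert (Hy1 : 1 <= Rpower y e1).
  { rewrite <- (Rpower_base_1 e1). apply Rpower_le_neg; lra. }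
  replace (f (x0, y)) with (l + (a O + Rq))%C by (unfold l; ring).
  eapply Rle_trans; [apply Cmod_triangle|].
  assert (T1 := Cmod_triangle (a O) Rq). assert (T2 := Cmod_ge_0 (a O)).
  assert ((Cmod (a O) + m) * 1 <= (Cmod (a O) + m) * Rpower y e1) by (apply Rmult_le_compat_l; lra).
  lra.
Qed.

(** Otherwise y^r f(x0 + iy) would be O(y^(r+e1)) with a positive exponent, and tend to 0. *)
Lemma not_cuspidal_lower_bound (f : C -> C) (r x0 A e1 : R) :
  not_cuspidal_at f r x0 -> 0 <= A ->
  (forall y, 0 < y <= 1 -> Cmod (f (x0, y)) <= A * Rpower y e1) -> r + e1 <= 0.
Proof.
  intros [c [Hc Hlim]] HA Hb. apply Rnot_lt_le. intros He.
  assert (Hc0 : 0 < Cmod c) by now apply Cmod_gt_0.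
  assert (Heps : 0 < Cmod c / 4) by lra.
  assert (HL : locally c (fun z : C => Cmod (c - z)%C < Cmod c / 2)).
  { exists (mkposreal _ Heps). intros z [Hz1 Hz2]. simpl in Hz1, Hz2.
    change (Rabs (fst z + - fst c) < Cmod c / 4) in Hz1.
    change (Rabs (snd z + - snd c) < Cmod c / 4) in Hz2.
    rewrite Cmod_minus_sym. eapply Rle_lt_trans; [apply Cmod_le_re_im|].
    change (Re (z - c)%C) with (fst z + - fst c). change (Im (z - c)%C) with (snd z + - snd c). lra. }
  destruct (Hlim _ HL) as [delta Hdelta].
  set (b := Cmod c / (2 * (A + 1))). assert (Hbp : 0 < b) by (apply Rdiv_lt_0_compat; lra).
  set (y := Rmin (Rmin (delta / 2) 1) (Rpower b (/ (r + e1)))).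
  assert (T0 := cond_pos delta).
  assert (Hy : 0 < y <= 1 /\ y < delta /\ Rpower y (r + e1) <= b).
  { assert (T1 := Rmin_l (Rmin (delta / 2) 1) (Rpower b (/ (r + e1)))).
    assert (T2 := Rmin_r (Rmin (delta / 2) 1) (Rpower b (/ (r + e1)))).
    assert (T3 := Rmin_l (delta / 2) 1). assert (T4 := Rmin_r (delta / 2) 1). fold y in T1, T2.
    assert (0 < y).
    { unfold y. apply Rmin_glb_lt; [apply Rmin_glb_lt; lra|apply Rpower_pos]. }
    repeat split; try lra.
    replace b with (Rpower (Rpower b (/ (r + e1))) (r + e1)).
    - apply Rle_Rpower_l; lra.
    - rewrite Rpower_mult, Rinv_l by lra. now apply Rpower_1. }
  destruct Hy as [Hy [Hyd Hyb]].
  assert (Hball : Cmod (c - RtoC (Rpower y r) * f (x0, y))%C < Cmod c / 2).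
  { apply Hdelta; [|lra]. unfold ball. simpl. unfold AbsRing_ball, abs, minus, plus, opp. simpl.
    rewrite Ropp_0, Rplus_0_r, Rabs_pos_eq; lra. }
  assert (Hsmall : Cmod (RtoC (Rpower y r) * f (x0, y))%C <= A * b).
  { rewrite Cmod_mult, Cmod_R, Rabs_pos_eq by (left; apply Rpower_pos).
    apply Rle_trans with (Rpower y r * (A * Rpower y e1)).
    - apply Rmult_le_compat_l; [left; apply Rpower_pos|auto].
    - replace (Rpower y r * (A * Rpower y e1)) with (A * (Rpower y r * Rpower y e1)) by ring.
      rewrite <- Rpower_plus. now apply Rmult_le_compat_l. }
  assert (HAb : A * b <= Cmod c / 2).
  { apply Rle_trans with ((A + 1) * b); [nra|]. right. unfold b. field. lra. }
  assert (T := Cmod_minus_triangle c (RtoC (Rpower y r) * f (x0, y)) 0).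
  replace (c - 0)%C with c in T by ring.
  replace (RtoC (Rpower y r) * f (x0, y) - 0)%C with (RtoC (Rpower y r) * f (x0, y))%C in T by ring.
  lra.
Qed.

Theorem theorem3p6 (G : mat2 -> Prop) (r alpha : R) (f : C -> C) (a : nat -> C)
    (p q : Z)
    (hG : congruence_group G)
    (hwidth : cusp_width G mat2_id 1)
    (hr : 0 < r)
    (hf : modular_form G r f)
    (ha : fourier_expansion f a)
    (halpha : r < alpha)
    (hfloor : 1 + IZR (Int_part (alpha - r)) <= alpha)
    (hq : (0 < q)%Z)
    (hpq : Z.gcd p q = 1%Z)
    (hcusp : not_cuspidal_at f r (IZR p / IZR q)) :
  Holder_exponent (f_alpha a alpha) (IZR p / IZR q) = Finite (alpha - r).
Proof.
  set (x0 := IZR p / IZR q) in *.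
  destruct (modular_form_growth G r f hG hr hf) as [B [HB Hgrowth]].
  assert (Hsums : forall rho, r < rho -> fourier_sums_bounded a rho).
  { intros rho Hrho. replace rho with (r + (rho - r)) by ring.
    apply (fourier_sum_growth f a r (rho - r) B); auto. lra. }
  unfold Holder_exponent. apply is_lub_Rbar_unique. split.
  - intros s [Hs Hclass]. simpl. apply Rnot_lt_le. intros Hlt.
    (* Lowering the exponent below alpha makes the kernel integrable against it with a gain in y. *)
    set (s' := (alpha - r + Rmin s alpha) / 2).
    assert (Hs' : alpha - r < s' < alpha /\ s' <= s).
    { unfold s'. assert (T1 := Rmin_l s alpha). assert (T2 := Rmin_r s alpha).
      assert (alpha - r < Rmin s alpha) by (apply Rmin_glb_lt; lra). lra. }
    destruct (form_bound_of_Holder f a ((r + alpha) / 2) alpha x0 s s' ha) as [A [HA Hb]]; try lra; auto.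
    { apply Hsums. lra. }
    assert (T := not_cuspidal_lower_bound f r x0 A (s' - alpha) hcusp HA Hb). lra.
  - intros b Hb. destruct b as [b| |]; simpl; auto.
    + apply Rnot_lt_le. intros Hlt.
      set (s := (Rmax 0 b + (alpha - r)) / 2).
      assert (Hs : 0 <= s < alpha - r /\ b < s).
      { unfold s. assert (T1 := Rmax_l 0 b). assert (T2 := Rmax_r 0 b).
        assert (Rmax 0 b < alpha - r) by (apply Rmax_lub_lt; lra). lra. }
      assert (K := Hb s (conj (proj1 (proj1 Hs)) (f_alpha_Holder_class a r alpha x0 s Hsums (proj1 Hs)))).
      simpl in K. lra.
    + apply (Hb 0). split; [lra|]. apply (f_alpha_Holder_class a r); [exact Hsums|lra].
Qed.
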